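(* Let $T\colon X\to X$ be a continuous map on a compact metric space and let $\Phi=\{\phi_1,\ldots,\phi_d\}$ be a family of continuous functions $\phi_i\colon X\to\mathbb{R}$ such that the pair $(T,\Phi)$ is $C^r$ regular for some $r\ge2$. For each function $F\colon\mathbb{R}^d\to\mathbb{R}$ of class $C^r$, the following properties hold: 1. $K(F,\Phi)$ is a nonempty compact set; 2. $K(F,\Phi)$ is the set of maximizers of the function $z\mapsto h(z)+F(z)$ on $L(\Phi)$; 3. if $K(F,\Phi)\subset\operatorname{int}L(\Phi)$, then the equilibrium measures for $(F,\Phi)$ are the elements of $\{\nu_z:z\in K(F,\Phi)\}$, where each $\nu_z\in\mathcal{M}$ is an ergodic measure that is the unique equilibrium measure (with respect to the classical topological pressure) for some function $\psi_z\in\operatorname{span}\{\phi_1,\ldots,\phi_d,1\}$.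
   Context: $\mathcal{M}$ is the set of $T$-invariant Borel probability measures on $X$ with the weak$^*$ topology, $h_\mu(T)$ is the Kolmogorov–Sinai entropy, and $\int_X\Phi\,d\mu=\left(\int_X\phi_1\,d\mu,\ldots,\int_X\phi_d\,d\mu\right)$. Let $$L(\Phi)=\left\{\int_X\Phi\,d\mu:\mu\in\mathcal{M}\right\}\subset\mathbb{R}^d,\qquad \mathcal{M}(z)=\left\{\mu\in\mathcal{M}:\int_X\Phi\,d\mu=z\right\},$$ and define $h\colon L(\Phi)\to\mathbb{R}$ by $h(z)=\sup\{h_\mu(T):\mu\in\mathcal{M}(z)\}$. Let $d$ also denote the metric of $X$. For $n\in\mathbb{N}$ let $d_n(x,y)=\max\{d(T^k(x),T^k(y)):k=0,\ldots,n-1\}$; a set $E\subset X$ is $(n,\epsilon)$-separated if $d_n(x,y)>\epsilon$ for all $x,y\in E$ with $x\ne y$. With $S_n\phi=\sum_{k=0}^{n-1}\phi\circ T^k$, the nonlinear topological pressure of $\Phi$ is $$P_F(\Phi)=\lim_{\epsilon\to0}\limsup_{n\to\infty}\frac1n\log\sup_E\sum_{x\in E}\exp\left[nF\left(\frac{S_n\phi_1(x)}{n},\ldots,\frac{S_n\phi_d(x)}{n}\right)\right],$$ with the supremum over all $(n,\epsilon)$-separated sets $E$. A measure $\nu\in\mathcal{M}$ is an equilibrium measure for $(F,\Phi)$ if $P_F(\Phi)=h_\nu(T)+F\left(\int_X\Phi\,d\nu\right)$, and $$K(F,\Phi)=\left\{\int_X\Phi\,d\mu:\mu\text{ is an equilibrium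 measure for }(F,\Phi)\right\}\subset L(\Phi).$$ The classical topological pressure of a continuous $\psi\colon X\to\mathbb{R}$ is denoted $P(\psi)$; it satisfies $P(\psi)=\sup_{\mu\in\mathcal{M}}\left(h_\mu(T)+\int_X\psi\,d\mu\right)$, and a classical equilibrium measure for $\psi$ is a $\mu\in\mathcal{M}$ attaining this supremum. The pair $(T,\Phi)$ is $C^r$-regular (for some $2\le r\le\omega$, where $\omega$ refers to the analytic case) if: (i) each function in $\operatorname{span}\{\phi_1,\ldots,\phi_d,1\}$ has a unique equilibrium measure with respect to the classical topological pressure; (ii) for each $z\in\operatorname{int}L(\Phi)$ the map $q\mapsto P(\langle q,\Phi-z\rangle)$ is of class $C^r$, is strictly convex, and its second derivative is a positive definite bilinear form for each $q\in\mathbb{R}^d$, where $\langle\cdot,\cdot\rangle$ is the usual inner product; (iii) the entropy map $\mu\mapsto h_\mu(T)$ is upper semicontinuous on $\mathcal{M}$. *)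

(* Defs.v *)
(* MathComp-Analysis, over an arbitrary [R : realType] *)
From HB Require Import structures.
From mathcomp Require Import all_boot all_order all_algebra.
From mathcomp Require Import all_classical all_reals all_analysis.

Set Implicit Arguments.
Unset Strict Implicit.
Unset Printing Implicit Defensive.

Import Order.TTheory GRing.Theory Num.Theory.
Import numFieldNormedType.Exports.

Local Open Scope classical_set_scope.
Local Open Scope ring_scope.

(* The library's measurable types are pointed, so a metric space carrying
   measures comes with a base point, which plays no further role. *)
#[short(type="pmetricType")]
HB.structure Definition PointedMetric (R : numDomainType) :=
  {X of Metric R X & Pointed X}.

Section Smoothness.
Variables (R : realType) (d : nat).
Implicit Types (f : 'rV[R]_d -> R) (x v w : 'rV[R]_d).

Definition partial (i : 'I_d) f : 'rV[R]_d -> R :=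
  fun x => 'D_(delta_mx ord0 i) f x.

Fixpoint Ck (k : nat) f : Prop :=
  if k is k'.+1 then
    (forall x, differentiable f x) /\ forall i, Ck k' (partial i f)
  else continuous f.

(* Power series in several variables are summed by total degree. A multi-index
   of degree n has entries at most n, so the finite sums below range over all
   multi-indices of degree n. *)
Definition monomial_term (c : {ffun 'I_d -> nat} -> R) v (n : nat)
    (a : {ffun 'I_d -> 'I_n.+1}) : R :=
  c [ffun i => nat_of_ord (a i)] * \prod_i v ord0 i ^+ a i.

Definition homogeneous_part (c : {ffun 'I_d -> nat} -> R) v (n : nat) : R :=
  \sum_(a : {ffun 'I_d -> 'I_n.+1} | (\sum_i a i == n)%N) monomial_term c v a.

Definition homogeneous_abs (c : {ffun 'I_d -> nat} -> R) v (n : nat) : R :=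
  \sum_(a : {ffun 'I_d -> 'I_n.+1} | (\sum_i a i == n)%N) `|monomial_term c v a|.

Definition real_analytic f : Prop :=
  forall x, exists c : {ffun 'I_d -> nat} -> R, exists2 e : R, 0 < e &
    forall v, `|v| < e ->
      cvgn (series (homogeneous_abs c v)) /\
      series (homogeneous_part c v) @ \oo --> f (x + v).

Definition strictly_convex f : Prop :=
  forall x y (t : R), x != y -> 0 < t < 1 ->
    f (t *: x + (1 - t) *: y) < t * f x + (1 - t) * f y.

Definition second_derivative f x v w : R := 'D_v (fun y => 'D_w f y) x.

Definition positive_definite (b : 'rV[R]_d -> 'rV[R]_d -> R) : Prop :=
  forall v, v != 0 -> 0 < b v v.

End Smoothness.

Inductive smoothness := Cfin of nat | Cinfty | Comega.

Definition smoothness_ge2 (r : smoothness) : bool :=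
  if r is Cfin k then (2 <= k)%N else true.

Definition Cr (R : realType) (d : nat) (r : smoothness) (f : 'rV[R]_d -> R)
    : Prop :=
  match r with
  | Cfin k => Ck k f
  | Cinfty => forall k, Ck k f
  | Comega => real_analytic f
  end.

Section Entropy.
Context (R : realType) (dX : measure_display) (X : measurableType dX).
Variables (T : X -> X) (mu : probability X R).

Definition finite_partition (k : nat) (A : 'I_k -> set X) : Prop :=
  [/\ forall i, measurable (A i), trivIset setT A & \bigcup_i A i = setT].

(* Since [ln 0 = 0], null atoms contribute 0. *)
Definition partition_entropy (I : finType) (A : I -> set X) : R :=
  - \sum_(i : I) fine (mu (A i)) * ln (fine (mu (A i))).

(* The atoms, indexed by words of length n, of the join of the partitions
   T^-j A for j < n. *)
Definition dynamical_join (k : nat) (A : 'I_k -> set X) (n : nat)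
    (w : {ffun 'I_n -> 'I_k}) : set X :=
  \bigcap_(j in [set: 'I_n]) (iter j T @^-1` A (w j)).

Definition entropy_wrt (k : nat) (A : 'I_k -> set X) : R :=
  limn (fun n : nat => n%:R^-1 * partition_entropy (@dynamical_join k A n)).

Definition ks_entropy : \bar R :=
  ereal_sup [set e | exists k : nat, exists2 A : 'I_k -> set X,
                       finite_partition A & e = (entropy_wrt A)%:E].

Definition invariant_measure : Prop :=
  forall A : set X, measurable A -> mu (T @^-1` A) = mu A.

Definition ergodic_measure : Prop :=
  invariant_measure /\
  forall A : set X, measurable A -> T @^-1` A = A ->
    mu A = 0%E \/ mu A = 1%E.

End Entropy.

Section Pressure.
Context (R : realType) (X : pmetricType R).
Variable T : X -> X.

Definition Borel := g_sigma_algebraType (@open X).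

(* A library measure is a function on all sets, constrained only on the
   measurable ones; equality of Borel measures is equality on Borel sets. *)
Definition same_measure (mu nu : probability Borel R) : Prop :=
  forall A : set Borel, measurable A -> mu A = nu A.

(* The coarsest topology making mu |-> \int f dmu continuous for every
   continuous f. *)
Definition weak_star_topology : topologicalType :=
  initial_topology (fun mu : probability Borel R =>
    (fun f : continuousType X R => \int[mu]_(x in [set: Borel]) f x)
      : {ptws continuousType X R -> R}).

Definition invariant_measures : set (probability Borel R) :=
  [set mu | invariant_measure (T : Borel -> Borel) mu].

Definition entropy (mu : probability Borel R) : \bar R :=
  ks_entropy (T : Borel -> Borel) mu.

Definition entropy_usc : Prop :=
  forall mu : weak_star_topology, invariant_measures mu ->
    forall c : R, (entropy mu < c%:E)%E ->
    \forall nu \near mu, invariant_measures nu -> (entropy nu < c%:E)%E.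

Definition bowen_dist (n : nat) (x y : X) : R :=
  \big[Num.max/0]_(k < n) mdist (iter k T x) (iter k T y).

Definition dyn_separated (n : nat) (e : R) (E : set X) : Prop :=
  forall x y, E x -> E y -> x != y -> e < bowen_dist n x y.

Definition birkhoff_sum (n : nat) (phi : X -> R) (x : X) : R :=
  \sum_(k < n) phi (iter k T x).

(* lim_{e -> 0} limsup_n (1/n) log sup_E \sum_{x in E} exp (w n x) *)
Definition separated_growth (w : nat -> X -> R) : \bar R :=
  lim ((fun e : R =>
    limn_esup (fun n : nat =>
      (n%:R^-1)%:E *
      lne (ereal_sup [set (\esum_(x in E) (expR (w n x))%:E)%E
                     | E in dyn_separated n e]))%E) @ 0^'+).

Definition pressure (psi : X -> R) : \bar R :=
  separated_growth (fun n => birkhoff_sum n psi).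

Definition classical_equilibrium (psi : X -> R) (mu : probability Borel R)
    : Prop :=
  invariant_measures mu /\
  (entropy mu + (\int[mu]_(x in [set: Borel]) psi x)%:E)%E =
  ereal_sup [set (entropy nu + (\int[nu]_(x in [set: Borel]) psi x)%:E)%E
            | nu in invariant_measures].

Definition unique_classical_equilibrium (psi : X -> R)
    (mu : probability Borel R) : Prop :=
  classical_equilibrium psi mu /\
  forall nu, classical_equilibrium psi nu -> same_measure nu mu.

Variables (d : nat) (Phi : 'I_d -> X -> R).

Definition integral_vec (mu : probability Borel R) : 'rV[R]_d :=
  \row_i \int[mu]_(x in [set: Borel]) Phi i x.

Definition L_set : set 'rV[R]_d :=
  [set integral_vec mu | mu in invariant_measures].

Definition M_fiber (z : 'rV[R]_d) : set (probability Borel R) :=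
  [set mu | invariant_measures mu /\ integral_vec mu = z].

Definition h_sup (z : 'rV[R]_d) : \bar R :=
  ereal_sup [set entropy mu | mu in M_fiber z].

Definition span1 : set (X -> R) :=
  [set psi | exists (a : 'I_d -> R) (c : R),
               psi = (fun x => \sum_i a i * Phi i x + c)].

Definition inner_shift (q z : 'rV[R]_d) (x : X) : R :=
  \sum_i q ord0 i * (Phi i x - z ord0 i).

Definition regular_pair (r : smoothness) : Prop :=
  [/\ forall psi, span1 psi ->
        exists mu, unique_classical_equilibrium psi mu,
      forall z, (L_set)° z ->
        let p := fun q : 'rV[R]_d => fine (pressure (inner_shift q z)) in
        [/\ forall q, pressure (inner_shift q z) \is a fin_num,
            Cr r p,
            strictly_convex p &
            forall q, positive_definite (second_derivative p q)]
    & entropy_usc].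

Variable F : 'rV[R]_d -> R.

Definition nonlinear_pressure : \bar R :=
  separated_growth (fun n x =>
    n%:R * F (\row_i (birkhoff_sum n (Phi i) x / n%:R))).

Definition nonlinear_equilibrium (nu : probability Borel R) : Prop :=
  invariant_measures nu /\
  nonlinear_pressure = (entropy nu + (F (integral_vec nu))%:E)%E.

Definition K_set : set 'rV[R]_d :=
  [set integral_vec mu | mu in [set mu | nonlinear_equilibrium mu]].

End Pressure.

(* Main.v *)
(* Write I(mu) for the integral vector of mu. The heart of the matter is the
   variational principle P_F = sup { h_mu + F(I mu) : mu invariant }.

   Upper bound: Misiurewicz's argument, applied to separated points whose
   Birkhoff averages of Phi lie in one small ball, chosen by pigeonhole over a
   finite cover of the range of these averages. The weak* limit mu then has
   I(mu) in this ball.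

   Lower bound, for ergodic mu: almost all points have Birkhoff averages close
   to I(mu), and there are about exp(n h_mu) separated ones among them.

   To pass from ergodic to invariant mu, no ergodic decomposition is needed.
   The unique equilibrium measure e(q) of <q, Phi - z> is ergodic, because the
   entropy is affine. With z = I(mu) and p(q) the pressure of <q, Phi - z>,
   the minimiser q of p(q) + delta |q|^2 / 2 satisfies I(e(q)) - z = - delta q,
   because limits of equilibrium measures are again equilibrium measures and
   hence unique. It follows that h_{e(q)} >= h_mu while I(e(q)) tends to z as
   delta tends to 0. For z in the interior of L(Phi), delta = 0 is allowed and
   e(q) is the measure nu_z. If some entropy is infinite, uniqueness forces all
   invariant measures to coincide.

   Everything else is compactness of the set of invariant measures and upper
   semicontinuity of the entropy. Weak* limits are taken along ultrafilters;
   the limit measure is built from the limit of the integrals by the Riesz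
   representation theorem. *)
Require Import Defs.
From HB Require Import structures.
From mathcomp Require Import all_boot all_order all_algebra.
From mathcomp Require Import finmap.
From mathcomp Require Import all_classical all_reals all_analysis.
From mathcomp Require Import measurable_realfun ring lra.
Import Order.TTheory GRing.Theory Num.Theory.
Import numFieldNormedType.Exports.
Local Open Scope classical_set_scope.
Local Open Scope ring_scope.
Set Implicit Arguments.
Unset Strict Implicit.
Unset Printing Implicit Defensive.

(** The weight [n F(S_n Phi / n)] is not a Birkhoff sum, so it cannot be integrated against a limit
    measure. The pigeonhole step makes it almost constant on the chosen points, and only
    cardinalities remain to be compared with entropy. Partitions are treated as maps into finite
    types and their entropies as entropies of laws. Every entropy inequality then comes from Gibbs'
    inequality on a finite set. In the lower bound Gibbs' inequality also does the work of the
    Shannon-McMillan-Breiman theorem: large entropy forces many words among typical points. The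
    coding loses a bounded amount per symbol; taking blocks of a long fixed length [m] as symbols
    makes this loss small per unit of time. The square [delta |q|^2 / 2] is added because [z] may
    lie on the boundary of L(Phi), where [p] need not attain its infimum. At the minimiser the
    derivative of [p] is replaced by subgradients at nearby points, which converge because
    equilibrium measures are unique. *)

(** * Entropy of distributions on finite sets *)

Section FiniteEntropy.
Context {R : realType}.
Implicit Types (W I J : finType).

Definition ent I (m : I -> R) : R := - \sum_i m i * ln (m i).

(** The law of the random variable [f] under [p]. A join of partitions becomes a pair of random
    variables, a coarser partition a composition. *)
Definition marginal W I (p : W -> R) (f : W -> I) (i : I) : R :=
  \sum_(w | f w == i) p w.

Definition fin_prob W (p : W -> R) : Prop :=
  (forall w, 0 <= p w) /\ \sum_w p w = 1.

Lemma ln_le_subr1 (x : R) : 0 < x -> ln x <= x - 1.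
Proof.
move=> x0; have := @le_ln1Dx R (x - 1).
by rewrite (addrC 1) subrK; apply; lra.
Qed.

Lemma sum_marginal W I (p : W -> R) (f : W -> I) (phi : I -> R) :
  \sum_w p w * phi (f w) = \sum_i marginal p f i * phi i.
Proof.
rewrite (partition_big f predT)//=; apply: eq_bigr => i _.
by rewrite /marginal mulr_suml; apply: eq_bigr => w /eqP ->.
Qed.

Lemma marginal_ge0 W I (p : W -> R) (f : W -> I) :
  (forall w, 0 <= p w) -> forall i, 0 <= marginal p f i.
Proof. by move=> p0 i; exact: sumr_ge0. Qed.

Lemma marginal_prob W I (p : W -> R) (f : W -> I) :
  fin_prob p -> fin_prob (marginal p f).
Proof.
move=> [p0 p1]; split=> [|]; first exact: marginal_ge0.
rewrite -p1; have := sum_marginal p f (fun=> 1).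
by under eq_bigr do rewrite mulr1; under [RHS]eq_bigr do rewrite mulr1.
Qed.

Lemma le_marginal W I (p : W -> R) (f : W -> I) w :
  (forall w, 0 <= p w) -> p w <= marginal p f (f w).
Proof.
by move=> p0; rewrite /marginal (bigD1 w)//= lerDl sumr_ge0.
Qed.

Lemma marginal_comp W I J (p : W -> R) (f : W -> I) (g : I -> J) :
  marginal (marginal p f) g = marginal p (g \o f).
Proof.
apply/funext => j; rewrite /marginal (partition_big f (fun i => g i == j))//=.
apply: eq_bigr => i /eqP gi; apply: eq_bigl => w.
by case: eqP => [->|]; rewrite ?andbF// gi eqxx.
Qed.

Lemma ent_marginal W I (p : W -> R) (f : W -> I) :
  ent (marginal p f) = - \sum_w p w * ln (marginal p f (f w)).
Proof. by rewrite /ent -sum_marginal. Qed.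

(** Gibbs' inequality, from [ln x <= x - 1] at the ratio of [r] to the law of [f]. The mass of [r]
    may be less than 1, and [r] need be positive only where [p] charges. *)
Lemma gibbs W I (p : W -> R) (f : W -> I) (r : I -> R) :
  fin_prob p -> (forall i, 0 <= r i) -> \sum_i r i <= 1 ->
  (forall w, 0 < p w -> 0 < r (f w)) ->
  ent (marginal p f) <= - \sum_w p w * ln (r (f w)).
Proof.
move=> [p0 p1] r0 r1 rpos; rewrite ent_marginal lerN2 -subr_le0 -sumrB.
pose m := marginal p f.
have m0 i : 0 <= m i by exact: marginal_ge0.
apply: (@le_trans _ _ (\sum_w p w * (r (f w) / m (f w) - 1))).
  apply: ler_sum => w _; have [pw|pw] := ltrP 0 (p w); last first.
    have -> : p w = 0 by apply/eqP; rewrite eq_le pw p0.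
    by rewrite !mul0r subr0.
  have mw : 0 < m (f w) by rewrite (lt_le_trans pw)// le_marginal.
  rewrite -mulrBr ler_pM2l// -ln_div ?posrE ?rpos//.
  by apply: ln_le_subr1; rewrite divr_gt0 ?rpos.
under eq_bigr do rewrite mulrBr mulr1.
rewrite sumrB p1 subr_le0 (sum_marginal p f (fun i => r i / m i)).
apply: le_trans r1; apply: ler_sum => i _; rewrite -/(m i).
have [->|mi] := eqVneq (m i) 0; first by rewrite mul0r.
by rewrite mulrCA divff// mulr1.
Qed.

(** The fibre of [g \o f] through a point contains that of [f], so the inequality holds for the
    logarithms point by point. *)
Lemma ent_comp_le W I J (p : W -> R) (f : W -> I) (g : I -> J) :
  fin_prob p -> ent (marginal p (g \o f)) <= ent (marginal p f).
Proof.
move=> [p0 p1]; rewrite !ent_marginal lerN2; apply: ler_sum => w _.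
have [pw|pw] := ltrP 0 (p w); last first.
  by have -> : p w = 0; [apply/eqP; rewrite eq_le pw p0|rewrite !mul0r].
have mw : 0 < marginal p f (f w) by rewrite (lt_le_trans pw)// le_marginal.
have le_m : marginal p f (f w) <= marginal p (g \o f) (g (f w)).
  by rewrite -marginal_comp le_marginal//; exact: marginal_ge0.
by rewrite ler_pM2l// ler_ln ?posrE// (lt_le_trans mw).
Qed.

(** Gibbs' inequality against the product of the two marginals. *)
Lemma ent_pair_le W I J (p : W -> R) (f : W -> I) (g : W -> J) :
  fin_prob p -> ent (marginal p (fun w => (f w, g w))) <=
  ent (marginal p f) + ent (marginal p g).
Proof.
move=> pp; have [p0 p1] := pp.
have [mf0 mf1] := marginal_prob f pp; have [mg0 mg1] := marginal_prob g pp.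
have fpos w : 0 < p w -> 0 < marginal p f (f w).
  by move=> pw; rewrite (lt_le_trans pw)// le_marginal.
have gpos w : 0 < p w -> 0 < marginal p g (g w).
  by move=> pw; rewrite (lt_le_trans pw)// le_marginal.
apply: le_trans (gibbs (r := fun ij => marginal p f ij.1 * marginal p g ij.2)
  pp _ _ _) _ => /=.
- by move=> ij; rewrite mulr_ge0.
- rewrite -(pair_bigA _ (fun i j => marginal p f i * marginal p g j))/=.
  under eq_bigr do rewrite -mulr_sumr mg1 mulr1.
  by rewrite mf1.
- by move=> w pw; rewrite mulr_gt0 ?fpos ?gpos.
- rewrite !ent_marginal -opprD -big_split/= lerN2; apply: ler_sum => w _.
  have [pw|pw] := ltrP 0 (p w); last first.
    have -> : p w = 0 by apply/eqP; rewrite eq_le pw p0.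
    by rewrite !mul0r addr0.
  by rewrite -mulrDr lnM ?posrE ?fpos ?gpos.
Qed.

(** Gibbs' inequality against the uniform distribution. *)
Lemma ent_le_ln_card I (m : I -> R) : fin_prob m -> ent m <= ln #|I|%:R.
Proof.
move=> mm; have [m0 m1] := mm.
have I0 : (0 < #|I|)%N.
  rewrite lt0n; apply/eqP => I0; have := oner_neq0 R; rewrite -m1 big1 ?eqxx//.
  by move=> i _; have := card0_eq I0 i; rewrite inE.
have mE : m = marginal m id.
  by apply/funext => i; rewrite /marginal big_pred1_eq.
rewrite [in leLHS]mE; apply: le_trans (gibbs (r := fun=> #|I|%:R^-1) mm _ _ _) _.
- by move=> i; rewrite invr_ge0.
- by rewrite sumr_const -[_ *+ #|_|]mulr_natr cardT -cardE mulVf// pnatr_eq0 -lt0n.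
- by move=> i _; rewrite invr_gt0 ltr0n.
- rewrite -mulr_suml m1 mul1r lnV ?opprK// posrE ltr0n//.
Qed.

Lemma ent_ge0 I (m : I -> R) : fin_prob m -> 0 <= ent m.
Proof.
move=> [m0 m1]; rewrite /ent oppr_ge0; apply: sumr_le0 => i _.
rewrite mulr_ge0_le0// ln_le0// -m1 (bigD1 i)//= lerDl sumr_ge0//.
Qed.

Lemma uniform_prob W : (0 < #|W|)%N -> fin_prob (fun _ : W => #|W|%:R^-1 : R).
Proof.
move=> W0; split=> [w|]; first by rewrite invr_ge0.
by rewrite sumr_const -[_ *+ #|_|]mulr_natr cardT -cardE mulVf// pnatr_eq0 -lt0n.
Qed.

Lemma ent_uniform_inj W I (f : W -> I) : (0 < #|W|)%N -> injective f ->
  ent (marginal (fun=> #|W|%:R^-1 : R) f) = ln #|W|%:R.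
Proof.
move=> W0 finj; rewrite ent_marginal.
under eq_bigr => w _.
  rewrite /marginal (eq_bigl (fun v => v == w)); last first.
    by move=> v; rewrite (inj_eq finj).
  rewrite big_pred1_eq lnV ?posrE ?ltr0n// mulrN.
  over.
rewrite sumrN opprK -mulr_suml (uniform_prob W0).2 mul1r//.
Qed.

(** Gibbs' inequality for each [m s] against the mixture, averaged with weights [a]. *)
Lemma ent_concave (S I : finType) (a : S -> R) (m : S -> I -> R) : fin_prob a ->
  (forall s, fin_prob (m s)) ->
  \sum_s a s * ent (m s) <= ent (fun i => \sum_s a s * m s i).
Proof.
move=> [a0 a1] mm; set M := (fun i => \sum_s a s * m s i).
have M0 i : 0 <= M i by apply: sumr_ge0 => s _; rewrite mulr_ge0// (mm s).1.
have M1 : \sum_i M i = 1.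
  rewrite exchange_big/= -a1; apply: eq_bigr => s _.
  by rewrite -mulr_sumr (mm s).2 mulr1.
rewrite /ent [leRHS](_ : _ = \sum_s a s * - \sum_i m s i * ln (M i)); last first.
  transitivity (- \sum_i \sum_s a s * (m s i * ln (M i))).
    congr (- _); apply: eq_bigr => i _; rewrite /M mulr_suml.
    by apply: eq_bigr => s _; rewrite mulrA.
  rewrite exchange_big/= -sumrN; apply: eq_bigr => s _.
  by rewrite mulrN mulr_sumr.
apply: ler_sum => s _; have [as0|as0] := ltrP 0 (a s); last first.
  have -> : a s = 0 by apply/eqP; rewrite eq_le as0 a0.
  by rewrite !mul0r.
rewrite ler_pM2l//.
have mE : m s = marginal (m s) id.
  by apply/funext => i; rewrite /marginal big_pred1_eq.
have := @gibbs _ _ (m s) id M (mm s) M0; rewrite M1 lexx => /(_ isT).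
rewrite -mE; apply => i mi; rewrite /M (bigD1 s)//= ltr_wpDr ?mulr_gt0//.
by apply: sumr_ge0 => t _; rewrite mulr_ge0// (mm t).1.
Qed.

(** Concavity fails to be equality by at most the entropy of the weights, because the mixture
    dominates [a * m] and [b * n]. This defect does not depend on [I], so it disappears in entropy
    per unit of time. *)
Lemma ent_mix_le I (a b : R) (m n : I -> R) : 0 < a -> 0 < b -> a + b = 1 ->
  fin_prob m -> fin_prob n ->
  ent (fun i => a * m i + b * n i) <=
  a * ent m + b * ent n + (- (a * ln a) - b * ln b).
Proof.
move=> a0 b0 ab [m0 m1] [n0 n1].
have aux (c : R) (l M : I -> R) : 0 < c -> (forall i, 0 <= l i) ->
    \sum_i l i = 1 -> (forall i, c * l i <= M i) ->
    - \sum_i c * l i * ln (M i) <= c * ent l - c * ln c.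
  move=> c0 l0 l1 lM; rewrite /ent mulrN -opprD lerN2.
  rewrite -[X in _ + X]mulr1 -l1 mulr_sumr [in leLHS]mulr_sumr -big_split/=.
  apply: ler_sum => i _; have [li|li] := ltrP 0 (l i); last first.
    have -> : l i = 0 by apply/eqP; rewrite eq_le li l0.
    by rewrite !(mul0r, mulr0) addr0.
  rewrite -!mulrA -mulrDr ler_pM2l// (mulrC (ln c)) -mulrDr ler_pM2l//.
  rewrite addrC -lnM ?posrE// ler_ln ?posrE ?mulr_gt0//.
  by rewrite (lt_le_trans _ (lM i))// mulr_gt0.
rewrite {1}/ent.
under eq_bigr do rewrite mulrDl.
rewrite big_split/= opprD [leRHS](_ : _ =
  (a * ent m - a * ln a) + (b * ent n - b * ln b)); last by ring.
apply: lerD.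
- apply: (aux a m (fun i => a * m i + b * n i)) => // i.
  by rewrite lerDl mulr_ge0// ltW.
- apply: (aux b n (fun i => a * m i + b * n i)) => // i.
  by rewrite lerDr mulr_ge0// ltW.
Qed.

End FiniteEntropy.

(** * Continuous functions on a metric space *)

Section ContinuousFunctions.
Context {R : realType} {X : metricType R}.
Implicit Types (f g : X -> R) (C U : set X).

Lemma continuous_mdistP f : continuous f <->
  forall x (e : R), 0 < e -> exists2 d : R, 0 < d &
    forall y, mdist x y < d -> `|f x - f y| < e.
Proof.
split=> [fc x e e0|fP x].
- have /cvgrPdist_lt/(_ e e0) := fc x.
  rewrite near_simpl => /nbhs_ballP[d /= d0 dP].
  by exists d => // y; have := dP y; rewrite ballEmdist.
- apply/cvgrPdist_lt => e /(fP x)[d d0 dP].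
  rewrite near_simpl; apply/nbhs_ballP; exists d => //= y.
  by rewrite ballEmdist => /dP.
Qed.

Lemma lipschitz_continuous f (K : R) : 0 <= K ->
  (forall x y, `|f x - f y| <= K * mdist x y) -> continuous f.
Proof.
move=> K0 fK; apply/continuous_mdistP => x e e0.
exists (e / (K + 1)) => [|y xy]; first by rewrite divr_gt0// ltr_pwDr.
rewrite (le_lt_trans (fK x y))//; move: xy; rewrite ltr_pdivlMr ?ltr_pwDr//.
by apply: le_lt_trans; rewrite mulrC ler_wpM2l ?mdist_ge0// lerDl.
Qed.

Lemma mdist_continuous (x : X) : continuous (mdist x).
Proof.
apply: (@lipschitz_continuous _ 1) => // y z; rewrite mul1r ler_norml.
have := metric_triangle x z y; have := metric_triangle x y z.
by rewrite (metric_sym z y) => *; apply/andP; split; lra.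
Qed.

Lemma continuous_sum (I : Type) (r : seq I) (P : pred I) (F : I -> X -> R) :
  (forall i, P i -> continuous (F i)) ->
  continuous (fun x => \sum_(i <- r | P i) F i x).
Proof.
move=> Fc; elim: r => [|i r IH].
  by under eq_fun do rewrite big_nil; exact: cst_continuous.
under eq_fun do rewrite big_cons.
have [Pi x|//] := boolP (P i); apply: cvgD; [exact: Fc|exact: IH].
Qed.

Lemma continuous_iter (T : X -> X) n : continuous T -> continuous (iter n T).
Proof.
move=> Tc; elim: n => [|n IH] x; first exact: cvg_id.
by apply: (@continuous_comp _ _ _ (iter n T) T); [exact: IH|exact: Tc].
Qed.

Lemma continuous_opp_fun f : continuous f -> continuous (fun x => - f x).
Proof. by move=> fc x; apply: cvgN; exact: fc. Qed.

Lemma continuous_scale_fun (a : R) f :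
  continuous f -> continuous (fun x => a * f x).
Proof. by move=> fc x; apply: cvgMr; exact: fc. Qed.

Lemma continuous_add_fun f g :
  continuous f -> continuous g -> continuous (fun x => f x + g x).
Proof. by move=> fc gc x; apply: cvgD; [exact: fc|exact: gc]. Qed.

Lemma continuous_sub_fun f g :
  continuous f -> continuous g -> continuous (fun x => f x - g x).
Proof. by move=> fc gc x; apply: cvgB; [exact: fc|exact: gc]. Qed.

Lemma continuous_mul_fun f g :
  continuous f -> continuous g -> continuous (fun x => f x * g x).
Proof. by move=> fc gc x; apply: cvgM; [exact: fc|exact: gc]. Qed.

Definition clamp (t : R) : R := Num.max 0 (Num.min t 1).

Lemma clamp_ge0 t : 0 <= clamp t. Proof. by rewrite le_max lexx. Qed.

Lemma clamp_le1 t : clamp t <= 1.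
Proof. by rewrite ge_max ler01/= ge_min lexx orbT. Qed.

Lemma clamp1 t : 1 <= t -> clamp t = 1.
Proof. by move=> t1; rewrite /clamp min_r// max_r. Qed.

Lemma clamp0 t : t <= 0 -> clamp t = 0.
Proof. by move=> t0; rewrite /clamp min_l ?max_l// (le_trans t0). Qed.

Lemma clamp_homo s t : s <= t -> clamp s <= clamp t.
Proof.
move=> st; rewrite /clamp; case: (leP s 1) => ?; case: (leP t 1) => ?;
by case: (leP 0 s) => ?; case: (leP 0 t) => ?; case: (leP (0 : R) 1) => ?; lra.
Qed.

Lemma continuous_clamp f : continuous f -> continuous (fun x => clamp (f x)).
Proof.
move=> /continuous_mdistP fc; apply/continuous_mdistP => x e /(fc x)[d d0 dP].
exists d => // y /dP; apply: le_lt_trans; rewrite /clamp.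
have := ler_norm (f x - f y); have := ler_norm (- (f x - f y)).
rewrite normrN ler_norml; case: (leP (f x) 1) => ?; case: (leP (f y) 1) => ?;
by case: (leP 0 (f x)) => ?; case: (leP 0 (f y)) => ?; case: (leP (0 : R) 1) => ? ? ?;
  apply/andP; split; lra.
Qed.

(** For empty [C] the value is 0, since [inf set0 = 0]; hence the separate empty cases below. *)
Definition set_dist C (x : X) : R := inf [set mdist x y | y in C].

Lemma set_dist_ge0 C x : 0 <= set_dist C x.
Proof.
have [->|/set0P[c Cc]] := eqVneq C set0.
  by rewrite /set_dist image_set0 inf0.
by apply: lb_le_inf; [exists (mdist x c), c|move=> _ [y _ <-]; exact: mdist_ge0].
Qed.

Lemma set_dist_le C x y : C y -> set_dist C x <= mdist x y.
Proof.
move=> Cy; apply: ge_inf; last by exists y.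
by exists 0 => _ [z _ <-]; exact: mdist_ge0.
Qed.

Lemma set_dist_continuous C : continuous (set_dist C).
Proof.
have [->|/set0P[c Cc]] := eqVneq C set0.
  rewrite (_ : set_dist _ = fun=> 0); first exact: cst_continuous.
  by apply/funext => x; rewrite /set_dist image_set0 inf0.
have tri x y : set_dist C x <= mdist x y + set_dist C y.
  rewrite -lerBlDl; apply: lb_le_inf; first by exists (mdist y c), c.
  move=> _ [z Cz <-]; rewrite lerBlDl.
  exact: le_trans (set_dist_le _ Cz) (metric_triangle _ _ _).
apply: (@lipschitz_continuous _ 1) => // x y; rewrite mul1r ler_norml.
have := tri x y; have := tri y x; rewrite (metric_sym y x) => *.
by apply/andP; split; lra.
Qed.

Lemma set_dist_gt0 U x : open U -> ~` U !=set0 -> U x -> 0 < set_dist (~` U) x.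
Proof.
move=> oU [c Uc] Ux; have : nbhs x U by exact: open_nbhs_nbhs.
move=> /nbhs_ballP[d /= d0]; rewrite ballEmdist => dU.
apply: lt_le_trans d0 _; apply: lb_le_inf; first by exists (mdist x c), c.
by move=> _ [y Uy <-]; rewrite leNgt; apply/negP => /dU.
Qed.

(** The functions are [n] times the distance to the complement, cut off at 1. At each point of [U]
    the value 1 is reached after finitely many steps, not only in the limit. *)
Lemma open_approx U : open U -> exists u : nat -> X -> R,
  [/\ forall n, continuous (u n), forall n x, 0 <= u n x <= 1,
      forall n x, u n x <= u n.+1 x, forall n x, ~ U x -> u n x = 0 &
      forall x, U x -> exists N, forall n, (N <= n)%N -> u n x = 1].
Proof.
move=> oU; have [UT|/set0P U0] := eqVneq (~` U) set0.
  have UxT x : U x by apply: contrapT => Ux; have : set0 x by rewrite -UT.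
  exists (fun _ _ => 1); split => //; first by move=> n; exact: cst_continuous.
    by move=> n x; rewrite ler01 lexx.
  by move=> x _; exists 0%N.
exists (fun n x => clamp (n%:R * set_dist (~` U) x)); split.
- move=> n; apply: continuous_clamp; apply: continuous_scale_fun.
  exact: set_dist_continuous.
- by move=> n x; rewrite clamp_ge0 clamp_le1.
- move=> n x; apply: clamp_homo; rewrite ler_wpM2r ?set_dist_ge0//.
  by rewrite ler_nat.
- move=> n x Ux; apply: clamp0.
  rewrite mulr_ge0_le0//; have := @set_dist_le (~` U) x x Ux.
  by rewrite mdistxx.
- move=> x Ux; have d0 := set_dist_gt0 oU U0 Ux.
  exists (Num.truncn ((set_dist (~` U) x)^-1)).+1 => n Nn; apply: clamp1.
  rewrite -ler_pdivrMr// mul1r; apply: le_trans (ltW (truncnS_gt _)) _.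
  by rewrite ler_nat.
Qed.

(** Dini's argument: each point has a neighbourhood on which one index works, and by monotonicity so
    do all later ones. *)
Lemma compact_monotone_cover (g : nat -> X -> R) (c : X -> R) :
  compact [set: X] -> (forall n, continuous (g n)) -> continuous c ->
  (forall n x, g n x <= g n.+1 x) -> (forall x, exists n, c x < g n x) ->
  exists n, forall x, c x < g n x.
Proof.
move=> cX gc cc gS gx; have gle n m x : (n <= m)%N -> g n x <= g m x.
  elim: m => [|m IH]; first by rewrite leqn0 => /eqP ->.
  by rewrite leq_eqVlt => /predU1P[->//|/IH/le_trans]; apply.
move/compact_near_coveringP: cX => /(_ nat \oo (fun n x => c x < g n x)) H.
have [x _|N _ /(_ N (leqnn N)) HN] := H _; last by exists N => x; exact: HN.
have [n cn] := gx x.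
exists ([set y | c y < g n y], [set m | (n <= m)%N]); last first.
  by move=> [y m] /= [cy nm]; exact: lt_le_trans cy (gle _ _ _ nm).
split; last by exists n.
have : continuous (fun y => g n y - c y) by exact: continuous_sub_fun.
move=> /(_ x)/cvgrPdist_lt /(_ (g n x - c x)); rewrite subr_gt0 => /(_ cn).
by apply: filterS => y /=; rewrite ltr_norml => /andP[_]; lra.
Qed.

End ContinuousFunctions.

(** * The Riesz representation theorem on a compact metric space *)

Section Riesz.
Context {R : realType} {X : pmetricType R}.
Implicit Types (f g : X -> R) (a : R).

(** A positive normalised linear functional on the continuous functions. Its argument is an
    arbitrary function, with continuity as a hypothesis, so that integrals and finite averages are
    states as they stand. *)
Definition is_state (L : (X -> R) -> R) : Prop :=
  [/\ forall f g, continuous f -> continuous g ->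
        L (fun x => f x + g x) = L f + L g,
      forall a f, continuous f -> L (fun x => a * f x) = a * L f,
      forall f, continuous f -> (forall x, 0 <= f x) -> 0 <= L f
    & L (fun=> 1) = 1].

Variable L : (X -> R) -> R.
Hypothesis state_L : is_state L.

Lemma stateD f g : continuous f -> continuous g ->
  L (fun x => f x + g x) = L f + L g.
Proof. by case: state_L => + _ _ _; exact. Qed.

Lemma stateZ a f : continuous f -> L (fun x => a * f x) = a * L f.
Proof. by case: state_L => _ + _ _; exact. Qed.

Lemma state_ge0 f : continuous f -> (forall x, 0 <= f x) -> 0 <= L f.
Proof. by case: state_L => _ _ + _; exact. Qed.

Lemma state1 : L (fun=> 1) = 1. Proof. by case: state_L. Qed.

Lemma stateB f g : continuous f -> continuous g ->
  L (fun x => f x - g x) = L f - L g.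
Proof.
move=> fc gc; rewrite -(mulN1r (L g)) -stateZ// -stateD//; last first.
  exact: continuous_scale_fun.
by congr L; apply/funext => x; rewrite mulN1r.
Qed.

Lemma le_state f g : continuous f -> continuous g ->
  (forall x, f x <= g x) -> L f <= L g.
Proof.
move=> fc gc fg; rewrite -subr_ge0 -stateB//; apply: state_ge0.
  exact: continuous_sub_fun.
by move=> x; rewrite subr_ge0.
Qed.

Lemma state_cst a : L (fun=> a) = a.
Proof.
rewrite -[RHS]mulr1 -state1 -stateZ; last exact: cst_continuous.
by congr L; apply/funext => x; rewrite mulr1.
Qed.

Lemma state_norm_le f (C : R) : continuous f -> (forall x, `|f x| <= C) ->
  `|L f| <= C.
Proof.
move=> fc fC; have cC a : continuous (fun _ : X => a) by exact: cst_continuous.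
rewrite ler_norml -[- C in X in X && _]state_cst -[C in X in _ && X]state_cst.
by apply/andP; split; apply: le_state => // x;
  have := fC x; rewrite ler_norml => /andP[].
Qed.

Lemma state_sum (I : Type) (r : seq I) (F : I -> X -> R) :
  (forall i, continuous (F i)) ->
  L (fun x => \sum_(i <- r) F i x) = \sum_(i <- r) L (F i).
Proof.
move=> Fc; elim: r => [|i r IH].
  rewrite big_nil; transitivity (L (fun=> 0)); last exact: state_cst.
  by congr L; apply/funext => x; rewrite big_nil.
rewrite big_cons -IH -stateD//; last by apply: continuous_sum.
by congr L; apply/funext => x; rewrite big_cons.
Qed.

(* Allowing increasing sequences instead of single functions makes the outer
   measure countably subadditive. *)
Definition covered (B : set X) (c : R) : Prop :=
  exists g : nat -> X -> R,
    [/\ forall n, continuous (g n), forall n x, 0 <= g n x,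
        forall n x, g n x <= g n.+1 x, forall n, L (g n) <= c &
        forall x, B x -> forall e : R, 0 < e -> exists n, 1 - e < g n x].

Definition outer_state (B : set X) : R := inf [set c | covered B c].

(** Carries the proof of [is_state L], so that the measure structures below can be attached to
    it. *)
Definition riesz (_ : is_state L) (B : set X) : \bar R := (outer_state B)%:E.

Local Notation mu := (riesz state_L).

Lemma covered1 B : covered B 1.
Proof.
exists (fun _ _ => 1); split=> //; first by move=> n; exact: cst_continuous.
  by move=> n; rewrite state1.
by move=> x _ e e0; exists 0%N; rewrite gtrBl.
Qed.

Lemma covered_ge0 B c : covered B c -> 0 <= c.
Proof.
by move=> [g [gc g0 _ gL _]]; apply: le_trans (gL 0%N); exact: state_ge0.
Qed.

Lemma le_covered B c c' : c <= c' -> covered B c -> covered B c'.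
Proof.
move=> cc' [g [gc g0 gS gL gB]]; exists g; split => // n.
exact: le_trans (gL n) cc'.
Qed.

Lemma has_inf_covered B : has_inf [set c | covered B c].
Proof.
split; first by exists 1; exact: covered1.
by exists 0 => c; exact: covered_ge0.
Qed.

Lemma outer_state_le B c : covered B c -> outer_state B <= c.
Proof. by move=> Bc; apply: ge_inf => //; exact: (has_inf_covered B).2. Qed.

Lemma outer_state_ge0 B : 0 <= outer_state B.
Proof.
apply: lb_le_inf; first exact: (has_inf_covered B).1.
by move=> c; exact: covered_ge0.
Qed.

Lemma covered_outer_state B e : 0 < e -> covered B (outer_state B + e).
Proof.
move=> e0; have [c Bc /ltW ce] := inf_adherent e0 (has_inf_covered B).
exact: le_covered ce Bc.
Qed.

Lemma le_outer_state A B : A `<=` B -> outer_state A <= outer_state B.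
Proof.
move=> AB; apply/ler_addgt0Pr => e e0; apply: outer_state_le.
have [g [gc g0 gS gL gB]] := covered_outer_state B e0.
by exists g; split => // x /AB; exact: gB.
Qed.

Let riesz0 : mu set0 = 0.
Proof.
congr EFin; apply/eqP; rewrite eq_le outer_state_ge0 andbT.
apply: outer_state_le; exists (fun _ _ => 0); split=> //.
  by move=> n; exact: cst_continuous.
by move=> n; rewrite state_cst.
Qed.

Let riesz_ge0 A : (0 <= mu A)%E.
Proof. by rewrite lee_fin outer_state_ge0. Qed.

Let le_riesz : {homo mu : A B / A `<=` B >-> (A <= B)%E}.
Proof. by move=> A B AB; rewrite lee_fin le_outer_state. Qed.

Let riesz_sigma_subadditive : sigma_subadditive mu.
Proof.
move=> F; apply/lee_addgt0Pr => e e0.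
have s0 : (0 <= \sum_(i <oo) mu (F i))%E by apply: nneseries_ge0.
case sE : (\sum_(i <oo) mu (F i))%E s0 => [s| |]// _; last by rewrite addye ?leey.
rewrite -EFinD lee_fin; apply: outer_state_le.
pose ei i := e / (2 ^+ i.+1).
have ei0 i : 0 < ei i by rewrite divr_gt0// exprn_gt0.
have ei_sum n : \sum_(i < n) ei i <= e.
  suff -> : \sum_(i < n) ei i = e - e / 2 ^+ n.
    by rewrite gerBl divr_ge0 ?exprn_ge0// ltW.
  elim: n => [|n IH]; first by rewrite big_ord0 expr0 divr1 subrr.
  rewrite big_ord_recr/= IH /ei exprS invfM.
  by field; rewrite expf_neq0.
have s_sum n : \sum_(i < n) outer_state (F i) <= s.
  rewrite -lee_fin -sE -sumEFin (le_trans _ (nneseries_lim_ge n _))//.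
  by rewrite big_mkord.
have /choice[g gP] : forall i, exists g : nat -> X -> R,
    [/\ forall n, continuous (g n), forall n x, 0 <= g n x,
      forall n x, g n x <= g n.+1 x, forall n, L (g n) <= outer_state (F i) + ei i
    & forall x, F i x -> forall e : R, 0 < e -> exists n, 1 - e < g n x].
  by move=> i; exact: covered_outer_state.
(* Diagonal sums grow with [n] both in their range and in their terms, and their [L]-values stay
   below [s + e]. *)
exists (fun n x => \sum_(i < n) g i n x); split.
- by move=> n; apply: continuous_sum => i _; case: (gP i).
- by move=> n x; apply: sumr_ge0 => i _; case: (gP i).
- move=> n x; rewrite big_ord_recr/=; apply: ler_wpDr; first by case: (gP n).
  by apply: ler_sum => i _; case: (gP i).
- move=> n; rewrite state_sum; last by move=> i; case: (gP i).
  apply: (@le_trans _ _ (\sum_(i < n) (outer_state (F i) + ei i))).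
    by apply: ler_sum => i _; case: (gP i).
  by rewrite big_split/=; exact: lerD (s_sum n) (ei_sum n).
- move=> x [i _ Fx] d d0; case: (gP i) => _ _ gS _ /(_ x Fx d d0)[n dn].
  exists (maxn n i.+1).
  have im : (i < maxn n i.+1)%N by rewrite leq_max leqnn orbT.
  rewrite (bigD1 (Ordinal im))//= (lt_le_trans dn)// ler_wpDr//.
    by apply: sumr_ge0 => j _; case: (gP j).
  have : (n <= maxn n i.+1)%N by rewrite leq_max leqnn.
  elim: (maxn n i.+1) => [|m IH]; first by rewrite leqn0 => /eqP ->.
  by rewrite leq_eqVlt => /predU1P[->//|/IH/le_trans]; apply.
Qed.

HB.instance Definition _ := isOuterMeasure.Build R X mu
  riesz0 riesz_ge0 le_riesz riesz_sigma_subadditive.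

(** A cover [g] of [B] is split by cut-offs [u] of [U]. The products [g n * u n] cover the part of
    [B] in [U]. With [k] fixed so that the value of [L] at [g k * u k] is nearly the supremum [a],
    the functions [g (n + k) * (1 - u k)] cover the rest, at cost at most the remainder. *)
Lemma open_caratheodory (U : set X) : open U -> mu.-caratheodory U.
Proof.
move=> oU; apply: le_caratheodory_measurable => B.
apply/lee_addgt0Pr => e e0; rewrite -!EFinD lee_fin.
have e20 : 0 < e / 2 by rewrite divr_gt0.
have [g [gc g0 gS gL gB]] := covered_outer_state B e20.
have [u [uc u01 uS u0 u1]] := open_approx oU.
have gle n m x : (n <= m)%N -> g n x <= g m x.
  elim: m => [|m IH]; first by rewrite leqn0 => /eqP ->.
  by rewrite leq_eqVlt => /predU1P[->//|/IH/le_trans]; apply.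
have uge0 n x : 0 <= u n x by have /andP[] := u01 n x.
have ule1 n x : u n x <= 1 by have /andP[] := u01 n x.
pose gu n x := g n x * u n x.
have guc n : continuous (gu n) by apply: continuous_mul_fun.
pose a := sup [set L (gu n) | n in setT].
have supa : has_sup [set L (gu n) | n in setT].
  split; first by exists (L (gu 0%N)), 0%N.
  exists (outer_state B + e / 2) => _ [n _ <-]; apply: le_trans (gL n).
  by apply: le_state => // x; rewrite /gu ler_piMr.
have la n : L (gu n) <= a by apply: (sup_upper_bound supa); exists n.
have [_ [k _ <-] ak] := sup_adherent e20 supa.
have BU : outer_state (B `&` U) <= a.
  apply: outer_state_le; exists gu; split=> //.
  - by move=> n x; rewrite mulr_ge0.
  - by move=> n x; apply: ler_pM.
  - move=> x [Bx Ux] d d0; have [n dn] := gB x Bx d d0; have [N uN] := u1 x Ux.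
    exists (maxn n N); rewrite /gu uN ?leq_maxr// mulr1.
    by rewrite (lt_le_trans dn)// gle// leq_maxl.
have BCU : outer_state (B `&` ~` U) <= outer_state B + e / 2 - (a - e / 2).
  apply: outer_state_le; exists (fun n x => g (n + k)%N x * (1 - u k x)).
  split=> //.
  - move=> n; apply: continuous_mul_fun => //.
    by apply: continuous_sub_fun => //; exact: cst_continuous.
  - by move=> n x; rewrite mulr_ge0// subr_ge0.
  - by move=> n x; rewrite ler_wpM2r// subr_ge0.
  - move=> n; apply: (@le_trans _ _ (L (fun x => g (n + k)%N x - gu k x))).
      apply: le_state; [|exact: continuous_sub_fun|].
        apply: continuous_mul_fun => //.
        by apply: continuous_sub_fun => //; exact: cst_continuous.
      move=> x; rewrite mulrBr mulr1 lerB// /gu ler_wpM2r//.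
      by rewrite gle// leq_addl.
    by rewrite stateB// lerB// ltW.
  - move=> x [Bx Ux] d d0; have [n dn] := gB x Bx d d0.
    by exists n; rewrite u0// subr0 mulr1 (lt_le_trans dn)// gle// leq_addr.
by move: (lerD BU BCU); lra.
Qed.

Lemma borel_caratheodory (A : set (Borel X)) :
  measurable A -> mu.-caratheodory (A : set X).
Proof.
move=> mA; have := @smallest_sub _ (sigma_algebra setT) (@open X)
  (mu.-caratheodory) _ _ A; apply => //.
  split; [exact: caratheodory_measurable_set0| |].
    by move=> B; rewrite setTD; exact: caratheodory_measurable_setC.
  exact: caratheodory_measurable_bigcup.
exact: open_caratheodory.
Qed.

Definition riesz_borel : set (Borel X) -> \bar R := mu.

Let riesz_semi_sigma_additive : semi_sigma_additive riesz_borel.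
Proof.
move=> F mF tF mUF.
apply: (@caratheodory_measure_sigma_additive R X mu F) => //.
  by move=> i; exact: borel_caratheodory.
exact: borel_caratheodory.
Qed.

HB.instance Definition _ := isMeasure.Build _ (Borel X) R riesz_borel
  riesz0 riesz_ge0 riesz_semi_sigma_additive.

Hypothesis X_compact : compact [set: X].

Let riesz_setT : riesz_borel setT = 1%E.
Proof.
congr EFin; apply/eqP; rewrite eq_le outer_state_le//=; last exact: covered1.
apply: lb_le_inf; first exact: (has_inf_covered _).1.
move=> c [g [gc g0 gS gL gB]]; apply/ler_addgt0Pr => e e0.
(* By compactness a cover of the whole space exceeds [1 - e] everywhere at one index, hence so does
   its value under [L]. *)
have cc : continuous (fun _ : X => 1 - e) by exact: cst_continuous.
have [n gn] := compact_monotone_cover X_compact gc cc gS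
  (fun x => gB x Logic.I e e0).
rewrite -lerBlDr; apply: le_trans (gL n).
rewrite -[leLHS]state_cst; apply: le_state => // x.
exact: ltW.
Qed.

HB.instance Definition _ := Measure_isProbability.Build _ (Borel X) R
  riesz_borel riesz_setT.

Definition riesz_probability : probability (Borel X) R :=
  riesz_borel.
End Riesz.

(** * Borel measures and integrals of continuous functions *)

Section BorelMeasures.
Context {R : realType} {X : pmetricType R}.
Implicit Types (f g : X -> R) (mu nu : probability (Borel X) R).

Lemma borel_open (U : set X) : open U -> measurable (U : set (Borel X)).
Proof. by move=> oU; apply: sub_sigma_algebra. Qed.

Lemma borel_closed (C : set X) : closed C -> measurable (C : set (Borel X)).
Proof.
by move=> cC; have := measurableC (borel_open (closed_openC cC)); rewrite setCK.
Qed.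

Lemma borel_continuous f :
  continuous f -> measurable_fun [set: Borel X] (f : Borel X -> R).
Proof.
move=> fc; apply: (measurability _ (measurable_realfun.RGenOInfty.measurableE R)).
move=> _ [_ [a ->] <-]; rewrite setTI; apply: borel_open.
by apply: open_comp => [x _|]; [exact: fc|exact: interval_open].
Qed.

Lemma borel_continuous_map (T : X -> X) : continuous T ->
  measurable_fun [set: Borel X] (T : Borel X -> Borel X).
Proof.
move=> Tc; apply: (@measurability _ _ (Borel X) (Borel X) setT T (@open X)) => //.
move=> _ [U oU <-]; rewrite setTI.
by apply: borel_open; apply: open_comp => [x _|//]; exact: Tc.
Qed.

Lemma borel_preimage (T : X -> X) (A : set (Borel X)) : continuous T ->
  measurable A -> measurable (T @^-1` A : set (Borel X)).
Proof.
move=> Tc mA; rewrite -[X in measurable X]setTI.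
exact: (borel_continuous_map Tc).
Qed.

Lemma open_gt_fun f (c : R) : continuous f -> open [set x | c < f x].
Proof.
move=> fc; rewrite (_ : mkset _ = f @^-1` [set t | c < t])//.
by apply: open_comp => [x _|]; [exact: fc|exact: open_gt].
Qed.

Lemma borel_gt_fun f (c : R) : continuous f ->
  measurable ([set x | c < f x] : set (Borel X)).
Proof. by move=> fc; apply: borel_open; exact: open_gt_fun. Qed.

Hypothesis X_compact : compact [set: X].

Lemma continuous_bounded f : continuous f -> exists C : R, forall x, `|f x| <= C.
Proof.
move=> fc; have : compact (f @` setT).
  by apply: continuous_compact => //; exact: continuous_subspaceT.
move=> /compact_bounded[C [_ HC]]; exists (C + 1) => x.
by apply: HC; [rewrite ltrDl|exists x].
Qed.

Lemma continuous_integrable mu f : continuous f ->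
  mu.-integrable [set: Borel X] (EFin \o (f : Borel X -> R)).
Proof.
move=> fc; apply: measurable_bounded_integrable => //.
- by rewrite ltey_eq fin_num_measure.
- exact: borel_continuous.
have [C fC] := continuous_bounded fc.
exists C; split; first by rewrite num_real.
by move=> D CD x _; apply: le_trans (fC x) (ltW CD).
Qed.

Lemma integral_state mu :
  is_state (fun f => \int[mu]_x f x).
Proof.
split.
- by move=> f g fc gc; rewrite RintegralD//; exact: continuous_integrable.
- by move=> a f fc; rewrite RintegralZl//; exact: continuous_integrable.
- by move=> f fc f0; apply: Rintegral_ge0.
- rewrite Rintegral_cst// mul1r; transitivity (fine (1%E : \bar R)) => //.
  by congr fine; exact: probability_setT.
Qed.

(** Layer-cake argument. Only the values of the measure on closed sets and their bounds by covers
    are used, so integral and state are compared slice by slice, with a shift of one slice. *)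
Lemma Rintegral_riesz L (HL : is_state L) f : continuous f ->
  \int[riesz_probability HL X_compact]_x f x = L f.
Proof.
set m := riesz_probability HL X_compact.
pose J f := \int[m]_x f x.
have HJ : is_state J by exact: integral_state.
(* One inequality for functions with values in [0, 1] is enough: applied to [1 - g] it gives
   equality, and an affine rescaling reaches every bounded [f]. *)
suff leJ g : continuous g -> (forall x, 0 <= g x <= 1) -> J g <= L g.
  have {}leJ g : continuous g -> (forall x, 0 <= g x <= 1) -> J g = L g.
    move=> gc g01; apply/eqP; rewrite eq_le leJ//=.
    have c1 : continuous (fun _ : X => 1 : R) by exact: cst_continuous.
    have := leJ (fun x => 1 - g x) (continuous_sub_fun c1 gc).
    rewrite !stateB// !state1// => /(_ _)/[!lerD2l]/[!lerN2]; apply => x.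
    by have /andP[? ?] := g01 x; apply/andP; split; lra.
  move=> fc; have [C fC] := continuous_bounded fc.
  have C0 : 0 <= C by apply: le_trans (fC point).
  have c1 : continuous (fun _ : X => C : R) by exact: cst_continuous.
  have C1 : 0 < 2 * C + 1 by lra.
  pose g x := (2 * C + 1)^-1 * (f x + C).
  have gc : continuous g by apply/continuous_scale_fun/continuous_add_fun.
  have := leJ g gc; rewrite /g !stateZ ?stateD//; last 2 first.
  - exact: continuous_add_fun.
  - exact: continuous_add_fun.
  rewrite !state_cst// => /(_ _)/(mulfI _)/addIr; apply; [by rewrite invr_eq0 gt_eqF|].
  move=> x; have := fC x; rewrite ler_norml => /andP[? ?].
  rewrite mulrC; apply/andP; split; last by rewrite ler_pdivrMr//; lra.
  by rewrite divr_ge0//; lra.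
move=> gc g01; apply/ler_addgt0Pr => e e0.
have [M Ne] : exists M, M.+1%:R^-1 <= e.
  exists (Num.truncn e^-1).
  by rewrite invf_ple// ?posrE//; apply: ltW; exact: truncnS_gt.
pose N := M.+1; have N0 : 0 < N%:R :> R by rewrite ltr0n.
(* [h j] is the part of [N * g] between the heights [j] and [j + 1]; it lies between the indicators
   of [A j.+1] and [A j]. *)
pose h (j : nat) x := clamp (N%:R * g x - j%:R).
have hc j : continuous (h j).
  apply: continuous_clamp; apply: continuous_sub_fun.
    exact: continuous_scale_fun.
  exact: cst_continuous.
have gE : g = fun x => N%:R^-1 * \sum_(j < N) h j x.
  apply/funext => x.
  suff -> : \sum_(j < N) h j x = N%:R * g x by rewrite mulKf// gt_eqF.
  have /andP[g0 g1] := g01 x.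
  have key n : \sum_(j < n) h j x = Num.min (N%:R * g x) n%:R.
    elim: n => [|n IH].
      by rewrite big_ord0 min_r// mulr_ge0// ltW.
    rewrite big_ord_recr/= IH /h /clamp -natr1.
    have [|] := leP (N%:R * g x) n%:R; have [|] := leP (N%:R * g x) (n%:R + 1);
    have [|] := leP (N%:R * g x - n%:R) 1 => ? ? ?;
    first [have [|] := leP 0 (N%:R * g x - n%:R) => ?; lra
          |have [|] := leP (0:R) 1 => ?; lra].
  by rewrite key min_l// ler_piMr// ltW.
have hi j x : (N%:R * g x >= j.+1%:R) -> h j x = 1.
  by move=> ?; apply: clamp1; rewrite lerBrDr addrC natr1.
pose A j : set X := [set x | j%:R <= N%:R * g x].
have mA j : measurable (A j : set (Borel X)).
  apply: borel_closed.
  rewrite (_ : A j = (fun x => N%:R * g x) @^-1` [set y | j%:R <= y])//.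
  apply: closed_comp => [x _|]; last exact: closed_ge.
  by apply: continuous_scale_fun.
have mA_le j : fine (m (A j.+1)) <= L (h j).
  apply: (outer_state_le HL); exists (fun _ => h j); split => //.
  - by move=> _ x; exact: clamp_ge0.
  - by move=> x Ax d d0; exists 0%N; rewrite hi// gtrBl.
have int_le j : J (h j) <= fine (m (A j)).
  rewrite /J.
  apply: (@le_trans _ _ (\int[m]_x \1_(A j : set (Borel X)) x)).
    apply: le_Rintegral => //.
    - exact: continuous_integrable.
    - exact: integrable_indic.
    - move=> x _; rewrite indicE; have [/set_mem Ax|/negP Ax] := boolP (x \in _).
        exact: clamp_le1.
      rewrite /h clamp0// subr_le0 leNgt; apply/negP => jx; apply: Ax.
      by rewrite inE; exact: ltW.
  rewrite /Rintegral integral_indic// setIT//.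
have Jh0 : J (h 0%N) <= 1.
  have c1 : continuous (fun _ : X => 1 : R) by exact: cst_continuous.
  by rewrite -(state1 HJ); apply: le_state => // x; exact: clamp_le1.
have JgE (K : (X -> R) -> R) : is_state K ->
    K g = N%:R^-1 * \sum_(j < N) K (h j).
  move=> HK; rewrite gE stateZ//; last exact: continuous_sum.
  by rewrite state_sum.
rewrite (JgE J)// (JgE L)// -[e](mulKf (lt0r_neq0 N0)) -mulrDr.
rewrite ler_pM2l ?invr_gt0//.
(* The integral of slice [j + 1] is at most [L] of slice [j]. The slice left over has integral at
   most 1, which [N * e] absorbs. *)
rewrite {1}/N big_ord_recl/= [\sum_(j < N) L (h j)]big_ord_recr/=.
have : \sum_(i < M) J (h (bump 0 i)) <= \sum_(i < M) L (h i).
  by apply: ler_sum => i _; apply: le_trans (int_le _) (mA_le _).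
have : 1 <= N%:R * e by rewrite -ler_pdivrMl// mulr1.
have : 0 <= L (h M) by apply: state_ge0 => // x; exact: clamp_ge0.
move: Jh0; lra.
Qed.

End BorelMeasures.

(** * Real-valued probabilities and finite labels *)

Section RealProbability.
Context {R : realType} {d : measure_display} {S : measurableType d}.
Implicit Types (mu : probability S R) (A B : set S).

Definition prob mu A : R := fine (mu A).

Lemma probE mu A : measurable A -> mu A = (prob mu A)%:E.
Proof. by move=> mA; rewrite /prob fineK// fin_num_measure. Qed.

Lemma prob_ge0 mu A : 0 <= prob mu A.
Proof. by rewrite fine_ge0. Qed.

Lemma prob0 mu : prob mu set0 = 0.
Proof. by rewrite /prob measure0. Qed.

Lemma probT mu : prob mu setT = 1.
Proof. by apply: EFin_inj; rewrite -probE// probability_setT. Qed.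

Lemma le_prob mu A B : measurable A -> measurable B -> A `<=` B ->
  prob mu A <= prob mu B.
Proof.
by move=> mA mB AB; rewrite -lee_fin -!probE// le_measure// inE.
Qed.

Lemma prob_le1 mu A : measurable A -> prob mu A <= 1.
Proof. by move=> mA; rewrite -(probT mu) le_prob. Qed.

Lemma probU mu A B : measurable A -> measurable B -> A `&` B = set0 ->
  prob mu (A `|` B) = prob mu A + prob mu B.
Proof.
move=> mA mB AB; apply: EFin_inj; rewrite EFinD -!probE//; last exact: measurableU.
by rewrite measureU.
Qed.

Lemma probID mu A B : measurable A -> measurable B ->
  prob mu A = prob mu (A `&` B) + prob mu (A `\` B).
Proof.
move=> mA mB; rewrite -probU; [by rewrite setUIDK|exact: measurableI|
  exact: measurableD|].
by rewrite setDE setIACA setICr setI0.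
Qed.

Lemma probC mu A : measurable A -> prob mu (~` A) = 1 - prob mu A.
Proof.
move=> mA; rewrite -(probT mu) (probID mu (@measurableT _ S) mA) setTI setTD.
by rewrite addrC addKr.
Qed.

Lemma probU_le mu A B : measurable A -> measurable B ->
  prob mu (A `|` B) <= prob mu A + prob mu B.
Proof.
move=> mA mB; rewrite -lee_fin EFinD -!probE//; last exact: measurableU.
exact: measureU2.
Qed.

Lemma prob_nondecreasing_cvg mu (F : nat -> set S) :
  (forall n, measurable (F n)) -> (forall n, F n `<=` F n.+1) ->
  prob mu (F n) @[n --> \oo] --> prob mu (\bigcup_n F n).
Proof.
move=> mF ndF.
have mU : measurable (\bigcup_n F n) by exact: bigcup_measurable.
have := @nondecreasing_cvg_mu _ _ _ mu F mF mU.
have nd : nondecreasing_seq F.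
  by apply/nondecreasing_seqP => n; apply/subsetPset/ndF.
move=> /(_ nd) muF.
have : (mu \o F) n @[n --> \oo] --> (prob mu (\bigcup_n F n))%:E.
  by rewrite -probE.
by move=> /fine_cvgP[].
Qed.

(** A finite measurable partition, encoded by the map sending a point to the index of its atom. *)
Definition measurable_label (I : finType) (c : S -> I) : Prop :=
  forall i, measurable (c @^-1` [set i]).

Definition label_dist mu (I : finType) (c : S -> I) (i : I) : R :=
  prob mu (c @^-1` [set i]).

Lemma label_preimage (I : finType) (c : S -> I) mu (P : pred I) :
  measurable_label c -> measurable (c @^-1` [set` P]) /\
  prob mu (c @^-1` [set` P]) = \sum_(i | P i) label_dist mu c i.
Proof.
move=> mc; rewrite -big_filter; pose s := [seq i <- index_enum I | P i].
have -> : c @^-1` [set` P] = [set x | c x \in s].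
  by apply/seteqP; split=> x /=; rewrite /s mem_filter mem_index_enum andbT.
have : uniq s by rewrite filter_uniq// index_enum_uniq.
rewrite -/s; elim: s => [_|i s IH /andP[is_ us]].
  rewrite big_nil (_ : [set _ | _] = set0) ?prob0//.
  by apply/seteqP; split.
have -> : [set x | c x \in i :: s] = c @^-1` [set i] `|` [set x | c x \in s].
  apply/seteqP; split=> x /=; rewrite inE.
    by move/predU1P.
  by move/predU1P.
have [ms ps] := IH us; split; first exact: measurableU.
rewrite big_cons probU ?ps//; apply/seteqP; split=> x //= -[ci].
by rewrite ci (negbTE is_).
Qed.

Lemma measurable_label_comp (I J : finType) (c : S -> I) (f : I -> J) :
  measurable_label c -> measurable_label (f \o c).
Proof.
(* Only the measurability half is wanted here, so any measure serves. *)
move=> mc j; have [] // := label_preimage (point : probability S R)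
  (fun i => f i == j) mc.
rewrite (_ : c @^-1` _ = (f \o c) @^-1` [set j])//.
by apply/seteqP; split=> x /= /eqP.
Qed.

Lemma label_dist_prob mu (I : finType) (c : S -> I) :
  measurable_label c -> fin_prob (label_dist mu c).
Proof.
move=> mc; split=> [i|]; first exact: prob_ge0.
have [_ <-] := label_preimage mu predT mc.
rewrite -(probT mu); congr prob; by apply/seteqP; split.
Qed.

Lemma label_dist_comp mu (I J : finType) (c : S -> I) (f : I -> J) :
  measurable_label c -> label_dist mu (f \o c) = marginal (label_dist mu c) f.
Proof.
move=> mc; apply/funext => j; have [_] := label_preimage mu (fun i => f i == j) mc.
rewrite /marginal => <-; congr prob.
by apply/seteqP; split=> x /= /eqP.
Qed.

End RealProbability.

(** * Limits along ultrafilters *)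

Section UltraLimits.
Context {R : realType}.

Lemma ultra_cvg_compact (I : Type) (U : set_system I) (S : topologicalType)
  (A : set S) (u : I -> S) : UltraFilter U -> compact A ->
  U [set i | A (u i)] -> exists2 l, A l & u i @[i --> U] --> l.
Proof.
move=> ultraU cA UA; have [l [Al clu]] := cA (u i @[i --> U]) _ UA.
exists l => // B lB.
have [//|UnB] := in_ultra_setVsetC (u @^-1` B) ultraU.
by have [x [/= nBx Bx]] := clu (~` B) B UnB lB.
Qed.

Lemma ultra_cvg_bounded (I : Type) (U : set_system I) (u : I -> R) (C : R) :
  UltraFilter U -> (forall i, `|u i| <= C) -> exists l : R, u i @[i --> U] --> l.
Proof.
move=> ultraU uC.
have [||l _ ul] := @ultra_cvg_compact I U R `[- C, C]%classic u ultraU.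
- exact: segment_compact.
- by apply: filterE => i /=; rewrite in_itv/= -ler_norml.
- by exists l.
Qed.

End UltraLimits.

(** * Weak limits and regularity of Borel measures *)

Section WeakLimits.
Context {R : realType} {X : pmetricType R}.
Hypothesis X_compact : compact [set: X].
Implicit Types (f g : X -> R) (mu nu : probability (Borel X) R).

(** Markov's inequality for each [g n], then continuity from below along the increasing sets where
    [1 - e < g n]. *)
Lemma prob_cover_le mu (g : nat -> X -> R) (c e : R) :
  (forall n, continuous (g n)) -> (forall n x, 0 <= g n x) ->
  (forall n x, g n x <= g n.+1 x) ->
  (forall n, \int[mu]_x g n x <= c) -> 0 < e < 1 ->
  open [set x : X | exists n, 1 - e < g n x] /\
  prob mu [set x : X | exists n, 1 - e < g n x] * (1 - e) <= c.
Proof.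
move=> gc g0 gS gL /andP[e0 e1]; pose O n : set X := [set x | 1 - e < g n x].
have oO n : open (O n) by exact: open_gt_fun.
have mO n : measurable (O n : set (Borel X)) by exact: borel_open.
have OS n : O n `<=` O n.+1 by move=> x /lt_le_trans; apply.
have -> : [set x : X | exists n, 1 - e < g n x] = \bigcup_n O n.
  by apply/seteqP; split=> x /= [n]; exists n.
split; first exact: bigcup_open.
have cv := prob_nondecreasing_cvg (mu := mu) mO OS.
apply: (cvgr_to_le (cvgM cv (cvg_cst (1 - e)))).
apply: nearW => n; apply: le_trans (gL n); rewrite /= mulrC.
have -> : prob mu (O n) = \int[mu]_x \1_(O n : set (Borel X)) x.
  by rewrite /Rintegral integral_indic// setIT.
rewrite -RintegralZl//; last exact: integrable_indic.
apply: le_Rintegral => //.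
- apply: (@eq_integrable _ _ _ _ _ measurableT
    (fun x => (1 - e)%:E * (\1_(O n : set (Borel X)) x)%:E)%E) => //.
  by apply: integrableZl => //; exact: integrable_indic.
- exact: continuous_integrable.
- move=> x _; rewrite indicE; have [/set_mem /ltW|_] := boolP (x \in _).
    by rewrite mulr1.
  by rewrite mulr0.
Qed.

Lemma prob_le_outer_state mu (A : set (Borel X)) : measurable A ->
  prob mu A <=
  outer_state (fun f => \int[mu]_x f x) (A : set X).
Proof.
set L := fun f => _ => mA.
have HL : is_state L by exact: integral_state.
apply: lb_le_inf; first exact: (has_inf_covered HL _).1.
move=> c [g [gc g0 gS gL gA]].
have key (e : R) : 0 < e < 1 -> prob mu A * (1 - e) <= c.
  move=> e01; have [oO] := prob_cover_le gc g0 gS gL e01; apply: le_trans.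
  have /andP[e0 e1] := e01; apply: ler_wpM2r; first by rewrite subr_ge0 ltW.
  by apply: le_prob => //; [exact: borel_open|move=> x Ax; exact: gA].
have c0 : 0 <= c by exact: le_trans (state_ge0 HL (gc 0%N) (g0 0%N)) (gL 0%N).
apply/ler_addgt0Pr => e e0; pose e' := Num.min e (1 / 2).
have e'0 : 0 < e' by rewrite lt_min e0 divr_gt0.
have e'e : e' <= e by rewrite ge_min lexx.
have e'1 : e' <= 1 / 2 by rewrite ge_min lexx orbT.
have := key e'; rewrite e'0/= => /(_ _)/wrap[|]; first by lra.
have := prob_le1 mu mA; have := prob_ge0 mu A.
by rewrite mulrBr mulr1; nra.
Qed.

(** By Riesz the outer state restricts to a probability on Borel sets. It dominates [mu] on [A] and
    on the complement of [A]; as both pairs of masses add up to 1, both inequalities are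
    equalities. *)
Lemma prob_outer_state mu (A : set (Borel X)) : measurable A ->
  prob mu A =
  outer_state (fun f => \int[mu]_x f x) (A : set X).
Proof.
move=> mA; apply/eqP; rewrite eq_le prob_le_outer_state//=.
have HL := integral_state X_compact mu.
have := prob_le_outer_state mu (measurableC mA); rewrite probC//.
have := @probC _ _ _ (riesz_probability HL X_compact) A mA.
by rewrite /prob/= => ->; lra.
Qed.

Lemma same_measure_integral mu nu :
  (forall f, continuous f -> \int[mu]_x f x =
                             \int[nu]_x f x) ->
  same_measure mu nu.
Proof.
move=> munu A mA; rewrite (probE mu mA) (probE nu mA) !prob_outer_state//.
congr (inf _)%:E; apply/seteqP; split=> c [g [gc g0 gS gL gA]];
  by exists g; split=> // n; rewrite ?munu// -munu.
Qed.

(** Formulated for states instead of measures, so that it applies directly to the empirical averages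
    of Misiurewicz's argument. *)
Lemma weak_limit (I : Type) (U : set_system I) (L : I -> (X -> R) -> R) :
  UltraFilter U -> (forall i, is_state (L i)) ->
  exists mu, forall f, continuous f ->
    L i f @[i --> U] --> \int[mu]_x f x.
Proof.
move=> ultraU HL; pose Lim f := lim (L i f @[i --> U]).
have LimP f : continuous f -> L i f @[i --> U] --> Lim f.
  move=> fc; have [C fC] := continuous_bounded X_compact fc.
  have [l Ll] : exists l : R, L i f @[i --> U] --> l.
    apply: (@ultra_cvg_bounded _ _ _ _ C) => i.
    exact: (state_norm_le (HL i)).
  by apply: cvgP Ll.
have HLim : is_state Lim.
  split.
  - move=> f g fc gc; apply/cvg_lim => //.
    rewrite (_ : (fun i => _) = (fun i => L i f + L i g)).
      by apply: cvgD; exact: LimP.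
    by apply/funext => i; rewrite (stateD (HL i)).
  - move=> a f fc; apply/cvg_lim => //.
    rewrite (_ : (fun i => _) = (fun i => a * L i f)).
      by apply: cvgMr; exact: LimP.
    by apply/funext => i; rewrite (stateZ (HL i)).
  - move=> f fc f0; apply: (cvgr_to_ge (LimP f fc)).
    by apply: nearW => i; exact: (state_ge0 (HL i)).
  - apply/cvg_lim => //; rewrite (_ : (fun i => _) = (fun=> 1)).
      exact: cvg_cst.
    by apply/funext => i; rewrite (state1 (HL i)).
exists (riesz_probability HLim X_compact) => f fc.
by rewrite Rintegral_riesz//; exact: LimP.
Qed.

(** A nearly optimal cover of the complement of [A] exceeds [1 - d] on an open set [O] containing
    that complement and hardly larger in measure. [C] is the complement of [O]. *)
Lemma inner_regular mu (A : set (Borel X)) (e : R) : measurable A -> 0 < e ->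
  exists C : set X, [/\ closed C, C `<=` A & prob mu (A `\` C) <= e].
Proof.
move=> mA e0; have HL := integral_state X_compact mu.
pose d := Num.min (e / 4) (1 / 2).
have d0 : 0 < d by rewrite lt_min !divr_gt0.
have de : d <= e / 4 by rewrite ge_min lexx.
have d1 : d <= 1 / 2 by rewrite ge_min lexx orbT.
have mCA := measurableC mA.
have := covered_outer_state HL (~` A : set X) d0.
rewrite -(prob_outer_state mu mCA) => -[g [gc g0 gS gL gA]].
have d01 : 0 < d < 1 by apply/andP; split; lra.
have [oO] := prob_cover_le gc g0 gS gL d01.
set O := [set x | _] in oO * => pO.
have mO : measurable (O : set (Borel X)) by exact: borel_open.
exists (~` O); split.
- exact: open_closedC.
- by move=> x Ox; apply: contrapT => Ax; apply: Ox; exact: gA.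
- rewrite setDE setCK; have := probID mu mO mA.
  have -> : O `\` A = ~` A.
    by apply/seteqP; split=> x; [move=> []|move=> Ax; split=> //; exact: gA].
  rewrite setIC => OE; have := prob_le1 mu mCA; have := prob_ge0 mu (~` A).
  have := prob_ge0 mu O; move: pO; rewrite OE; nra.
Qed.

End WeakLimits.

(** * Words and subadditivity over blocks *)

Section Words.
Context {R : realType}.

(** [xi t] is the symbol at time [t]. An arbitrary process is allowed because the symbols may come
    from orbits in [X], from orbits of finitely many sample points, or from blocks of time. *)
Definition word (O : Type) (I : finType) (xi : nat -> O -> I) (s l : nat) (x : O)
    : {ffun 'I_l -> I} := [ffun j : 'I_l => xi (s + j)%N x].

Definition glue (I : finType) (l m : nat)
    (uv : {ffun 'I_l -> I} * {ffun 'I_m -> I}) : {ffun 'I_(l + m) -> I} :=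
  [ffun j => match fintype.split j with inl a => uv.1 a | inr b => uv.2 b end].

Definition truncate (I : finType) (l m : nat) (lm : (l <= m)%N)
    (u : {ffun 'I_m -> I}) : {ffun 'I_l -> I} :=
  [ffun j => u (widen_ord lm j)].

Lemma word_glue (O : Type) (I : finType) (xi : nat -> O -> I) s l m :
  word xi s (l + m) = @glue I l m \o (fun x => (word xi s l x, word xi (s + l) m x)).
Proof.
apply/funext => x; apply/ffunP => j; rewrite !ffunE/=.
by case: fintype.splitP => a ->; rewrite !ffunE// addnA.
Qed.

Lemma word_truncate (O : Type) (I : finType) (xi : nat -> O -> I) s l m
  (lm : (l <= m)%N) : word xi s l = truncate lm \o word xi s m.
Proof. by apply/funext => x; apply/ffunP => j; rewrite !ffunE. Qed.

Lemma sum_nat_blocks (f : nat -> R) (B q : nat) :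
  \sum_(0 <= t < B * q) f t = \sum_(0 <= j < q) \sum_(0 <= i < B) f (j + i * q)%N.
Proof.
rewrite exchange_big/=; elim: B => [|B IH]; first by rewrite mul0n !big_geq.
rewrite [RHS]big_nat_recr//= -IH mulSn addnC (@big_cat_nat _ _ _ (B * q))//=.
  by congr (_ + _); rewrite -{1}[(B * q)%N]add0n big_addn addKn.
exact: leq_addr.
Qed.

(* Cut [0, n) into blocks of length [q] at each of the [q] possible phases and average. *)
Lemma block_subadditivity (h : nat -> nat -> R) (K : R) (n q : nat) :
  (forall s l m, h s (l + m)%N <= h s l + h (s + l)%N m) ->
  (forall s l m, (l <= m)%N -> h s l <= h s m) ->
  (forall s l, h s l <= l%:R * K) -> (0 < q)%N -> 0 <= K ->
  q%:R * h 0%N n <= \sum_(t < n) h t q + 2 * q%:R ^+ 2 * K.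
Proof.
(* [B] blocks of length [q] cover the interval of length [n] and overshoot it by at most [q]. *)
move=> hD hS hK q0 K0; pose B := (n %/ q).+1.
have nB : (n <= B * q)%N by rewrite /B mulSn {1}(divn_eq n q) addnC leq_add2r ltnW// ltn_pmod.
have Bn : (B * q <= n + q)%N.
  by rewrite /B mulSn addnC leq_add2r leq_trunc_div.
have hB j : h j (B * q)%N <= \sum_(0 <= i < B) h (j + i * q)%N q.
  elim: B {nB Bn} => [|B IH].
    by rewrite mul0n big_geq//; have := hK j 0%N; rewrite mul0r.
  by rewrite big_nat_recr//= mulSn addnC (le_trans (hD _ _ _))// lerD2r.
(* For the phase [j], the initial stretch of length [j < q] costs at most [q * K]. *)
have hj j : (j < q)%N -> h 0%N n <= q%:R * K + \sum_(0 <= i < B) h (j + i * q)%N q.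
  move=> jq; apply: le_trans (hS 0%N n (j + B * q)%N _) _.
    by rewrite (leq_trans nB)// leq_addl.
  apply: le_trans (hD _ _ _) _; rewrite lerD ?add0n//.
  apply: le_trans (hK _ _) _; rewrite ler_wpM2r// ler_nat ltnW//.
have : \sum_(0 <= j < q) h 0%N n <=
    \sum_(0 <= j < q) (q%:R * K + \sum_(0 <= i < B) h (j + i * q)%N q).
  by rewrite !big_nat; apply: ler_sum => j /andP[_ /hj].
rewrite big_split/= -(sum_nat_blocks (fun t => h t q)) !sumr_const_nat subn0.
rewrite (@big_cat_nat _ _ _ n)//= big_mkord -[_ *+ q]mulr_natl -[_ *+ q]mulr_natl.
(* At most [q] windows start beyond [n], and each costs at most [q * K]. *)
have : \sum_(n <= t < B * q) h t q <= q%:R * (q%:R * K).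
  apply: le_trans (_ : \sum_(n <= t < B * q) q%:R * K <= _).
    by apply: ler_sum => t _; exact: hK.
  rewrite sumr_const_nat -[_ *+ _]mulr_natl ler_wpM2r ?mulr_ge0//.
  by rewrite ler_nat leq_subLR.
by move=> *; rewrite expr2; lra.
Qed.

End Words.

(** * Entropy of measurable labels *)

Section LabelEntropy.
Context {R : realType} {d : measure_display} {S : measurableType d}.
Variable mu : probability S R.
Implicit Types I J : finType.

Definition label_ent I (c : S -> I) : R := ent (label_dist mu c).

Lemma label_ent_comp_le I J (c : S -> I) (f : I -> J) : measurable_label c ->
  label_ent (f \o c) <= label_ent c.
Proof.
move=> mc; rewrite /label_ent (label_dist_comp mu f mc).
have E : label_dist mu c = marginal (label_dist mu c) id.
  by apply/funext => i; rewrite /marginal big_pred1_eq.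
rewrite [X in _ <= ent X]E -[f in marginal _ f]/(f \o id).
by apply: ent_comp_le; exact: label_dist_prob.
Qed.

Lemma measurable_label_pair I J (c : S -> I) (e : S -> J) :
  measurable_label c -> measurable_label e ->
  measurable_label (fun x => (c x, e x)).
Proof.
move=> mc me [i j]; rewrite (_ : _ @^-1` _ = c @^-1` [set i] `&` e @^-1` [set j]).
  exact: measurableI.
by apply/seteqP; split=> x /= [-> ->].
Qed.

Lemma label_ent_pair_le I J (c : S -> I) (e : S -> J) :
  measurable_label c -> measurable_label e ->
  label_ent (fun x => (c x, e x)) <= label_ent c + label_ent e.
Proof.
move=> mc me; have mce := measurable_label_pair mc me.
have := ent_pair_le fst snd (label_dist_prob mu mce).
by rewrite -!label_dist_comp.
Qed.

Lemma label_ent_ge0 I (c : S -> I) : measurable_label c -> 0 <= label_ent c.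
Proof. by move=> mc; apply: ent_ge0; exact: label_dist_prob. Qed.

Lemma label_ent_le_ln_card I (c : S -> I) : measurable_label c ->
  label_ent c <= ln #|I|%:R.
Proof. by move=> mc; apply: ent_le_ln_card; exact: label_dist_prob. Qed.

Lemma measurable_label_word I (xi : nat -> S -> I) s l :
  (forall t, measurable_label (xi t)) -> measurable_label (word xi s l).
Proof.
move=> mxi w; rewrite (_ : _ @^-1` _ =
    \bigcap_(j in [set: 'I_l]) xi (s + j)%N @^-1` [set w j]).
  by apply: fin_bigcap_measurable => // j _; exact: mxi.
apply/seteqP; split=> x /=.
  by move=> <- j _ /=; rewrite ffunE.
by move=> xw; apply/ffunP => j; rewrite ffunE; exact: xw.
Qed.

Lemma word_ent_le I (xi : nat -> S -> I) s l :
  (forall t, measurable_label (xi t)) ->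
  label_ent (word xi s l) <= l%:R * ln #|I|%:R.
Proof.
move=> mxi; have := label_ent_le_ln_card (measurable_label_word s (l := l) mxi).
move=> /le_trans; apply.
rewrite card_ffun card_ord natrX.
(* For empty [I] both sides are 0, by [ln 0 = 0] and [ln 1 = 0]. *)
have [I0|I0] := posnP #|I|; last by rewrite lnXn ?ltr0n// mulr_natl.
by rewrite I0 [X in _ * X]ln0// mulr0; case: l => [|l]; rewrite ?expr0 ?ln1// expr0n/= ln0.
Qed.

Lemma word_ent_block I (xi : nat -> S -> I) (n q : nat) :
  (forall t, measurable_label (xi t)) -> (0 < q)%N ->
  q%:R * label_ent (word xi 0 n) <=
  \sum_(t < n) label_ent (word xi t q) + 2 * q%:R ^+ 2 * ln #|I|%:R.
Proof.
move=> mxi q0; apply: (@block_subadditivity _ (fun s l => label_ent (word xi s l))) => //.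
- move=> s l m; rewrite word_glue.
  have m1 := measurable_label_word s (l := l) mxi.
  have m2 := measurable_label_word (s + l) (l := m) mxi.
  apply: le_trans (label_ent_pair_le m1 m2).
  by apply: label_ent_comp_le; exact: measurable_label_pair.
- move=> s l m lm; rewrite (word_truncate _ _ lm).
  by apply: label_ent_comp_le; exact: measurable_label_word.
- by move=> s l; exact: word_ent_le.
- have [I0|I0] := posnP #|I|; first by rewrite I0 ln0.
  by rewrite ln_ge0// ler1n.
Qed.

End LabelEntropy.

(** * Kolmogorov-Sinai entropy *)

Definition orbit_label (O : Type) (T : O -> O) (I : Type) (c : O -> I) (t : nat)
    : O -> I := fun x => c (iter t T x).

Lemma word_orbit (O : Type) (T : O -> O) (I : finType) (c : O -> I) s l :
  word (orbit_label T c) s l = word (orbit_label T c) 0 l \o iter s T.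
Proof.
apply/funext => x; apply/ffunP => j.
by rewrite !ffunE /orbit_label add0n addnC iterD.
Qed.

Section KSEntropy.
Context {R : realType} {d : measure_display} {S : measurableType d}.
Variable T : S -> S.
Hypothesis T_meas : measurable_fun setT T.
Implicit Types (mu nu : probability S R).

Definition orbit_ent mu (I : finType) (c : S -> I) (n : nat) : R :=
  label_ent mu (word (orbit_label T c) 0 n).

Lemma measurable_iter t : measurable_fun setT (iter t T).
Proof.
elim: t => [|t IH]; first exact: measurable_id.
exact: measurableT_comp T_meas IH.
Qed.

Lemma measurable_iter_preimage t (A : set S) :
  measurable A -> measurable (iter t T @^-1` A).
Proof. by move=> mA; rewrite -[X in measurable X]setTI; exact: measurable_iter. Qed.

Lemma measurable_orbit_label (I : finType) (c : S -> I) t :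
  measurable_label c -> measurable_label (orbit_label T c t).
Proof. by move=> mc i; apply: measurable_iter_preimage (mc i). Qed.

Lemma invariant_iter mu t (A : set S) : invariant_measure T mu -> measurable A ->
  mu (iter t T @^-1` A) = mu A.
Proof.
move=> inv mA; elim: t => [//|t IH].
rewrite -{}IH -[RHS]inv; last exact: measurable_iter_preimage.
by congr (mu _); apply/seteqP; split=> x; rewrite /preimage/= -iterSr.
Qed.

Lemma label_ent_iter mu (I : finType) (c : S -> I) t :
  invariant_measure T mu -> measurable_label c ->
  label_ent mu (c \o iter t T) = label_ent mu c.
Proof.
move=> inv mc; congr ent; apply/funext => i; congr fine.
exact: (invariant_iter t inv (mc i)).
Qed.

Lemma measurable_orbit_word (I : finType) (c : S -> I) s l :
  measurable_label c -> measurable_label (word (orbit_label T c) s l).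
Proof.
by move=> mc; apply: measurable_label_word => t; exact: measurable_orbit_label.
Qed.

Lemma orbit_ent_ge0 mu (I : finType) (c : S -> I) n :
  measurable_label c -> 0 <= orbit_ent mu c n.
Proof. by move=> mc; apply: label_ent_ge0; exact: measurable_orbit_word. Qed.

(** By invariance all windows of length [q] in [word_ent_block] have the same entropy. *)
Lemma orbit_ent_block mu (I : finType) (c : S -> I) (n q : nat) :
  invariant_measure T mu -> measurable_label c -> (0 < q)%N ->
  q%:R * orbit_ent mu c n <=
  n%:R * orbit_ent mu c q + 2 * q%:R ^+ 2 * ln #|I|%:R.
Proof.
move=> inv mc q0.
have := @word_ent_block _ _ _ mu I (orbit_label T c) n q
  (fun t => measurable_orbit_label t mc) q0.
rewrite -/(orbit_ent mu c n) (eq_bigr (fun=> orbit_ent mu c q)); last first.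
  move=> t _; rewrite word_orbit label_ent_iter//.
  exact: measurable_orbit_word.
by rewrite sumr_const card_ord -[_ *+ n]mulr_natl.
Qed.

Lemma partition_entropyE mu (k : nat) (c : S -> 'I_k) n :
  partition_entropy mu (dynamical_join T (fun i => c @^-1` [set i]) (n := n)) =
  orbit_ent mu c n.
Proof.
congr ent; apply/funext => w; congr (fine (mu _)).
apply/seteqP; split=> x /=.
  move=> xw; apply/ffunP => j; rewrite ffunE add0n.
  exact: (xw j Logic.I).
by move=> <- j _ /=; rewrite ffunE add0n.
Qed.

(** The limit defining the entropy exists and is the infimum of [orbit_ent mu c q / q], as in
    Fekete's lemma. The upper estimate is [orbit_ent_block] with [q] nearly optimal, whose error
    term stays bounded as [n] grows. *)
Lemma entropy_wrtP mu (k : nat) (c : S -> 'I_k) :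
  invariant_measure T mu -> measurable_label c ->
  let l := entropy_wrt T mu (fun i => c @^-1` [set i]) in
  (forall q, q%:R * l <= orbit_ent mu c q) /\
  (forall e : R, 0 < e -> exists N, forall q, (N <= q)%N ->
     orbit_ent mu c q <= q%:R * (l + e)).
Proof.
move=> inv mc; pose a n := orbit_ent mu c n.
pose l := inf [set a n.+1 / n.+1%:R | n in setT].
have hl : has_inf [set a n.+1 / n.+1%:R | n in setT].
  split; first by exists (a 1%N / 1), 0%N.
  by exists 0 => _ [n _ <-]; rewrite divr_ge0// orbit_ent_ge0.
have la q : q%:R * l <= a q.
  case: q => [|q]; first by rewrite mul0r orbit_ent_ge0.
  rewrite -ler_pdivlMl ?ltr0n// mulrC; apply: ge_inf; first exact: hl.2.
  by exists q.
have al (e : R) : 0 < e -> exists N, forall q, (N <= q)%N -> a q <= q%:R * (l + e).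
  move=> e0; have e20 : 0 < e / 2 by rewrite divr_gt0.
  have [_ [m _ <-] me] := inf_adherent e20 hl.
  pose q := m.+1; pose K : R := 2 * q%:R ^+ 2 * ln #|'I_k|%:R.
  have q0 : 0 < q%:R :> R by rewrite ltr0n.
  (* From this [n] on, the error [K] is at most [n * q * e / 2]. *)
  exists (Num.truncn (K / (q%:R * (e / 2)))).+1 => n Nn.
  have nK : K <= n%:R * (q%:R * (e / 2)).
    rewrite -ler_pdivrMr ?mulr_gt0//; apply: le_trans (ltW (truncnS_gt _)) _.
    by rewrite ler_nat.
  rewrite -(ler_pM2l q0); apply: le_trans (orbit_ent_block n inv mc _) _ => //.
  rewrite -/K -/(a q).
  have : a q <= q%:R * (l + e / 2) by rewrite -ler_pdivrMl// mulrC ltW.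
  move=> /(ler_wpM2l (ler0n R n)).
  by nra.
suff -> : entropy_wrt T mu (fun i => c @^-1` [set i]) = l by [].
apply/cvg_lim => //; apply/cvgrPdist_le => e e0.
have [N NP] := al e e0.
near=> n; rewrite partition_entropyE -/(a n).
have n0 : 0 < n%:R :> R by rewrite ltr0n; near: n; exact: nbhs_infty_gt.
have Nn : (N <= n)%N by near: n; exact: nbhs_infty_ge.
rewrite distrC ler_norml; apply/andP; split; last first.
  by rewrite lerBlDl ler_pdivrMl// NP.
rewrite lerBrDl ler_pdivlMl//; apply: le_trans (la n).
by rewrite ler_pM2l// gerDl oppr_le0 ltW.
Unshelve. all: by end_near. Qed.

Lemma finite_partition_label (k : nat) (A : 'I_k -> set S) :
  finite_partition A -> exists2 c : S -> 'I_k,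
    measurable_label c & A = (fun i => c @^-1` [set i]).
Proof.
move=> [mA tA UA].
have /choice[c cA] : forall x, exists i, A i x.
  by move=> x; have : setT x by []; rewrite -UA => -[i _ Aix]; exists i.
have AE : A = (fun i => c @^-1` [set i]).
  apply/funext => i; apply/seteqP; split=> x /=; last by move=> <-.
  move=> Aix; have := tA i (c x) Logic.I Logic.I.
  by move=> -> //; exists x; split.
by exists c => // i; have := mA i; rewrite AE.
Qed.

Lemma label_finite_partition (k : nat) (c : S -> 'I_k) : measurable_label c ->
  finite_partition (fun i => c @^-1` [set i]).
Proof.
move=> mc; split => //; last by apply/seteqP; split=> // x _; exists (c x).
by move=> i j _ _ [x /= [<- <-]].
Qed.

Lemma le_ks_entropy mu (k : nat) (c : S -> 'I_k) (a : R) :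
  invariant_measure T mu -> measurable_label c ->
  (forall q, (0 < q)%N -> a * q%:R <= orbit_ent mu c q) ->
  (a%:E <= ks_entropy T mu)%E.
Proof.
move=> inv mc ac; have [_ lP] := entropy_wrtP inv mc.
apply: (@le_trans _ _ (entropy_wrt T mu (fun i => c @^-1` [set i]))%:E).
  rewrite lee_fin; apply/ler_addgt0Pr => e /lP[N /(_ N.+1 (leqnSn N))].
  move/(le_trans (ac N.+1 isT)); rewrite mulrC ler_pM2l ?ltr0n//.
apply: ereal_sup_ubound; exists k, (fun i => c @^-1` [set i]) => //.
exact: label_finite_partition.
Qed.

Lemma ks_entropy_gt mu (b : R) : invariant_measure T mu ->
  (b%:E < ks_entropy T mu)%E -> exists k (c : S -> 'I_k) (a : R),
    [/\ measurable_label c, b < a & forall q, a * q%:R <= orbit_ent mu c q].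
Proof.
move=> inv /ereal_sup_gt[_ [k [A /finite_partition_label[c mc ->] ->]]].
rewrite lte_fin => ba; exists k, c; eexists; split; [exact: mc|exact: ba|].
by move=> q; rewrite mulrC; exact: (entropy_wrtP inv mc).1.
Qed.

Lemma ks_entropy_upper mu (k : nat) (c : S -> 'I_k) (b e : R) :
  invariant_measure T mu -> measurable_label c ->
  (ks_entropy T mu <= b%:E)%E -> 0 < e ->
  exists N, forall q, (N <= q)%N -> orbit_ent mu c q <= q%:R * (b + e).
Proof.
move=> inv mc kb e0; have [_ /(_ e e0)[N NP]] := entropy_wrtP inv mc.
exists N => q /NP/le_trans; apply; rewrite ler_wpM2l// lerD2r.
rewrite -lee_fin; apply: le_trans kb; apply: ereal_sup_ubound.
by exists k, (fun i => c @^-1` [set i]) => //; exact: label_finite_partition.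
Qed.

Lemma ks_entropy_ge0 mu : invariant_measure T mu -> (0 <= ks_entropy T mu)%E.
Proof.
move=> inv; have mc : measurable_label (fun _ : S => ord0 : 'I_1).
  move=> i; rewrite (_ : _ @^-1` _ = setT)//.
  by apply/seteqP; split=> x //= _; rewrite (ord1 i).
apply: (@le_ks_entropy _ _ _ 0 inv mc) => q q0.
by rewrite mul0r orbit_ent_ge0.
Qed.

Lemma eq_ks_entropy mu nu : (forall A, measurable A -> mu A = nu A) ->
  ks_entropy T mu = ks_entropy T nu.
Proof.
move=> munu.
have E k (c : S -> 'I_k) : measurable_label c ->
    entropy_wrt T mu (fun i => c @^-1` [set i]) =
    entropy_wrt T nu (fun i => c @^-1` [set i]).
  move=> mc; congr (limn _); apply/funext => n; rewrite !partition_entropyE.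
  congr (_ * ent _); apply/funext => w; congr fine; apply: munu.
  exact: measurable_orbit_word.
congr ereal_sup; apply/seteqP; split=> _ [k [A pA ->]]; exists k, A => //;
  by have [c mc ->] := finite_partition_label pA; rewrite E.
Qed.

Section Mixture.
Variables (a b : R) (mu mu1 mu2 : probability S R).
Hypotheses (a_gt0 : 0 < a) (b_gt0 : 0 < b) (ab1 : a + b = 1).
Hypothesis mixture : forall A, measurable A ->
  prob mu A = a * prob mu1 A + b * prob mu2 A.
Hypotheses (inv : invariant_measure T mu) (inv1 : invariant_measure T mu1)
  (inv2 : invariant_measure T mu2).

Lemma label_dist_mixture (I : finType) (c : S -> I) : measurable_label c ->
  label_dist mu c = (fun i => a * label_dist mu1 c i + b * label_dist mu2 c i).
Proof. by move=> mc; apply/funext => i; exact: mixture. Qed.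

(** By [ent_mix_le] the word entropy of the mixture exceeds the mixture of word entropies by at most
    a constant [C], which vanishes after division by the length [q]. *)
Lemma ks_entropy_mixture_le (e1 e2 : R) :
  (ks_entropy T mu1 <= e1%:E)%E -> (ks_entropy T mu2 <= e2%:E)%E ->
  (ks_entropy T mu <= (a * e1 + b * e2)%:E)%E.
Proof.
move=> k1 k2; rewrite leNgt; apply/negP => /(ks_entropy_gt inv)[k [c [h [mc]]]].
set m := a * e1 + b * e2 => mh hP.
pose e := (h - m) / 2; have e0 : 0 < e by rewrite divr_gt0// subr_gt0.
have [N1 N1P] := ks_entropy_upper inv1 mc k1 e0.
have [N2 N2P] := ks_entropy_upper inv2 mc k2 e0.
pose C := - (a * ln a) - b * ln b.
pose q := (N1 + N2 + (Num.truncn (C / e)).+1)%N.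
have /N1P H1 : (N1 <= q)%N by rewrite /q -addnA leq_addr.
have /N2P H2 : (N2 <= q)%N by rewrite /q addnAC leq_addl.
have q0 : 0 < q%:R :> R by rewrite ltr0n /q addnS.
have Cq : C < q%:R * e.
  rewrite -ltr_pdivrMr//; apply: lt_le_trans (truncnS_gt _) _.
  by rewrite ler_nat leq_addl.
have mw := measurable_orbit_word 0 (l := q) mc.
have := hP q; rewrite /orbit_ent /label_ent label_dist_mixture//.
have := ent_mix_le a_gt0 b_gt0 ab1 (label_dist_prob mu1 mw)
  (label_dist_prob mu2 mw).
rewrite -/C -/(label_ent mu1 _) -/(label_ent mu2 _) -/(orbit_ent mu1 _ _)
  -/(orbit_ent mu2 _ _).
have := ler_wpM2l (ltW a_gt0) H1; have := ler_wpM2l (ltW b_gt0) H2.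
have bE : b = 1 - a by rewrite -ab1 addrC addKr.
have hE : h = m + 2 * e by rewrite /e; field.
move=> P1 P2 P3 P4; have := le_trans P4 P3; rewrite leNgt => /negP; apply.
apply: le_lt_trans (_ : q%:R * (m + e) + C < _).
  rewrite lerD2r (le_trans (lerD P2 P1))// /m bE.
  by rewrite le_eqVlt; apply/orP; left; apply/eqP; ring.
by rewrite hE mulrC -[X in _ < X]mulrC; nra.
Qed.

(** Concavity: a positive fraction [a] of arbitrarily large entropy is still arbitrarily large. *)
Lemma ks_entropy_mixture_pinfty :
  ks_entropy T mu1 = +oo%E -> ks_entropy T mu = +oo%E.
Proof.
move=> k1; apply: eq_infty => r.
have [|k [c [h [mc rh hP]]]] := @ks_entropy_gt mu1 (r / a) inv1.
  by rewrite k1 ltry.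
apply: (le_ks_entropy inv mc) => q _.
have mw := measurable_orbit_word 0 (l := q) mc.
rewrite /orbit_ent /label_ent label_dist_mixture//.
pose w (t : bool) := if t then a else b.
pose m (t : bool) := if t then label_dist mu1 (word (orbit_label T c) 0 q)
  else label_dist mu2 (word (orbit_label T c) 0 q).
have wp : fin_prob w.
  by split=> [[]|]; rewrite ?ltW// /w big_bool.
have mp t : fin_prob (m t) by case: t; exact: label_dist_prob.
have := ent_concave wp mp; rewrite big_bool/=.
rewrite (_ : (fun i => \sum_s w s * m s i) = (fun i =>
  a * label_dist mu1 (word (orbit_label T c) 0 q) i +
  b * label_dist mu2 (word (orbit_label T c) 0 q) i)); last first.
  by apply/funext => i; rewrite big_bool.
apply: le_trans; rewrite ler_wpDr//.
  by apply: mulr_ge0; [exact: ltW|exact: (label_ent_ge0 mu2 mw)].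
apply: le_trans (ler_wpM2l (ltW a_gt0) (hP q)).
by rewrite mulrA ler_wpM2r// mulrC -ler_pdivrMr// ltW.
Qed.

End Mixture.

End KSEntropy.

(** * Invariant measures and Birkhoff averages *)

Section InvariantMeasures.
Context {R : realType} {X : pmetricType R}.
Variable T : X -> X.
Hypotheses (X_compact : compact [set: X]) (T_cont : continuous T).
Implicit Types (f g phi : X -> R) (mu nu : probability (Borel X) R).

Let T_meas : measurable_fun [set: Borel X] (T : Borel X -> Borel X).
Proof. exact: borel_continuous_map. Qed.

Definition image_measure mu : probability (Borel X) R :=
  distribution mu (mfun_Sub (mem_set T_meas) : {mfun Borel X >-> Borel X}).

Lemma Rintegral_image mu f : continuous f ->
  \int[image_measure mu]_x f x =
  \int[mu]_x f (T x).
Proof.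
move=> fc; rewrite /Rintegral/=; congr fine.
rewrite integral_pushforward//=.
- by apply/measurable_EFinP; exact: borel_continuous.
- apply: (@continuous_integrable _ _ X_compact mu (f \o T)) => x.
  by apply: continuous_comp; [exact: T_cont|exact: fc].
Qed.

Lemma same_measure_Rintegral mu nu f : same_measure mu nu ->
  \int[mu]_x f x = \int[nu]_x f x.
Proof.
by move=> munu; congr fine; apply: eq_measure_integral => A mA _; exact: munu.
Qed.

Lemma Rintegral_invariant mu f : invariant_measures T mu -> continuous f ->
  \int[mu]_x f (T x) = \int[mu]_x f x.
Proof.
by move=> inv fc; rewrite -Rintegral_image//; exact: same_measure_Rintegral.
Qed.

Lemma invariant_of_Rintegral mu :
  (forall f, continuous f -> \int[mu]_x f (T x) =
                             \int[mu]_x f x) ->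
  invariant_measures T mu.
Proof.
move=> inv; have : same_measure (image_measure mu) mu.
  by apply: same_measure_integral => // f fc; rewrite Rintegral_image// inv.
by move=> munu A mA; exact: munu.
Qed.

Lemma entropy_ge0 mu : invariant_measures T mu -> (0 <= entropy T mu)%E.
Proof. exact: ks_entropy_ge0. Qed.

Lemma birkhoff_sum_continuous n phi : continuous phi ->
  continuous (birkhoff_sum T n phi).
Proof.
move=> pc; apply: (@continuous_sum _ _ _ _ _ (fun k : 'I_n => phi \o iter k T)).
by move=> k _ x; apply: continuous_comp; [exact: continuous_iter|exact: pc].
Qed.

Lemma birkhoff_sumS n phi x :
  birkhoff_sum T n.+1 phi x = phi x + birkhoff_sum T n phi (T x).
Proof.
rewrite /birkhoff_sum big_ord_recl/=; congr (_ + _); apply: eq_bigr => k _.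
by rewrite -iterSr.
Qed.

Fixpoint max_birkhoff phi (n : nat) (x : X) : R :=
  if n is m.+1 then Num.max (max_birkhoff phi m x) (birkhoff_sum T m.+1 phi x)
  else 0.

Lemma max_birkhoff_continuous phi n : continuous phi ->
  continuous (max_birkhoff phi n).
Proof.
move=> pc; elim: n => [|n IH] /=; first exact: cst_continuous.
by move=> x; apply: continuous_max; [exact: IH|exact: birkhoff_sum_continuous].
Qed.

Lemma max_birkhoff_ge0 phi n x : 0 <= max_birkhoff phi n x.
Proof. by elim: n => [//|n IH] /=; rewrite le_max IH. Qed.

Lemma le_max_birkhoff phi n m x : (m <= n)%N ->
  birkhoff_sum T m phi x <= max_birkhoff phi n x.
Proof.
elim: n => [|n IH]; first by rewrite leqn0 => /eqP ->; rewrite /birkhoff_sum big_ord0.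
rewrite leq_eqVlt => /predU1P[->|/IH mn] /=; first by rewrite le_max lexx orbT.
by rewrite le_max mn.
Qed.

(** A positive maximum is attained by a nonempty sum, which is [phi x] plus a shorter sum at [T x].
    The induction keeps [n] fixed at [T x] and varies the length on the left only. *)
Lemma max_birkhoff_gt0 phi n x : 0 < max_birkhoff phi n x ->
  max_birkhoff phi n x <= phi x + max_birkhoff phi n (T x).
Proof.
suff : forall m, (m <= n)%N -> 0 < max_birkhoff phi m x ->
    max_birkhoff phi m x <= phi x + max_birkhoff phi n (T x) by apply.
elim=> [|m IH] mn /=; first by rewrite ltxx.
rewrite lt_max ge_max => h; apply/andP; split; last first.
  by rewrite birkhoff_sumS lerD2l le_max_birkhoff// ltnW.
have [/IH -> //|M0] := ltrP 0 (max_birkhoff phi m x); first exact: ltnW.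
rewrite (le_trans M0)//; case/orP: h => [|/ltW].
  by move=> /lt_le_trans/(_ M0); rewrite ltxx.
by move/le_trans; apply; rewrite birkhoff_sumS lerD2l le_max_birkhoff// ltnW.
Qed.

(* Garsia: [phi >= M - M \o T] on the set where [M > 0]. *)
Lemma maximal_ergodic mu phi (C : R) n : invariant_measures T mu ->
  continuous phi -> (forall x, `|phi x| <= C) ->
  - C * (1 - prob mu [set x | 0 < max_birkhoff phi n x]) <=
  \int[mu]_x phi x.
Proof.
move=> inv pc pC; set M := max_birkhoff phi n.
have Mc : continuous M by exact: max_birkhoff_continuous.
have MTc : continuous (M \o T).
  by move=> x; apply: continuous_comp; [exact: T_cont|exact: Mc].
have HL := integral_state X_compact mu.
have C0 : 0 <= C by apply: le_trans (pC point).
set E : set (Borel X) := [set x | 0 < M x].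
have mE : measurable E by exact: borel_gt_fun.
have mCE := measurableC mE.
have -> : 1 - prob mu E = \int[mu]_x \1_(~` E) x.
  by rewrite /Rintegral integral_indic// setIT -probC.
rewrite -RintegralZl//; last exact: integrable_indic.
have int1 : mu.-integrable [set: Borel X]
    (EFin \o (fun x => - C * \1_(~` E) x)).
  apply: (@eq_integrable _ _ _ _ _ measurableT
    (fun x => (- C)%:E * (\1_(~` E) x)%:E)%E) => //.
  by apply: integrableZl => //; exact: integrable_indic.
(* Subtract [M - M \o T], which has integral 0 by invariance. What remains is nonnegative where
   [M > 0], and at least [- C] elsewhere, because there [M = 0]. *)
rewrite -[leRHS]subr0.
have <- : \int[mu]_x (M x - M (T x)) = 0.
  have -> : \int[mu]_x (M x - M (T x)) =
    \int[mu]_x M x - \int[mu]_x M (T x).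
    exact: (stateB HL Mc MTc).
  by rewrite Rintegral_invariant// subrr.
rewrite -(stateB HL)//; last exact: (continuous_sub_fun Mc MTc).
apply: le_Rintegral => //.
  apply: continuous_integrable => //; apply: continuous_sub_fun => //.
  exact: (continuous_sub_fun Mc MTc).
move=> x _; rewrite indicE; have := max_birkhoff_gt0 (phi := phi) (n := n) (x := x).
rewrite -/M; have := max_birkhoff_ge0 phi n (T x); rewrite -/M.
have := pC x; rewrite ler_norml => /andP[pCx _].
have [/set_mem/= |] := boolP (x \in _).
  by move=> /negP; rewrite -leNgt mulr1 => *; lra.
rewrite notin_setE/= => /contrapT Ex h1 /(_ Ex); rewrite mulr0; lra.
Qed.

(** The function [f] has negative integral. The set [A] where its Birkhoff sums are unbounded above
    is invariant and, by the maximal inequality, not of full measure, hence null. So off a small set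
    these sums stay below some [K], and [K <= n * delta / 2] for large [n]. *)
Lemma ergodic_birkhoff_upper mu phi (delta eta : R) :
  ergodic_measure (T : Borel X -> Borel X) mu -> continuous phi ->
  0 < delta -> 0 < eta ->
  exists N, forall n, (N <= n)%N ->
    prob mu [set x | n%:R * (\int[mu]_y phi y + delta)
                     < birkhoff_sum T n phi x] <= eta.
Proof.
move=> [inv erg] pc d0 e0.
set I := \int[mu]_y phi y.
have HL := integral_state X_compact mu.
have cc (c : R) : continuous (fun _ : X => c) by exact: cst_continuous.
pose f x := phi x - (I + delta / 2).
have fc : continuous f by apply: continuous_sub_fun.
have Sf n x : birkhoff_sum T n f x =
    birkhoff_sum T n phi x - n%:R * (I + delta / 2).
  by rewrite /birkhoff_sum sumrB sumr_const card_ord mulr_natl.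
have If : \int[mu]_x f x = - (delta / 2).
  rewrite (stateB HL)// (state_cst HL) -/I; lra.
have [C0 fC0] := continuous_bounded X_compact fc; pose C := C0 + 1.
have fC x : `|f x| <= C by rewrite (le_trans (fC0 x))// lerDl.
have C_gt0 : 0 < C by rewrite ltr_pwDr// (le_trans _ (fC0 point)).
pose A : set (Borel X) := [set x | forall K : nat, exists n, K%:R < birkhoff_sum T n f x].
pose B (K : nat) : set (Borel X) := [set x | forall n, birkhoff_sum T n f x <= K%:R].
have mlt K n : measurable ([set x | K%:R < birkhoff_sum T n f x] : set (Borel X)).
  by apply: borel_gt_fun; exact: birkhoff_sum_continuous.
have mB K : measurable (B K).
  rewrite (_ : B K = \bigcap_n ~` [set x | K%:R < birkhoff_sum T n f x]).
    by apply: bigcap_measurable => // n _; exact: measurableC.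
  apply/seteqP; split=> x /= Bx n; first by move=> _; apply/negP; rewrite -leNgt.
  by rewrite leNgt; apply/negP; exact: Bx.
have mA : measurable A.
  rewrite (_ : A = ~` \bigcup_K B K).
    by apply: measurableC; exact: bigcup_measurable.
  apply/seteqP; split=> x /= Ax.
    by move=> [K _ Bx]; have [n] := Ax K; rewrite ltNge Bx.
  move=> K; apply: contrapT => nK; apply: Ax; exists K => // n.
  by rewrite leNgt; apply/negP => Kn; apply: nK; exists n.
(* Up to a shift of the length by one, the sums at [x] and at [T x] differ by at most [C]. *)
have TA : T @^-1` A = A.
  have Sf_T n x : birkhoff_sum T n f (T x) = birkhoff_sum T n.+1 f x - f x.
    by rewrite birkhoff_sumS addrC addKr.
  pose c := Num.truncn C; have Cc : C < c.+1%:R by exact: truncnS_gt.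
  apply/seteqP; split=> x /= Ax K.
  - have [n] := Ax (K + c.+1)%N; rewrite Sf_T natrD => h; exists n.+1.
    by have := fC x; rewrite ler_norml => /andP[? ?]; lra.
  - have [[|n]] := Ax (K + c.+1)%N.
      by rewrite /birkhoff_sum big_ord0 ltNge ler0n.
    rewrite natrD => h; exists n; rewrite Sf_T.
    by have := fC x; rewrite ler_norml => /andP[? ?]; lra.
have mM n : measurable ([set x | 0 < max_birkhoff f n x] : set (Borel X)).
  by apply: borel_gt_fun; exact: max_birkhoff_continuous.
have probM n : prob mu [set x | 0 < max_birkhoff f n x] <= 1 - delta / 2 / C.
  have := maximal_ergodic n inv fc fC; rewrite If mulNr lerN2.
  by rewrite -ler_pdivrMl// mulrC; lra.
have probA : prob mu A <= 1 - delta / 2 / C.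
  have MS n : [set x | 0 < max_birkhoff f n x] `<=` [set x | 0 < max_birkhoff f n.+1 x].
    by move=> x /=; rewrite lt_max => ->.
  have cv := prob_nondecreasing_cvg (mu := mu) mM MS.
  apply: le_trans (_ : prob mu (\bigcup_n [set x | 0 < max_birkhoff f n x]) <= _).
    apply: le_prob => //; first exact: bigcup_measurable.
    move=> x Ax; have [n n0] := Ax 0%N; exists n => //=.
    exact: lt_le_trans n0 (le_max_birkhoff _ _ _).
  by apply: (cvgr_to_le cv); apply: nearW.
have probA0 : prob mu A = 0.
  have [|muA] := erg A mA TA; first by rewrite /prob => ->.
  have dC : 0 < delta / 2 / C by rewrite !divr_gt0.
  by move: probA; rewrite /prob muA/=; lra.
have BS K : B K `<=` B K.+1.
  by move=> x Bx n; rewrite (le_trans (Bx n))// ler_nat.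
have := prob_nondecreasing_cvg (mu := mu) mB BS.
have -> : \bigcup_K B K = ~` A.
  apply/seteqP; split=> x /=.
    by move=> [K _ Bx] /(_ K)[n]; rewrite ltNge Bx.
  move=> nA; apply: contrapT => nB; apply: nA => K.
  apply: contrapT => nK; apply: nB; exists K => // n.
  by rewrite leNgt; apply/negP => Kn; apply: nK; exists n.
rewrite probC// probA0 subr0 => /cvgrPdist_le/(_ eta e0)[K _ /(_ K (leqnn K))].
rewrite ler_norml => /andP[_ /= BK].
exists (Num.truncn (K%:R / (delta / 2))).+1 => n Nn.
have Kn : K%:R <= n%:R * (delta / 2).
  rewrite -ler_pdivrMr ?divr_gt0//; apply: le_trans (ltW (truncnS_gt _)) _.
  by rewrite ler_nat.
apply: le_trans (_ : prob mu (~` B K) <= _); last by rewrite probC//; lra.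
apply: le_prob; [|exact: measurableC|].
  by apply: borel_gt_fun; exact: birkhoff_sum_continuous.
move=> x /= nx Bx; have := Bx n; rewrite Sf leNgt => /negP; apply.
apply: le_lt_trans Kn _; move: nx; lra.
Qed.

Lemma ergodic_birkhoff mu phi (delta eta : R) :
  ergodic_measure (T : Borel X -> Borel X) mu -> continuous phi ->
  0 < delta -> 0 < eta ->
  exists N, forall n, (N <= n)%N ->
    prob mu [set x | n%:R * delta < `|birkhoff_sum T n phi x -
       n%:R * \int[mu]_y phi y|] <= eta.
Proof.
move=> erg pc d0 e0; have e20 : 0 < eta / 2 by rewrite divr_gt0.
have [N1 N1P] := ergodic_birkhoff_upper erg pc d0 e20.
have [N2 N2P] := ergodic_birkhoff_upper erg (continuous_opp_fun pc) d0 e20.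
exists (maxn N1 N2) => n; rewrite geq_max => /andP[/N1P h1 /N2P h2].
have HL := integral_state X_compact mu.
have IN : \int[mu]_x - phi x = - \int[mu]_x phi x.
  rewrite -mulN1r -(stateZ HL)//; congr (\int[mu]_(x in _) _).
  by apply/funext => x; rewrite mulN1r.
have SN x : birkhoff_sum T n (fun x => - phi x) x = - birkhoff_sum T n phi x.
  by rewrite /birkhoff_sum sumrN.
have Sc := birkhoff_sum_continuous (n := n) pc.
have SNc := birkhoff_sum_continuous (n := n) (continuous_opp_fun pc).
apply: le_trans (_ : prob mu (
  [set x | n%:R * (\int[mu]_y phi y + delta) < birkhoff_sum T n phi x] `|`
  [set x | n%:R * (\int[mu]_y - phi y + delta)
    < birkhoff_sum T n (fun x => - phi x) x]) <= _).
  apply: le_prob.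
  - apply: borel_gt_fun => x.
    by apply: cvg_norm; apply: cvgB; [exact: Sc|exact: cvg_cst].
  - by apply: measurableU; apply: borel_gt_fun.
  - move=> x /=; rewrite SN IN ltr_normr => /orP[|] h; [left|right]; move: h; lra.
by apply: le_trans (probU_le mu _ _) _; [exact: borel_gt_fun|exact: borel_gt_fun|lra].
Qed.

End InvariantMeasures.

(** * Monotone functions, and continuity of x ln x *)

Section MonotoneFunctions.
Context {R : realType}.

(** The discontinuities of a monotone function are countable, hence Lebesgue-null, and cannot fill
    an interval. Continuity at [r] is expressed through a small increment across [r]. *)
Lemma monotone_continuity_point (G : R -> R) (a b : R) : a < b ->
  (forall x y, x <= y -> G x <= G y) ->
  exists2 r, a < r < b & forall e : R, 0 < e ->
    exists s t, [/\ s < r, r < t & G t - G s <= e].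
Proof.
move=> ab Gh; have ndG : {in `[a, b] &, nondecreasing_fun G}.
  by move=> x y _ _; exact: Gh.
have [r rab nr] : exists2 r, a < r < b & ~ discontinuity G r.
  apply: contrapT => h.
  have /countable_lebesgue_measure0 := discontinuity_countable ndG.
  have -> : [set x | x \in (`]a, b[) /\ discontinuity G x] = `]a, b[%classic.
    apply/seteqP; split=> x; first by move=> [].
    move=> xab; split; first exact: xab.
    apply: contrapT => nx; apply: h; by exists x.
  rewrite lebesgue_measure_itv/= lte_fin ab -EFinB => -[/eqP].
  by rewrite subr_eq0 => /eqP ba; move: ab; rewrite ba ltxx.
exists r => // e e0.
have cl : cvg (G x @[x --> r^'-]).
  apply: nondecreasing_at_left_is_cvgr; apply: nearW => s.
    by move=> y z _ _; exact: Gh.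
  by exists (G r) => _ /= [y + <-]; rewrite in_itv/= => /andP[_ /ltW yr]; exact: Gh.
have cr : cvg (G x @[x --> r^'+]).
  apply: nondecreasing_at_right_is_cvgr; apply: nearW => s.
    by move=> y z _ _; exact: Gh.
  by exists (G r) => _ /= [y + <-]; rewrite in_itv/= => /andP[/ltW ry _]; exact: Gh.
have lrE : lim (G x @[x --> r^'-]) = lim (G x @[x --> r^'+]).
  by apply/eqP; apply: contrapT => /negP ne; apply: nr.
have e20 : 0 < e / 2 by rewrite divr_gt0.
move: cl cr; rewrite lrE; set l := lim _ => cl cr.
have : \forall x \near r^'-, x < r /\ `|l - G x| <= e / 2.
  near=> x; split; first by near: x; exact: nbhs_left_lt.
  by near: x; move/cvgrPdist_le : cl; apply.
move=> /filter_ex[s [sr ls_le]].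
have : \forall x \near r^'+, r < x /\ `|l - G x| <= e / 2.
  near=> x; split; first by near: x; exact: nbhs_right_gt.
  by near: x; move/cvgrPdist_le : cr; apply.
move=> /filter_ex[t [rt lt_le]].
exists s, t; split=> //; move: ls_le lt_le; rewrite !ler_norml.
by move=> /andP[? ?] /andP[? ?]; lra.
Unshelve. all: by end_near. Qed.

Lemma xlnx_continuous : continuous (fun x : R => x * ln x).
Proof.
move=> x; have [x0|x0] := ltrP 0 x.
  by apply: cvgM; [exact: cvg_id|exact: continuous_ln].
have xln0 : x * ln x = 0 by rewrite ln0// mulr0.
apply/cvgrPdist_le => e e0; rewrite /= xln0 {xln0}.
have d0 : 0 < Num.min (e ^+ 2 / 4) 1 by rewrite lt_min ltr01 divr_gt0// exprn_gt0.
have [x_lt0|x_ge0] := ltrP x 0.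
  near=> y; rewrite sub0r normrN.
  have y0 : y < 0 by near: y; exact: lt_nbhsl.
  by rewrite (ln0 (ltW y0)) mulr0 normr0 ltW.
have -> : x = 0 by apply/eqP; rewrite eq_le x0.
near=> y; rewrite sub0r normrN.
have yd : `|y| < Num.min (e ^+ 2 / 4) 1 by near: y; apply: cvgr0_norm_lt d0; exact: cvg_id.
have [y0|y0] := ltrP 0 y; last by rewrite ln0// mulr0 normr0 ltW.
move: yd; rewrite gtr0_norm// lt_min => /andP[ye y1].
rewrite ler0_norm; last by rewrite mulr_ge0_le0 ?ln_le0// ltW.
(* With [y = s ^ 2], the bound [- ln s <= 1 / s - 1] gives [- (y * ln y) <= 2 * s], and
   [s <= e / 2]. *)
pose s := Num.sqrt y; have s0 : 0 < s by rewrite sqrtr_gt0.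
have yE : y = s ^+ 2 by rewrite sqr_sqrtr// ltW.
have se : s <= e / 2.
  rewrite -(ler_pXn2r (n := 2))// ?nnegrE ?divr_ge0 ?ltW// -yE.
  by rewrite expr_div_n (_ : 2 ^+ 2 = 4 :> R) ?ltW//; ring.
have : - ln s <= s^-1 - 1 by rewrite -lnV ?posrE//; apply: ln_le_subr1; rewrite invr_gt0.
have sV : s * s^-1 = 1 by rewrite divff// gt_eqF.
rewrite yE lnXn// -mulr_natl => /(ler_wpM2l (ltW (mulr_gt0 s0 s0))).
have : s * s * s^-1 = s by rewrite -mulrA sV mulr1.
by move=> ssV; rewrite mulrBr mulr1 ssV expr2; have := mulr_gt0 s0 s0; lra.
Unshelve. all: by end_near. Qed.

End MonotoneFunctions.

(** * Continuity sets and partitions of small diameter *)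

Section ContinuitySets.
Context {R : realType} {X : pmetricType R}.
Hypothesis X_compact : compact [set: X].
Variable mu : probability (Borel X) R.
Implicit Types (f g : X -> R) (A B : set X).

(* Stands in for sets with null boundary, in a form that passes to weak limits. *)
Definition continuity_set A : Prop :=
  measurable (A : set (Borel X)) /\
  forall e : R, 0 < e -> exists f g : X -> R,
    [/\ continuous f, continuous g,
        forall x, [/\ 0 <= f x, f x <= \1_A x, \1_A x <= g x & g x <= 1]
      & \int[mu]_x g x
        <= \int[mu]_x f x + e].

Let HL := integral_state X_compact mu.

Lemma continuity_setT : continuity_set setT.
Proof.
split=> // e e0; exists (fun=> 1), (fun=> 1); split.
- by move=> x; exact: cst_continuous.
- by move=> x; exact: cst_continuous.
- by move=> x; rewrite indicT ler01 !lexx.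
- by rewrite lerDl ltW.
Qed.

Lemma continuity_setC A : continuity_set A -> continuity_set (~` A).
Proof.
move=> [mA hA]; split; first exact: measurableC.
move=> e /hA[f [g [fc gc fg h]]]; exists (fun x => 1 - g x), (fun x => 1 - f x).
have c1 : continuous (fun _ : X => 1 : R) by exact: cst_continuous.
split; [exact: continuous_sub_fun|exact: continuous_sub_fun| |].
- move=> x; have [f0 fA Ag g1] := fg x.
  have -> : \1_(~` A) x = 1 - \1_A x :> R.
    by rewrite !indicE in_setC; case: (x \in A); rewrite ?subr0 ?subrr.
  by split; lra.
- by rewrite !(stateB HL)// (state1 HL); lra.
Qed.

Lemma continuity_setI A B :
  continuity_set A -> continuity_set B -> continuity_set (A `&` B).
Proof.
move=> [mA hA] [mB hB]; split; first exact: measurableI.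
move=> e e0; have e20 : 0 < e / 2 by rewrite divr_gt0.
have [f [g [fc gc fg h]]] := hA _ e20.
have [f' [g' [fc' gc' fg' h']]] := hB _ e20.
exists (fun x => f x * f' x), (fun x => g x * g' x).
have c1 := continuous_mul_fun fc fc'; have c2 := continuous_mul_fun gc gc'.
split => //.
- move=> x; have [f0 fA Ag g1] := fg x; have [f0' fA' Ag' g1'] := fg' x.
  have -> : \1_(A `&` B) x = \1_A x * \1_B x :> R.
    by rewrite !indicE in_setI; case: (x \in A); rewrite /= ?mul1r ?mul0r.
  have A0 : 0 <= \1_A x :> R by rewrite indicE ler0n.
  have B0 : 0 <= \1_B x :> R by rewrite indicE ler0n.
  split.
  + exact: mulr_ge0.
  + exact: ler_pM.
  + exact: ler_pM.
  + by apply: mulr_ile1 => //; [exact: le_trans Ag|exact: le_trans Ag'].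
- have : \int[mu]_x (g x * g' x - f x * f' x) <=
      \int[mu]_x ((g x - f x) + (g' x - f' x)).
    apply: (le_state HL).
    + exact: continuous_sub_fun.
    + by apply: continuous_add_fun; exact: continuous_sub_fun.
    + move=> x; have [f0 fA Ag g1] := fg x; have [f0' fA' Ag' g1'] := fg' x.
      have fg_le := le_trans fA Ag; have fg_le' := le_trans fA' Ag'.
      have g'0 : 0 <= g' x by exact: le_trans f0' fg_le'.
      by nra.
  have := stateD HL (continuous_sub_fun gc fc) (continuous_sub_fun gc' fc').
  by move=> ->; rewrite !(stateB HL)//; lra.
Qed.

Lemma continuity_set_bigI (I : finType) (A : I -> set X) :
  (forall i, continuity_set (A i)) ->
  continuity_set [set x | forall i, A i x].
Proof.
move=> hA; have -> : [set x | forall i, A i x] =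
    [set x | forall i, i \in enum I -> A i x].
  by apply/seteqP; split=> x /= Ax i; [move=> _|apply: Ax; rewrite mem_enum].
elim: (enum I) => [|i s IH].
  by rewrite (_ : mkset _ = setT)//; [exact: continuity_setT|apply/seteqP; split].
rewrite (_ : mkset _ = A i `&` [set x | forall j, j \in s -> A j x]).
  exact: continuity_setI.
apply/seteqP; split=> x /=.
  move=> Ax; split; first by apply: Ax; rewrite mem_head.
  by move=> j js; apply: Ax; rewrite inE js orbT.
by move=> [Ai As] j; rewrite inE => /predU1P[->|/As].
Qed.

Lemma continuity_set_preimage (T : X -> X) t A : continuous T ->
  invariant_measures T mu -> continuity_set A ->
  continuity_set (iter t T @^-1` A).
Proof.
move=> Tc inv; elim: t => [//|t IH] /IH{IH}.
have -> : iter t.+1 T @^-1` A = T @^-1` (iter t T @^-1` A).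
  by apply/seteqP; split=> x; rewrite /preimage/= -iterSr.
move: (_ @^-1` A) => {}A [mA hA]; split.
  exact: borel_preimage.
move=> e /hA[f [g [fc gc fg h]]]; exists (f \o T), (g \o T); split.
- by move=> x; apply: continuous_comp; [exact: Tc|exact: fc].
- by move=> x; apply: continuous_comp; [exact: Tc|exact: gc].
- by move=> x; exact: fg.
- by rewrite !(Rintegral_invariant X_compact Tc inv).
Qed.

Lemma prob_Rintegral_indic (A : set (Borel X)) : measurable A ->
  prob mu A = \int[mu]_x \1_A x.
Proof. by move=> mA; rewrite /Rintegral integral_indic// setIT. Qed.

(** Take for [r] a continuity point of the mass of closed balls. The tents descending from [s] to
    [r] and from [r] to [t] enclose the indicator and differ only where the distance lies between
    [s] and [t]. *)
Lemma continuity_ball (x : X) (a b : R) : a < b ->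
  exists2 r, a < r < b & continuity_set [set y | mdist x y < r].
Proof.
move=> ab; have mle r : measurable ([set y | mdist x y <= r] : set (Borel X)).
  apply: borel_closed; rewrite (_ : mkset _ = mdist x @^-1` [set t | t <= r])//.
  by apply: closed_comp => [y _|]; [exact: mdist_continuous|exact: closed_le].
have oball r : open [set y | mdist x y < r].
  rewrite (_ : mkset _ = mdist x @^-1` [set t | t < r])//.
  by apply: open_comp => [y _|]; [exact: mdist_continuous|exact: open_lt].
pose G r := prob mu [set y | mdist x y <= r].
have GH s t : s <= t -> G s <= G t.
  by move=> st; apply: le_prob => // y /= /le_trans; apply.
have [r rab rP] := monotone_continuity_point ab GH.
exists r => //; split; first exact: borel_open.
move=> e /rP[s [t [sr rt Gst]]].
have cd c k : continuous (fun y : X => clamp (k * (c - mdist x y))).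
  apply: continuous_clamp; apply: continuous_scale_fun.
  apply: continuous_sub_fun; first exact: cst_continuous.
  exact: mdist_continuous.
pose f y := clamp ((r - s)^-1 * (r - mdist x y)).
pose g y := clamp ((t - r)^-1 * (t - mdist x y)).
have rs0 : 0 < r - s by rewrite subr_gt0.
have tr0 : 0 < t - r by rewrite subr_gt0.
have fle y : r <= mdist x y -> f y = 0.
  by move=> h; apply: clamp0; rewrite pmulr_rle0 ?invr_gt0// subr_le0.
have fge y : mdist x y <= s -> f y = 1.
  by move=> h; apply: clamp1; rewrite ler_pdivlMl// mulr1; lra.
have gle y : t < mdist x y -> g y = 0.
  move=> h; apply: clamp0; rewrite pmulr_rle0 ?invr_gt0//; lra.
have gge y : mdist x y <= r -> g y = 1.
  by move=> h; apply: clamp1; rewrite ler_pdivlMl// mulr1; lra.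
have gfc : continuous (fun y => g y - f y).
  by apply: continuous_sub_fun; exact: cd.
exists f, g; split; [exact: cd|exact: cd| |].
- move=> y; rewrite indicE; split; first exact: clamp_ge0.
  + have [_|] := boolP (y \in _); first exact: clamp_le1.
    by rewrite notin_setE/= => /negP; rewrite -leNgt => /fle ->.
  + have [/set_mem/= /ltW /gge ->//|_] := boolP (y \in _).
    exact: clamp_ge0.
  + exact: clamp_le1.
- rewrite addrC -lerBlDr.
  have <- := stateB HL (cd t (t - r)^-1) (cd r (r - s)^-1).
  apply: le_trans Gst.
  have mD : measurable ([set y | mdist x y <= t] `\` [set y | mdist x y <= s] : set (Borel X)).
    exact: measurableD.
  have <- : prob mu ([set y | mdist x y <= t] `\` [set y | mdist x y <= s]) = G t - G s.
    rewrite /G (probID mu (mle t) (mle s)) (_ : _ `&` _ = [set y | mdist x y <= s]).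
      by rewrite addrC addKr.
    apply/seteqP; split=> y /=; first by move=> [].
    by move=> ys; split=> //; apply: le_trans ys _; rewrite ltW// (lt_trans sr).
  rewrite prob_Rintegral_indic//; apply: le_Rintegral => //.
  + exact: continuous_integrable.
  + exact: integrable_indic.
  + move=> y _; rewrite indicE -/(g y) -/(f y).
    have [_|] := boolP (y \in _).
      by have := clamp_le1 ((t - r)^-1 * (t - mdist x y));
         have := clamp_ge0 ((r - s)^-1 * (r - mdist x y)); rewrite /f /g /=; lra.
    rewrite notin_setE/= => yD; have [yt|yt] := leP (mdist x y) t.
      have ys : mdist x y <= s by apply: contrapT => ys; apply: yD.
      by rewrite fge// gge ?subrr// (le_trans ys)// ltW.
    by rewrite gle// sub0r oppr_le0; exact: clamp_ge0.
Qed.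

(** Cover [X] by finitely many such balls of radius less than [e / 2] and label a point by the set
    of balls containing it. Points with equal labels share a ball. *)
Lemma continuity_partition (e : R) : 0 < e ->
  exists m (c : X -> 'I_m),
    (forall i, continuity_set (c @^-1` [set i])) /\
    (forall x y, c x = c y -> mdist x y <= e).
Proof.
move=> e0; have e40 : e / 4 < e / 2 by lra.
have /choice[r rP] : forall x : X, exists r,
    e / 4 < r < e / 2 /\ continuity_set [set y | mdist x y < r].
  by move=> x; have [r rab rc] := continuity_ball x e40; exists r.
have oball x : open [set y | mdist x y < r x].
  rewrite (_ : mkset _ = mdist x @^-1` [set t | t < r x])//.
  by apply: open_comp => [y _|]; [exact: mdist_continuous|exact: open_lt].
have := X_compact; rewrite compact_cover.
move=> /(_ X setT (fun x => [set y | mdist x y < r x]) (fun x _ => oball x)).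
case=> [x _|D _ Dcov].
  by exists x => //=; rewrite mdistxx; have [/andP[? _] _] := rP x; lra.
pose I := {ffun D -> bool}.
pose b (x : X) : I := [ffun y : D => mdist (val y) x < r (val y)].
have bc i : continuity_set (b @^-1` [set i]).
  pose B (y : D) : set X := [set z | mdist (val y) z < r (val y)].
  pose A (y : D) : set X := if i y then B y else ~` B y.
  rewrite (_ : _ @^-1` _ = [set x | forall y : D, A y x]).
    apply: continuity_set_bigI => y; rewrite /A; case: (i y).
      exact: (rP _).2.
    exact: continuity_setC (rP _).2.
  apply/seteqP; split=> x /=.
    by move=> bi y; rewrite /A -bi ffunE; case: ifPn => //= /negP.
  move=> h; apply/ffunP => y; rewrite ffunE; have := h y; rewrite /A.
  by case: (i y) => // /negP/negbTE.
exists #|I|, (fun x => enum_rank (b x)); split.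
  move=> i; rewrite (_ : _ @^-1` _ = b @^-1` [set enum_val i]); first exact: bc.
  apply/seteqP; split=> x /=; first by move=> <-; rewrite enum_rankK.
  by move=> ->; rewrite enum_valK.
move=> x y /enum_rank_inj bxy; have [z /= zD zx] := Dcov x Logic.I.
have := congr1 (fun u : I => u (FSetSub zD)) bxy; rewrite !ffunE/= zx => /esym zy.
have := metric_triangle x z y; rewrite (metric_sym x z).
by have [/andP[_ ?] _] := rP z; lra.
Qed.

End ContinuitySets.

(** * Empirical averages and Misiurewicz's argument *)

Section EmpiricalMeasures.
Context {R : realType} {X : pmetricType R}.
Variable T : X -> X.
Implicit Types (f g : X -> R) (W : finType).

Definition empirical W (e : W -> X) (n : nat) f : R :=
  \sum_(i < n) n%:R^-1 * \sum_w #|W|%:R^-1 * f (iter i T (e w)).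

Lemma le_empirical W (e : W -> X) n f g : (forall x, f x <= g x) ->
  empirical e n f <= empirical e n g.
Proof.
move=> fg; apply: ler_sum => i _; rewrite ler_wpM2l ?invr_ge0//.
by apply: ler_sum => w _; rewrite ler_wpM2l ?invr_ge0.
Qed.

Lemma empirical_cst W (e : W -> X) n (c : R) : (0 < #|W|)%N -> (0 < n)%N ->
  empirical e n (fun=> c) = c.
Proof.
move=> W0 n0; rewrite /empirical.
under eq_bigr do rewrite -mulr_suml (uniform_prob W0).2 mul1r.
rewrite sumr_const card_ord -[_ *+ n]mulr_natl mulVKf//.
by rewrite pnatr_eq0 -lt0n.
Qed.

Lemma empirical_state W (e : W -> X) n : (0 < #|W|)%N -> (0 < n)%N ->
  is_state (empirical e n).
Proof.
move=> W0 n0; split.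
- move=> f g _ _; rewrite -big_split/=; apply: eq_bigr => i _.
  rewrite -mulrDr -big_split/=; congr (_ * _); apply: eq_bigr => w _.
  by rewrite mulrDr.
- move=> a f _; rewrite mulr_sumr; apply: eq_bigr => i _.
  rewrite [RHS]mulrCA; congr (_ * _); rewrite mulr_sumr; apply: eq_bigr => w _.
  by rewrite mulrCA.
- by move=> f _ f0; rewrite -(empirical_cst e 0 W0 n0); exact: le_empirical.
- exact: empirical_cst.
Qed.

(** The sum over time telescopes, leaving only the first and the last term. *)
Lemma empirical_invariance W (e : W -> X) n f (C : R) :
  (0 < #|W|)%N -> (0 < n)%N -> (forall x, `|f x| <= C) ->
  `|empirical e n (f \o T) - empirical e n f| <= 2 * C / n%:R.
Proof.
move=> W0 n0 fC; pose F i := \sum_w #|W|%:R^-1 * f (iter i T (e w)).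
have FC i : `|F i| <= C.
  have -> : C = \sum_(w : W) #|W|%:R^-1 * C.
    by rewrite -mulr_suml (uniform_prob W0).2 mul1r.
  apply: le_trans (ler_norm_sum _ _ _) _; apply: ler_sum => w _.
  by rewrite normrM ger0_norm ?invr_ge0// ler_wpM2l ?invr_ge0.
have -> : empirical e n (f \o T) = n%:R^-1 * \sum_(i < n) F i.+1 by rewrite mulr_sumr.
have -> : empirical e n f = n%:R^-1 * \sum_(i < n) F i by rewrite mulr_sumr.
rewrite -mulrBr -sumrB normrM ger0_norm ?invr_ge0//.
rewrite mulrC ler_pM2r ?invr_gt0 ?ltr0n//.
rewrite -(big_mkord xpredT (fun i => F i.+1 - F i)) telescope_sumr//.
by apply: le_trans (ler_normB _ _) _; have := FC n; have := FC 0%N; lra.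
Qed.

Lemma empirical_label W (e : W -> X) n (J : finType) (v : X -> J) j :
  empirical e n (\1_(v @^-1` [set j])) =
  \sum_(s < n) n%:R^-1 * marginal (fun=> #|W|%:R^-1) (fun w => v (iter s T (e w))) j.
Proof.
rewrite /empirical; apply: eq_bigr => i _; congr (_ * _).
rewrite /marginal [RHS]big_mkcond/=.
apply: eq_bigr => w _; rewrite indicE; case: eqP => [vj|vj].
  by rewrite mem_set// mulr1.
by rewrite memNset// mulr0.
Qed.

Lemma fin_word_ent_block W (p : W -> R) (I : finType) (xi : nat -> W -> I) n q :
  fin_prob p -> (0 < q)%N ->
  q%:R * ent (marginal p (word xi 0 n)) <=
  \sum_(t < n) ent (marginal p (word xi t q)) + 2 * q%:R ^+ 2 * ln #|I|%:R.
Proof.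
move=> pp q0.
have lnI : 0 <= ln #|I|%:R :> R.
  have [I0|I0] := posnP #|I|; first by rewrite I0 ln0.
  by rewrite ln_ge0// ler1n.
apply: (@block_subadditivity _ (fun s l => ent (marginal p (word xi s l)))) => //.
- move=> s l m; rewrite word_glue.
  exact: le_trans (ent_comp_le _ _ pp) (ent_pair_le _ _ pp).
- by move=> s l m lm; rewrite (word_truncate _ _ lm); exact: ent_comp_le.
- move=> s l; have := ent_le_ln_card (marginal_prob (word xi s l) pp).
  move=> /le_trans; apply; rewrite card_ffun card_ord natrX.
  have [I0|I0] := posnP #|I|; last by rewrite lnXn ?ltr0n// mulr_natl.
  rewrite I0 [X in _ * X]ln0// mulr0.
  by case: l => [|l]; rewrite ?expr0 ?ln1// expr0n/= ln0.
Qed.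

(** Separated points have distinct words of length [n], so the uniform law on them has word entropy
    [ln #|W|]. Cutting into blocks of length [q] leaves an average over starting times, which
    concavity moves inside the entropy of the empirical average. *)
Lemma separated_empirical_ent W (e : W -> X) (eps : R) n q (m : nat) (c : X -> 'I_m) :
  (0 < #|W|)%N -> (0 < n)%N -> (0 < q)%N -> 0 <= eps ->
  (forall w w', w != w' -> eps < bowen_dist T n (e w) (e w')) ->
  (forall x y, c x = c y -> mdist x y <= eps) ->
  q%:R * ln #|W|%:R <=
  n%:R * ent (fun j => empirical e n (\1_(word (orbit_label T c) 0 q @^-1` [set j])))
  + 2 * q%:R ^+ 2 * ln m%:R.
Proof.
move=> W0 n0 q0 eps0 sep cdiam; pose xi t w := c (iter t T (e w)).
have pW := uniform_prob (R := R) W0.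
rewrite -(@ent_uniform_inj R _ _ (word xi 0 n) W0); last first.
  move=> w w' ww'; apply: contrapT => /eqP /sep; rewrite ltNge => /negP; apply.
  apply/bigmax_leP; split=> // i _; apply: cdiam.
  by have := congr1 (fun u : {ffun 'I_n -> 'I_m} => u i) ww'; rewrite !ffunE.
apply: le_trans (fin_word_ent_block _ _ pW q0) _; rewrite card_ord lerD2r.
have n0' : 0 < n%:R :> R by rewrite ltr0n.
rewrite -ler_pdivrMl// mulr_sumr.
have pn : fin_prob (fun _ : 'I_n => n%:R^-1 : R).
  by have := @uniform_prob R 'I_n; rewrite card_ord; exact.
under [X in _ <= ent X]eq_fun do rewrite empirical_label.
have := ent_concave pn (fun s => marginal_prob (word xi s q) pW).
move=> /le_trans; apply; rewrite le_eqVlt; apply/orP; left; apply/eqP.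
congr ent; apply/funext => j; apply: eq_bigr => s _; congr (_ * marginal _ _ _).
apply/funext => w; rewrite -[RHS]/((word (orbit_label T c) 0 q \o iter s T) (e w)).
by rewrite -word_orbit; apply/ffunP => i; rewrite !ffunE.
Qed.

Hypotheses (X_compact : compact [set: X]) (T_cont : continuous T).

(** Monotonicity of [L] is required on all functions because the indicator, squeezed between two
    continuous functions, is itself not continuous. *)
Lemma empirical_continuity_set (mu : probability (Borel X) R) (I : Type)
    (U : set_system I) (L : I -> (X -> R) -> R) (A : set X) :
  Filter U -> (forall i f g, (forall x, f x <= g x) -> L i f <= L i g) ->
  (forall f, continuous f -> L i f @[i --> U] --> \int[mu]_x f x) ->
  continuity_set mu A -> L i (\1_A) @[i --> U] --> prob mu A.
Proof.
move=> FU Lmono Lcvg [mA hA]; apply/cvgrPdist_le => e e0.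
have e20 : 0 < e / 2 by rewrite divr_gt0.
have [f [g [fc gc fg h]]] := hA _ e20.
have /cvgrPdist_le/(_ _ e20) Lf := Lcvg f fc.
have /cvgrPdist_le/(_ _ e20) Lg := Lcvg g gc.
have fA : \int[mu]_x f x <= prob mu A.
  rewrite (prob_Rintegral_indic mu mA); apply: le_Rintegral => //.
  - exact: continuous_integrable.
  - exact: integrable_indic.
  - by move=> x _; have [] := fg x.
have Ag : prob mu A <= \int[mu]_x g x.
  rewrite (prob_Rintegral_indic mu mA); apply: le_Rintegral => //.
  - exact: integrable_indic.
  - exact: continuous_integrable.
  - by move=> x _; have [] := fg x.
near=> i; have : `|\int[mu]_x f x - L i f| <= e / 2.
  by near: i.
have : `|\int[mu]_x g x - L i g| <= e / 2 by near: i.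
have : L i f <= L i (\1_A) by apply: Lmono => x; have [] := fg x.
have : L i (\1_A) <= L i g by apply: Lmono => x; have [] := fg x.
rewrite !ler_norml => ? ? /andP[? ?] /andP[? ?]; apply/andP; split; lra.
Unshelve. all: by end_near. Qed.

Lemma cvg_div_index (U : set_system nat) (n : nat -> nat) (C : R) : Filter U ->
  (forall N, U [set k | (N <= k)%N]) -> (forall k, (k < n k)%N) ->
  C / (n k)%:R @[k --> U] --> (0 : R).
Proof.
move=> FU Uoo kn; have n0 k : (0 < n k)%N by exact: leq_ltn_trans (kn k).
apply/cvgrPdist_le => d d0; near=> k; rewrite sub0r normrN normrM normfV.
rewrite normr_nat ler_pdivrMr ?ltr0n// -ler_pdivrMl// mulrC.
apply: le_trans (ltW (truncnS_gt _)) _; rewrite ler_nat ltnW//.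
apply: leq_ltn_trans (kn k); near: k.
exact: (Uoo (Num.truncn (`|C| / d)).+1).
Unshelve. all: by end_near. Qed.

Lemma misiurewicz (U : set_system nat) (n : nat -> nat) (W : nat -> finType)
    (e : forall k, W k -> X) (eps : R) (a : nat -> R) (b : R)
    (mu : probability (Borel X) R) :
  ProperFilter U -> (forall N, U [set k | (N <= k)%N]) ->
  (forall k, (k < n k)%N) -> (forall k, (0 < #|W k|)%N) -> 0 < eps ->
  (forall k w w', w != w' -> eps < bowen_dist T (n k) (e k w) (e k w')) ->
  (forall f, continuous f ->
    empirical (e k) (n k) f @[k --> U] --> \int[mu]_x f x) ->
  (forall k, (n k)%:R * a k <= ln #|W k|%:R) -> a k @[k --> U] --> b ->
  invariant_measures T mu /\ (b%:E <= entropy T mu)%E.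
Proof.
move=> PU Uoo kn W0 eps0 sep mucvg aW ab.
have n0 k : (0 < n k)%N by exact: leq_ltn_trans (kn k).
have inv_cvg (C : R) : C / (n k)%:R @[k --> U] --> (0 : R).
  exact: cvg_div_index.
have inv : invariant_measures T mu.
  apply: invariant_of_Rintegral => // f fc.
  have fTc : continuous (f \o T).
    by move=> x; apply: continuous_comp; [exact: T_cont|exact: fc].
  have [C fC] := continuous_bounded X_compact fc.
  apply: subr0_eq; apply: (@cvg_unique _ _ (empirical (e k) (n k) (f \o T) -
      empirical (e k) (n k) f @[k --> U])) => //.
    by apply: cvgB; exact: mucvg.
  apply/cvgrPdist_le => d d0; have /cvgrPdist_le/(_ d d0) Ck := inv_cvg (2 * C).
  near=> k; rewrite sub0r normrN.
  apply: le_trans (empirical_invariance (e k) (W0 k) (n0 k) fC) _.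
  have : `|0 - 2 * C / (n k)%:R| <= d by near: k.
  by rewrite sub0r normrN; apply: le_trans; exact: ler_norm.
split=> //.
(* The partition depends on the limit [mu]: its atoms must be continuity sets of [mu]. *)
have [m [c [cc cdiam]]] := continuity_partition X_compact mu eps0.
have mc : measurable_label (c : Borel X -> 'I_m) by move=> i; exact: (cc i).1.
apply: (le_ks_entropy (borel_continuous_map T_cont) inv mc) => q q0.
have wc j : continuity_set mu (word (orbit_label T c) 0 q @^-1` [set j]).
  rewrite (_ : _ @^-1` _ = [set x | forall t : 'I_q, (iter t T @^-1` (c @^-1` [set j t])) x]).
    by apply: continuity_set_bigI => // t; exact: continuity_set_preimage.
  apply/seteqP; split=> x /=; first by move=> <- t; rewrite ffunE add0n.
  by move=> h; apply/ffunP => t; rewrite ffunE add0n; exact: h.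
pose E k j := empirical (e k) (n k) (\1_(word (orbit_label T c) 0 q @^-1` [set j])).
have wcvg j : E k j @[k --> U] --> label_dist mu (word (orbit_label T c) 0 q) j.
  apply: (@empirical_continuity_set mu _ U (fun k => empirical (e k) (n k))) => //.
  by move=> k f g fg; exact: le_empirical.
have entcvg : ent (E k) @[k --> U] --> orbit_ent (T : Borel X -> Borel X) mu c q.
  apply: cvgN; apply: (@cvg_big R _ _ 0 _ _ _ _ _ (fun j k => E k j * ln (E k j))).
    by move=> xy; apply: cvgD; [exact: cvg_fst|exact: cvg_snd].
  move=> j _; apply: (cvg_comp (fun k => E k j) (fun x => x * ln x) (wcvg j)).
  exact: xlnx_continuous.
(* Here [q] is fixed while [n k] tends to infinity, so the last term vanishes in the limit. *)
have key k : q%:R * a k <= ent (E k) + 2 * q%:R ^+ 2 * ln m%:R / (n k)%:R.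
  have nk0 : 0 < (n k)%:R :> R by rewrite ltr0n.
  rewrite -(ler_pM2l nk0) mulrDr [X in _ + X]mulrC divfK ?gt_eqF//.
  apply: le_trans (separated_empirical_ent (W0 k) (n0 k) q0 (ltW eps0) (sep k) cdiam).
  by rewrite mulrCA ler_wpM2l.
rewrite mulrC -[leRHS]addr0.
apply: (@ler_cvg_to nat U _ R (fun k => q%:R * a k)
  (fun k => ent (E k) + 2 * q%:R ^+ 2 * ln m%:R / (n k)%:R)).
- by apply: cvgMr.
- by apply: cvgD.
- by apply: nearW.
Unshelve. all: by end_near. Qed.

End EmpiricalMeasures.

(** * Growth rates of separated sets *)

Section SeparatedGrowth.
Context {R : realType} {X : pmetricType R}.
Variable T : X -> X.
Local Open Scope ereal_scope.

Lemma limn_esup_frequently (u : (\bar R)^nat) (c : \bar R) N :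
  c < limn_esup u -> exists2 n, (N <= n)%N & c < u n.
Proof.
rewrite limn_esup_lim (cvg_lim _ (@cvg_esups_inf R u))// => cu.
have : c < esups u N.
  by apply: lt_le_trans cu _; apply: ereal_inf_lbound; exists N.
by move=> /ereal_sup_gt[_ [n /= Nn <-] cn]; exists n.
Qed.

Lemma limn_esup_ge (u : (\bar R)^nat) (c : \bar R) :
  (forall N, exists2 n, (N <= n)%N & c <= u n) -> c <= limn_esup u.
Proof.
move=> cu; rewrite limn_esup_lim (cvg_lim _ (@cvg_esups_inf R u))//.
apply: le_ereal_inf_tmp => _ [N _ <-]; have [n Nn cn] := cu N.
by apply: le_trans cn _; apply: ereal_sup_ubound; exists n.
Qed.

Definition separated_sup (w : nat -> X -> R) (e : R) (n : nat) : \bar R :=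
  ereal_sup [set \esum_(x in E) (expR (w n x))%:E | E in dyn_separated T n e].

Definition growth_at (w : nat -> X -> R) (e : R) : \bar R :=
  limn_esup (fun n => (n%:R^-1)%:E * lne (separated_sup w e n)).

Lemma separated_sup_ge0 w e n : 0 <= separated_sup w e n.
Proof.
apply: le_trans (_ : \esum_(x in set0) (expR (w n x))%:E <= _).
  by rewrite esum_set0.
by apply: ereal_sup_ubound; exists set0.
Qed.

Lemma le_growth_at w e e' : (e <= e')%R -> growth_at w e' <= growth_at w e.
Proof.
move=> ee'; rewrite /growth_at.
rewrite !limn_esup_lim !(cvg_lim _ (@cvg_esups_inf R _))//.
apply: le_ereal_inf_tmp => _ [N _ <-].
apply: le_trans (ereal_inf_lbound _) _; first by exists N.
apply: ge_ereal_sup => _ [n /= Nn <-].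
apply: le_trans (ereal_sup_ubound _); last by exists n.
apply: lee_wpmul2l; first by rewrite lee_fin invr_ge0.
rewrite lee_lne ?in_itv/= ?andbT ?separated_sup_ge0 ?leey//.
apply: ereal_sup_le => _ [E sE <-]; exists E => // x y Ex Ey xy.
exact: le_lt_trans (sE x y Ex Ey xy).
Qed.

Lemma separated_growthE w :
  separated_growth T w = ereal_sup (growth_at w @` [set` `]0%R, +oo[]).
Proof.
have mono : {in Interval (BRight 0%R) +oo%O &, {homo growth_at w : e e' /
    (e <= e')%R >-> e' <= e}} by move=> e e' _ _; exact: le_growth_at.
transitivity (lim (growth_at w e @[e --> 0^'+])%classic) => //.
apply: cvg_lim => //.
exact: (nonincreasing_at_right_cvge +oo%O (isT : (BRight 0%R < +oo)%O) mono).
Qed.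

Lemma separated_growth_le w (S : \bar R) :
  (forall e, (0 < e)%R -> growth_at w e <= S) -> separated_growth T w <= S.
Proof.
move=> gS; rewrite separated_growthE; apply: ge_ereal_sup => _ [e /= e0 <-].
by apply: gS; move: e0; rewrite in_itv/= andbT.
Qed.

Lemma separated_growth_ge w (e : R) (c : \bar R) :
  (0 < e)%R -> c <= growth_at w e -> c <= separated_growth T w.
Proof.
move=> e0 cg; rewrite separated_growthE; apply: le_trans cg _.
by apply: ereal_sup_ubound; exists e => //=; rewrite in_itv/= e0.
Qed.

Lemma separated_sup_gt w e n (c : R) : (0 < n)%N ->
  c%:E < (n%:R^-1)%:E * lne (separated_sup w e n) ->
  exists (W : finType) (p : W -> X),
    (forall a b, a != b -> e < bowen_dist T n (p a) (p b))%R /\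
    (expR (n%:R * c) < \sum_a expR (w n (p a)))%R.
Proof.
move=> n0 cs; have n0' : (0 < n%:R :> R)%R by rewrite ltr0n.
have : (expR (n%:R * c))%:E < separated_sup w e n.
  move: cs; case: (separated_sup w e n) => [s cs|_|].
  - move: cs; rewrite /lne; case: ifPn => [s0|].
      by rewrite gt0_muleNy// lte_fin invr_gt0.
    rewrite -ltNge -EFinM !lte_fin ltr_pdivlMl// => s0.
    by rewrite -[X in (X < _)%R -> _]expRK ltr_ln ?posrE ?expR_gt0.
  - by rewrite ltry.
  - by rewrite /= gt0_muleNy// lte_fin invr_gt0.
(* The first supremum yields a separated set [E], the second, inside [\esum], a finite subset [A] of
   it. *)
move=> /ereal_sup_gt[_ [E sE <-]] /ereal_sup_gt[_ [A [finA AE] <-]] cA.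
exists (fset_set A), (fun a => val a); split.
  move=> a b ab; apply: sE; last by rewrite (inj_eq val_inj).
    by apply: AE; have := valP a; rewrite in_fset_set// => /set_mem.
  by apply: AE; have := valP b; rewrite in_fset_set// => /set_mem.
move: cA; rewrite fsbig_finite//= sumEFin lte_fin.
by rewrite big_seq_fsetE.
Qed.

Lemma separated_sup_ge w e n (c : R) (W : finType) (p : W -> X) :
  (0 < n)%N -> (0 <= e)%R ->
  (forall a b, a != b -> e < bowen_dist T n (p a) (p b))%R ->
  (expR (n%:R * c) <= \sum_a expR (w n (p a)))%R ->
  c%:E <= (n%:R^-1)%:E * lne (separated_sup w e n).
Proof.
move=> n0 e0 sep cW; have n0' : (0 < n%:R :> R)%R by rewrite ltr0n.
have pinj : injective p.
  move=> a b pab; apply: contrapT => /eqP /sep; rewrite pab ltNge => /negP; apply.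
  by apply/bigmax_leP; split=> // i _; rewrite mdistxx.
have : (expR (n%:R * c))%:E <= separated_sup w e n.
  apply: le_trans (_ : (\sum_a expR (w n (p a)))%:E <= _); first by rewrite lee_fin.
  apply: le_trans (_ : \esum_(x in range p) (expR (w n x))%:E <= _); last first.
    apply: ereal_sup_ubound; exists (range p) => // _ _ [a _ <-] [b _ <-] ab.
    by apply: sep; apply: contraNneq ab => ->.
  rewrite esum_image//; last by move=> a b _ _; exact: pinj.
  rewrite esum_fset//= (fsbigE (index_enum W) _ (index_enum_uniq W))//=.
  - by rewrite -sumEFin; under [leRHS]eq_bigl do rewrite in_setT.
  - by move=> a _; rewrite mem_index_enum.
case: (separated_sup w e n) => [s|_|//].
- rewrite lee_fin => cs; have s0 : (0 < s)%R by rewrite (lt_le_trans _ cs)// expR_gt0.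
  rewrite (lne_EFin s0) -EFinM lee_fin ler_pdivlMl//.
  by rewrite -[leLHS]expRK ler_ln ?posrE ?expR_gt0.
- by rewrite /= gt0_muley ?leey// lte_fin invr_gt0.
Qed.

End SeparatedGrowth.

(** * Upper bound in the variational principle *)

Section UpperBound.
Context {R : realType} {X : pmetricType R}.
Variables (T : X -> X) (d : nat) (Phi : 'I_d -> X -> R).
Variable F : 'rV[R]_d -> R.

Definition birkhoff_vec (n : nat) (x : X) : 'rV[R]_d :=
  \row_i (birkhoff_sum T n (Phi i) x / n%:R).

Lemma empirical_birkhoff (W : finType) (e : W -> X) n (f : X -> R) :
  empirical T e n f = \sum_w #|W|%:R^-1 * (birkhoff_sum T n f (e w) / n%:R).
Proof.
rewrite /empirical; under eq_bigr do rewrite mulr_sumr.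
rewrite exchange_big/=; apply: eq_bigr => w _.
rewrite /birkhoff_sum mulr_suml mulr_sumr; apply: eq_bigr => i _.
by rewrite mulrCA (mulrC (f _)).
Qed.

(** One class carries at least the fraction [1 / #|D|] of the exponential sum. On it [F] is at most
    [F z + delta], so its cardinality must be large. *)
Lemma pigeonhole_count (W : finType) (v : W -> 'rV[R]_d) (n : nat) (c delta : R)
    (D : {fset 'rV[R]_d}) (V : 'rV[R]_d -> set 'rV[R]_d) :
  (forall w, exists2 z, z \in D & V z (v w)) ->
  (forall z y, z \in D -> V z y -> F y <= F z + delta) ->
  expR (n%:R * c) < \sum_w expR (n%:R * F (v w)) ->
  exists z (P : pred W), [/\ z \in D, forall w, P w -> V z (v w),
    (0 < #|P|)%N & n%:R * (c - F z - delta) - ln #|` D|%:R <= ln #|P|%:R].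
Proof.
move=> vD VF cv; pose P z := [pred w | `[< V z (v w) >]].
have D0 : (0 < #|` D|)%N.
  rewrite lt0n; apply/eqP => /cardfs0_eq DE.
  have W0 : #|W| = 0%N.
    by apply: eq_card0 => w; have [z] := vD w; rewrite DE inE.
  move: cv; rewrite big1 => [|w _]; first by rewrite ltNge expR_ge0.
  by have := card0_eq W0 w; rewrite inE.
have D0' : 0 < #|` D|%:R :> R by rewrite ltr0n.
(* Otherwise the classes, which cover [W], would contribute at most [expR (n * c)] altogether. *)
have [z zD Pz] : exists2 z, z \in D &
    expR (n%:R * c) / #|` D|%:R < #|P z|%:R * expR (n%:R * (F z + delta)).
  apply: contrapT => h; move: cv; apply/negP; rewrite -leNgt.
  apply: (@le_trans _ _ (\sum_(z <- D) #|P z|%:R * expR (n%:R * (F z + delta)))).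
    apply: (@le_trans _ _ (\sum_w \sum_(z <- D | P z w) expR (n%:R * F (v w)))).
      apply: ler_sum => w _; have [z zD Vz] := vD w.
      rewrite big_mkcond/= (big_fsetD1 z)//=.
      have -> : `[< V z (v w) >] by apply/asboolP.
      by rewrite lerDl sumr_ge0// => y _; case: ifP => // _; exact: expR_ge0.
    rewrite (exchange_big_dep predT)//= big_seq [leRHS]big_seq.
    apply: ler_sum => z zD; rewrite mulr_natl -sumr_const.
    apply: ler_sum => w /asboolP Vz; rewrite ler_expR ler_wpM2l//.
    exact: VF.
  apply: (@le_trans _ _ (\sum_(z <- D) expR (n%:R * c) / #|` D|%:R)).
    rewrite big_seq [leRHS]big_seq; apply: ler_sum => z zD.
    by rewrite leNgt; apply/negP => hz; apply: h; exists z.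
  rewrite big_const_seq count_predT iter_addr_0 -[_ *+ _]mulr_natr.
  by rewrite divfK// gt_eqF.
have P0 : (0 < #|P z|)%N.
  rewrite lt0n; apply/eqP => P0; move: Pz; rewrite P0 mul0r ltNge.
  by rewrite divr_ge0// expR_ge0.
exists z, (P z); split=> //; first by move=> w /asboolP.
have P0' : 0 < #|P z|%:R :> R by rewrite ltr0n.
have : ln (expR (n%:R * c) / #|` D|%:R) <= ln (#|P z|%:R * expR (n%:R * (F z + delta))).
  by rewrite ler_ln ?posrE ?divr_gt0 ?mulr_gt0 ?expR_gt0// ltW.
rewrite ln_div ?posrE ?expR_gt0// lnM ?posrE ?expR_gt0// !expRK.
by rewrite !mulrBr mulrDr; lra.
Qed.

Hypotheses (X_compact : compact [set: X]) (T_cont : continuous T).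
Hypotheses (Phi_cont : forall i, continuous (Phi i)) (F_cont : continuous F).

Lemma Phi_bounded : exists C : R, forall i x, `|Phi i x| <= C.
Proof.
have /choice[C CP] : forall i, exists C : R, forall x, `|Phi i x| <= C.
  by move=> i; exact: continuous_bounded.
exists (\sum_i C i) => i x; apply: le_trans (CP i x) _.
rewrite (bigD1 i)//= lerDl sumr_ge0// => j _.
exact: le_trans (CP j point).
Qed.

Lemma birkhoff_sum_norm_le n (f : X -> R) (C : R) x :
  (forall x, `|f x| <= C) -> `|birkhoff_sum T n f x| <= n%:R * C.
Proof.
move=> fC; apply: le_trans (ler_norm_sum _ _ _) _.
rewrite -[n in n%:R]card_ord mulr_natl -sumr_const.
by apply: ler_sum => i _; exact: fC.
Qed.

Lemma box_compact (C : R) : compact [set v : 'rV[R]_d | forall i, `|v ord0 i| <= C].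
Proof.
have := @rV_compact R d (fun=> `[- C, C]%classic) (fun=> @segment_compact _ _ _).
congr compact; apply/seteqP; split=> v /= vC i; have := vC i;
  by rewrite in_itv/= ler_norml.
Qed.

Lemma cvg_row (I : Type) (U : set_system I) (u : I -> 'rV[R]_d) (l : 'rV[R]_d) :
  Filter U -> (forall i, u k ord0 i @[k --> U] --> l ord0 i) -> u k @[k --> U] --> l.
Proof.
move=> FU ul; apply/cvg_ballP => e e0.
have H i : \forall k \near U, ball (l ord0 i) e (u k ord0 i).
  by have /cvg_ballP/(_ e e0) := ul i.
have : \forall k \near U, forall i, ball (l ord0 i) e (u k ord0 i).
  exact: filter_forall.
by apply: filterS => k h; split=> // i j; rewrite ord1; exact: h.
Qed.

Lemma local_oscillation (delta : R) (z : 'rV[R]_d) : 0 < delta ->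
  exists2 eta : R, 0 < eta & forall y : 'rV[R]_d,
    (forall i, `|z ord0 i - y ord0 i| < eta) -> `|F z - F y| <= delta.
Proof.
move=> d0; have /cvgrPdist_le/(_ _ d0) := @F_cont z.
rewrite near_simpl => /nbhs_ballP[eta /= eta0 h]; exists eta => // y hy.
by apply: h; split=> // i j; rewrite ord1; exact: hy.
Qed.

Lemma ereal_between (x y : \bar R) :
  (x < y)%E -> exists2 r : R, (x < r%:E)%E & (r%:E < y)%E.
Proof.
case: x y => [x| |] [y| |] //.
- by rewrite lte_fin => xy; exists ((x + y) / 2); rewrite lte_fin; lra.
- by move=> _; exists (x + 1); rewrite ?ltry// lte_fin ltrDl.
- by move=> _; exists (y - 1); rewrite ?ltNyr// lte_fin gtrDl oppr_lt0.
- by move=> _; exists 0; rewrite ?ltNyr ?ltry.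
Qed.

Lemma nonlinear_pressure_le (S : \bar R) :
  (forall mu, invariant_measures T mu ->
     (entropy T mu + (F (integral_vec Phi mu))%:E <= S)%E) ->
  (nonlinear_pressure T Phi F <= S)%E.
Proof.
move=> HS; apply: separated_growth_le => eps eps0.
rewrite leNgt; apply/negP => /ereal_between[c1 Sc1].
move=> /ereal_between[c2 c12 c2g]; rewrite lte_fin in c12.
pose delta := (c2 - c1) / 8.
have delta0 : 0 < delta by rewrite divr_gt0// subr_gt0.
have [C PhiC] := Phi_bounded.
pose K := [set v : 'rV[R]_d | forall i, `|v ord0 i| <= C].
have /choice[eta etaP] : forall z : 'rV[R]_d, exists eta : R, 0 < eta /\ forall y : 'rV[R]_d,
    (forall i, `|z ord0 i - y ord0 i| < eta) -> `|F z - F y| <= delta.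
  by move=> z; have [eta e0 eP] := @local_oscillation delta z delta0; exists eta.
have eta20 z : 0 < eta z / 2 by rewrite divr_gt0// (etaP z).1.
have := @box_compact C; rewrite -/K compact_cover.
move=> /(_ _ setT (fun z => (ball z (eta z / 2))°) (fun z _ => open_interior _)).
case=> [z _|D _ DK].
  by exists z => //; exact: nbhsx_ballx.
(* A sample bundles a time, a finite type, its points and the centre of their ball, so that a single
   choice gives the whole sequence. *)
pose sample := {n : nat & {W : finType & ((W -> X) * 'rV[R]_d)%type}}.
pose sn (t : sample) := projT1 t; pose sW (t : sample) := projT1 (projT2 t).
pose sp (t : sample) : sW t -> X := (projT2 (projT2 t)).1.
pose sz (t : sample) := (projT2 (projT2 t)).2.
have step k : exists t : sample, [/\ (k < sn t)%N, (0 < #|sW t|)%N,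
      forall a b, a != b -> eps < bowen_dist T (sn t) (sp t a) (sp t b),
      forall a i, `|sz t ord0 i - birkhoff_vec (sn t) (sp t a) ord0 i| <= eta (sz t) / 2 &
      (sn t)%:R * (c2 - F (sz t) - delta) - ln #|` D|%:R <= ln #|sW t|%:R].
  have [n kn] := limn_esup_frequently k.+1 c2g.
  have n0 : (0 < n)%N by exact: leq_ltn_trans kn.
  move=> /(separated_sup_gt n0)[W [p [sep big]]].
  have n0' : 0 < n%:R :> R by rewrite ltr0n.
  have avgK w : K (birkhoff_vec n (p w)).
    move=> i; rewrite mxE normrM normfV normr_nat ler_pdivrMr// mulrC.
    exact: birkhoff_sum_norm_le.
  have [|z y zD|z [P [zD PV P0 hP]]] := @pigeonhole_count W (birkhoff_vec n \o p) n c2 delta D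
      (fun z => (ball z (eta z / 2))°) _ _ big.
  - by move=> w; have [z zD zw] := DK _ (avgK w); exists z.
  - move=> /interior_subset yz.
    have : `|F z - F y| <= delta.
      apply: (etaP z).2 => i; apply: lt_trans (yz.2 ord0 i) _.
      by have := eta20 z; lra.
    by rewrite ler_norml => /andP[? ?]; lra.
  exists (existT _ n (existT _ ({w | P w} : finType) (p \o val, z))); split => //=.
  - by rewrite card_sig.
  - by move=> a b ab; apply: sep; rewrite (inj_eq val_inj).
  - move=> [w Pw] i /=; have /interior_subset := PV w Pw.
    by move=> [_ /(_ ord0 i)/ltW].
  - by rewrite card_sig.
have /choice[t tP] := step.
pose n k := sn (t k); pose W k := sW (t k); pose p k : W k -> X := sp (t k).
pose z k := sz (t k).
have kn k : (k < n k)%N by case: (tP k).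
have W0 k : (0 < #|W k|)%N by case: (tP k).
have n0 k : (0 < n k)%N by exact: leq_ltn_trans (kn k).
have [U [ultraU ooU]] := ultraFilterLemma (eventually_filter : ProperFilter \oo).
have Ucof N : U [set k | (N <= k)%N] by apply: ooU; exists N.
have [mu mucvg] := weak_limit X_compact ultraU
  (fun k => empirical_state T (p k) (W0 k) (n0 k)).
pose I k : 'rV[R]_d := \row_i empirical T (p k) (n k) (Phi i).
(* The vector [I k] is the mean of the Birkhoff averages of the sample points, all of which lie
   within [eta / 2] of the centre in each coordinate. *)
have FI k : `|F (z k) - F (I k)| <= delta.
  have [_ _ _ zb _] := tP k; apply: (etaP (z k)).2 => i; rewrite mxE.
  apply: (@le_lt_trans _ _ (eta (z k) / 2)); last by have := eta20 (z k); lra.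
  have -> : z k ord0 i = \sum_(w : W k) #|W k|%:R^-1 * z k ord0 i.
    by rewrite -mulr_suml (uniform_prob (W0 k)).2 mul1r.
  have -> : eta (z k) / 2 = \sum_(w : W k) #|W k|%:R^-1 * (eta (z k) / 2).
    by rewrite -mulr_suml (uniform_prob (W0 k)).2 mul1r.
  rewrite empirical_birkhoff -sumrB; apply: le_trans (ler_norm_sum _ _ _) _.
  apply: ler_sum => w _; rewrite -mulrBr normrM ger0_norm ?invr_ge0//.
  by rewrite ler_wpM2l ?invr_ge0//; have := zb w i; rewrite mxE.
have Icvg : I k @[k --> U] --> integral_vec Phi mu.
  apply: cvg_row => i; rewrite mxE.
  have := mucvg _ (@Phi_cont i); apply: cvg_trans; apply: near_eq_cvg.
  by apply: nearW => k; rewrite mxE.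
pose lnD := ln #|` D|%:R : R.
(* The pigeonhole loss is [lnD / n k]. The second [delta] pays for replacing the centre [z k], which
   need not converge, by [I k], which does. *)
pose a k := c2 - 2 * delta - F (I k) - lnD / (n k)%:R.
have acvg : a k @[k --> U] --> c2 - 2 * delta - F (integral_vec Phi mu) - 0.
  apply: cvgB.
    apply: cvgB; first exact: cvg_cst.
    by apply: (cvg_comp I F Icvg); exact: F_cont.
  exact: cvg_div_index.
have aW k : (n k)%:R * a k <= ln #|W k|%:R.
  have [_ _ _ _] := tP k; apply: le_trans.
  have nk0 : 0 < (n k)%:R :> R by rewrite ltr0n n0.
  rewrite /a mulrBr (mulrC _ (lnD / _)) divfK ?gt_eqF// lerD2r ler_pM2l//.
  by have := FI k; rewrite ler_norml => /andP[? ?]; rewrite -/(z k); lra.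
have sep k (w w' : W k) : w != w' -> eps < bowen_dist T (n k) (p k w) (p k w').
  by have [_ _ + _ _] := tP k; exact.
have [inv hmu] := misiurewicz X_compact T_cont (@ultra_proper _ _ ultraU) Ucof kn W0 eps0
  sep mucvg aW acvg.
have := HS mu inv; rewrite leNgt => /negP; apply.
apply: lt_le_trans Sc1 _; apply: le_trans (leeD2r _ hmu).
by rewrite -EFinD lee_fin /delta; lra.
Qed.

End UpperBound.

(** * Approximation of a partition by disjoint compact sets *)

Section CompactSubpartition.
Context {R : realType} {X : pmetricType R}.
Hypothesis X_compact : compact [set: X].
Variable mu : probability (Borel X) R.

(** Each atom is shrunk to a closed subset by inner regularity, and the rest is labelled [None].
    Disjoint compact sets are apart by some [2 * e], so two points within [e] of a third one cannot
    carry different labels. *)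
Lemma compact_subpartition (I : finType) (u : X -> I) (theta : R) :
  measurable_label (u : Borel X -> I) -> 0 < theta ->
  exists (eta : X -> option I) (e : R),
    [/\ measurable_label (eta : Borel X -> option I), 0 < e,
        prob mu (eta @^-1` [set None]) <= theta,
        forall x i, eta x = Some i -> u x = i &
        forall x y i j, mdist x y <= 2 * e -> eta x = Some i -> eta y = Some j ->
          i = j].
Proof.
move=> mu_ theta0.
have I0 : (0 < #|I|)%N by apply/card_gt0P; exists (u point).
have I0' : 0 < #|I|%:R :> R by rewrite ltr0n.
have /choice[B BP] : forall i, exists B : set X, [/\ closed B,
    B `<=` u @^-1` [set i] & prob mu (u @^-1` [set i] `\` B) <= theta / #|I|%:R].
  move=> i; have [B [cB BA pB]] := inner_regular X_compact mu (mu_ i)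
    (divr_gt0 theta0 I0').
  by exists B.
pose v x : I * bool := (u x, `[< B (u x) x >]).
have v1 i : v @^-1` [set (i, true)] = B i.
  apply/seteqP; split=> x /=; first by move=> [ux]; rewrite ux => /asboolP.
  by move=> Bx; have [_ /(_ x Bx) /= ux _] := BP i; rewrite /v ux asboolT.
have v0 i : v @^-1` [set (i, false)] = u @^-1` [set i] `\` B i.
  apply/seteqP; split=> x /=.
    by move=> [ux]; rewrite ux => /asboolPn.
  by move=> [ux Bx]; rewrite /v ux asboolF.
have mB i : measurable (B i : set (Borel X)) by apply: borel_closed; case: (BP i).
have mv : measurable_label (v : Borel X -> I * bool).
  by move=> [i []]; rewrite ?v1 ?v0//; exact: measurableD.
pose eta x := if (v x).2 then Some (v x).1 else None.
have meta : measurable_label (eta : Borel X -> option I).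
  exact: (measurable_label_comp (fun ib => if ib.2 then Some ib.1 else None) mv).
have etaB x i : eta x = Some i -> B i x.
  by rewrite /eta /=; case: ifPn => // /asboolP Bx [<-].
have etaN x : eta x = None -> (v x).2 = false by rewrite /eta; case: ifP.
have [_ p2] := label_preimage mu (fun ib : I * bool => ~~ ib.2) mv.
have pN : prob mu (eta @^-1` [set None]) <= theta.
  rewrite (_ : eta @^-1` [set None] = v @^-1` [set` (fun ib : I * bool => ~~ ib.2)]); last first.
    apply/seteqP; split=> x; first by move=> /etaN/negbT.
    by move=> /negbTE vF; rewrite /= /eta vF.
  rewrite p2 (reindex_onto (fun i : I => (i, false)) fst) => [|[i []]//].
  rewrite (eq_bigl predT) => [|i]; last by rewrite /= eqxx.
  apply: (@le_trans _ _ (\sum_(i : I) theta / #|I|%:R)).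
    by apply: ler_sum => i _; rewrite /label_dist v0; case: (BP i).
  by rewrite sumr_const -[_ *+ _]mulr_natr cardT -cardE divfK// gt_eqF.
(* Near-covering compactness along [0^'+] turns an [e] found around each point into one for all
   points. *)
move/compact_near_coveringP: X_compact => /(_ R (0^'+)
  (fun e x => forall y i j, mdist x y <= 2 * e -> eta x = Some i ->
     eta y = Some j -> i = j)) H.
have : \forall e \near 0^'+, [set: X] `<=` (fun x => forall y i j,
    mdist x y <= 2 * e -> eta x = Some i -> eta y = Some j -> i = j).
  apply: H => x _.
  have [r r0 rP] : exists2 r : R, 0 < r & forall i, ~ B i x ->
      forall y, mdist x y < r -> ~ B i y.
    have /choice[r rP] : forall i, exists r : R, 0 < r /\ (~ B i x ->
        forall y, mdist x y < r -> ~ B i y).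
      move=> i; have [Bx|Bx] := pselect (B i x); first by exists 1; split.
      have : nbhs x (~` B i).
        by apply: open_nbhs_nbhs; split=> //; apply: closed_openC; case: (BP i).
      move=> /nbhs_ballP[r /= r0]; rewrite ballEmdist => h.
      by exists r; split=> // _ y; exact: h.
    pose i0 := u x; exists (\big[Num.min/r i0]_i r i).
      by elim/big_ind: _ => [|a b a0 b0|i _]; rewrite ?(rP _).1// lt_min a0.
    move=> i Bx y /lt_le_trans xy; apply: (rP i).2 => //; apply: xy.
    exact: bigmin_le_cond.
  exists ([set y | mdist x y < r / 2], [set e | e < r / 4]) => /=.
    split.
      apply/nbhs_ballP; exists (r / 2); first exact: divr_gt0.
      by rewrite ballEmdist.
    by apply: nbhs_right_lt; rewrite divr_gt0.
  move=> [y e] /= [xy er] z i j yz /etaB By /etaB Bz.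
  have Bi : B i x by apply: contrapT => nB; apply: (rP i nB y _ By); lra.
  have Bj : B j x.
    apply: contrapT => nB; apply: (rP j nB z _ Bz).
    by apply: le_lt_trans (metric_triangle x y z) _; lra.
  have [_ /(_ x Bi) /= <- _] := BP i.
  by have [_ /(_ x Bj) /= <- _] := BP j.
move=> h; have : \forall e \near 0^'+, 0 < e /\ [set: X] `<=` (fun x => forall y i j,
    mdist x y <= 2 * e -> eta x = Some i -> eta y = Some j -> i = j).
  near=> e; split; first by near: e; exact: nbhs_right_gt.
  by near: e.
move=> /filter_ex[e [e0 eP]]; exists eta, e; split=> //.
- by move=> x i; rewrite /eta /=; case: ifPn => // _ [].
- by move=> x y i j; exact: (eP x Logic.I).
Unshelve. all: by end_near. Qed.

End CompactSubpartition.

(** * Entropy of words bounded by counting *)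

Section GibbsComparison.
Context {R : realType} {dS : measure_display} {S : measurableType dS}.
Variables (mu : probability S R).

(* Gibbs' inequality against the distribution: choose the sequence of [xi],
   uniformly either among those met by [G] or among all, then complete each
   [None] uniformly. *)
Lemma word_ent_subpartition (I : finType) (u : nat -> S -> I)
    (eta : nat -> S -> option I) (G : set S) (n : nat) (q : R)
    (J : pred {ffun 'I_n -> option I}) :
  (forall t, measurable_label (u t)) -> (forall t, measurable_label (eta t)) ->
  measurable G -> (forall t x i, eta t x = Some i -> u t x = i) ->
  (forall t, prob mu (eta t @^-1` [set None]) <= q) ->
  (forall x, G x -> J (word eta 0 n x)) ->
  label_ent mu (word u 0 n) <=
  ln 2 + ln #|J|%:R + prob mu (~` G) * (n%:R * ln #|I|.+1%:R)
  + n%:R * q * ln #|I|%:R.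
Proof.
move=> mu_ me mG etau qP GJ.
pose U := word u 0 n; pose H := word eta 0 n; pose g x := `[< G x >].
have mU : measurable_label U by exact: measurable_label_word.
have mH : measurable_label H by exact: measurable_label_word.
have mg : measurable_label g.
  move=> [].
    rewrite (_ : _ @^-1` _ = G)//.
    by apply/seteqP; split=> x; [move/asboolP|move=> Gx; exact/asboolP].
  rewrite (_ : _ @^-1` _ = ~` G); first exact: measurableC.
  apply/seteqP; split=> x; first by rewrite /= => /asboolP.
  by move=> Gx; exact: asboolF.
have mUH := measurable_label_pair mU mH.
have mv := measurable_label_pair mUH mg.
set v := (fun x => (U x, H x, g x)) in mv.
have pv := label_dist_prob mu mv.
have [p0 p1] := pv.
have [x0 _] : exists x : S, True by exists point.
have I0 : (0 < #|I|)%N by apply/card_gt0P; exists (u 0%N x0).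
have I0' : 0 < #|I|%:R :> R by rewrite ltr0n.
pose rho1 (a : I) (o : option I) : R := if o is Some b then (a == b)%:R else #|I|%:R^-1.
pose rho (i : {ffun 'I_n -> I}) (j : {ffun 'I_n -> option I}) : R :=
  \prod_l rho1 (i l) (j l).
pose M := #|{ffun 'I_n -> option I}|.
have ME : M%:R = #|I|.+1%:R ^+ n :> R by rewrite /M card_ffun card_option card_ord natrX.
have M0 : 0 < M%:R :> R by rewrite ME exprn_gt0.
(* Half of the mass is spread over the words in [J], half over all words. For empty [J] the first
   half is just missing, which Gibbs' inequality tolerates. *)
pose s (j : {ffun 'I_n -> option I}) : R := (J j)%:R / (2 * #|J|%:R) + 1 / (2 * M%:R).
have s0 j : 0 < s j.
  by rewrite ltr_wpDl// ?divr_ge0 ?divr_gt0 ?mulr_gt0 ?mulr_ge0.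
have rho1_ge0 a o : 0 <= rho1 a o by case: o => [b|] /=; rewrite ?invr_ge0.
have rho_ge0 i j : 0 <= rho i j by exact: prodr_ge0.
pose r i := \sum_j s j * rho i j.
have r0 i : 0 <= r i by apply: sumr_ge0 => j _; rewrite mulr_ge0// ltW.
have rho_sum j : \sum_i rho i j = 1.
  rewrite /rho -(bigA_distr_bigA (fun l a => rho1 a (j l))) big1// => l _.
  case: (j l) => [b|] /=; last by rewrite sumr_const -[_ *+ _]mulr_natr cardT -cardE mulVf// gt_eqF.
  rewrite (bigD1 b)//= eqxx big1 ?addr0// => a /negbTE ->.
  by [].
have s_sum : \sum_j s j <= 1.
  rewrite /s big_split/= -mulr_suml sumr_const.
  rewrite (_ : \sum_i (J i)%:R = #|J|%:R); last first.
    by rewrite -sum1_card natr_sum [RHS]big_mkcond/=; apply: eq_bigr => j _;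
      rewrite -[J j]/(j \in J); case: (j \in J).
  rewrite -[X in _ + X]mulr_natr -/M.
  have [->|J0] := posnP #|J|.
    by rewrite mul0r add0r mul1r invfM -mulrA mulVf ?gt_eqF//; lra.
  have J0' : 0 < #|J|%:R :> R by rewrite ltr0n.
  by rewrite !invfM mul1r mulrCA mulfV ?gt_eqF// -mulrA mulVf ?gt_eqF//; lra.
have r1 : \sum_i r i <= 1.
  rewrite exchange_big/=; apply: le_trans s_sum.
  by apply: ler_sum => j _; rewrite -mulr_sumr rho_sum mulr1.
have vex w : 0 < label_dist mu v w -> exists x, v x = w.
  move=> pw; apply: contrapT => nx; move: pw.
  rewrite /label_dist (_ : _ @^-1` _ = set0) ?prob0 ?ltxx//.
  by apply/seteqP; split=> x //= vx; apply: nx; exists x.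
pose nN (j : {ffun 'I_n -> option I}) : R := \sum_l (j l == None)%:R.
(* Along an actual point the defined symbols agree with [u] and cost nothing; each [None] costs a
   factor [1 / #|I|]. *)
have rhoE x : rho (U x) (H x) = expR (- (nN (H x) * ln #|I|%:R)).
  rewrite /nN mulr_suml -sumrN expR_sum; apply: eq_bigr => l _.
  rewrite !ffunE /rho1; case E: (eta (0 + l)%N x) => [b|].
    by rewrite (etau _ _ _ E) eqxx mul0r oppr0 expR0.
  by rewrite eqxx mul1r expRN lnK// posrE.
have ln_nat (k : nat) : 0 <= ln k%:R :> R.
  by case: k => [|k]; [rewrite ln0|rewrite ln_ge0// ler1n].
(* On [G] the first half of [s] is used, off [G] the second. *)
have lns x : - ln (s (H x)) <= ln 2 + ln #|J|%:R + (~~ g x)%:R * (n%:R * ln #|I|.+1%:R).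
  have [gx|gx] := boolP (g x); last first.
    rewrite mul1r; apply: (@le_trans _ _ (ln (2 * M%:R))).
      rewrite -lnV ?posrE// ler_ln ?posrE ?invr_gt0//; last by rewrite mulr_gt0.
      rewrite -[leRHS]invrK lef_pV2 ?posrE ?invr_gt0 ?mulr_gt0//.
      by rewrite /s mul1r lerDr divr_ge0// mulr_ge0.
    rewrite lnM ?posrE// ME lnXn ?ltr0n// -mulr_natl.
    by have := ln_nat #|J|; lra.
  have JH : J (H x) by apply: GJ; exact/asboolP.
  have J0 : (0 < #|J|)%N by apply/card_gt0P; exists (H x).
  have J0' : 0 < #|J|%:R :> R by rewrite ltr0n.
  rewrite mul0r addr0 -lnM ?posrE// -lnV ?posrE// ler_ln ?posrE ?invr_gt0 ?mulr_gt0//.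
  rewrite -[leRHS]invrK lef_pV2 ?posrE ?invr_gt0 ?mulr_gt0//.
  by rewrite /s JH /= !mul1r lerDl invr_ge0 mulr_ge0.
have lnr x : - ln (r (U x)) <= ln 2 + ln #|J|%:R +
    (~~ g x)%:R * (n%:R * ln #|I|.+1%:R) + nN (H x) * ln #|I|%:R.
  apply: le_trans (_ : - ln (s (H x) * rho (U x) (H x)) <= _).
    rewrite lerN2 ler_ln ?posrE.
    - rewrite /r (bigD1 (H x))//= lerDl sumr_ge0// => j _.
      by rewrite mulr_ge0// ltW.
    - by rewrite mulr_gt0// rhoE expR_gt0.
    - rewrite /r (bigD1 (H x))//= ltr_pwDl//; first by rewrite mulr_gt0// rhoE expR_gt0.
      by apply: sumr_ge0 => j _; rewrite mulr_ge0// ltW.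
  rewrite lnM ?posrE//; last by rewrite rhoE expR_gt0.
  by rewrite rhoE expRK opprD opprK lerD.
have expect (P : pred _) : \sum_w label_dist mu v w * (P w)%:R =
    prob mu (v @^-1` [set` P]).
  rewrite (label_preimage mu P mv).2 [RHS]big_mkcond/=; apply: eq_bigr => w _.
  by case: (P w); rewrite ?mulr1 ?mulr0.
rewrite /label_ent -/U (_ : U = (fun w => w.1.1) \o v)//.
rewrite (label_dist_comp mu (fun w => w.1.1) mv).
apply: le_trans (gibbs pv r0 r1 _) _.
  move=> w /vex[x <-] /=; rewrite /r (bigD1 (H x))//= ltr_pwDl//.
    by rewrite mulr_gt0// rhoE expR_gt0.
  by apply: sumr_ge0 => j _; rewrite mulr_ge0// ltW.
pose B (w : {ffun 'I_n -> I} * {ffun 'I_n -> option I} * bool) : R :=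
  ln 2 + ln #|J|%:R + (~~ w.2)%:R * (n%:R * ln #|I|.+1%:R) + nN w.1.2 * ln #|I|%:R.
apply: (@le_trans _ _ (\sum_w label_dist mu v w * B w)).
  rewrite -sumrN; apply: ler_sum => w _; rewrite -mulrN.
  have [pw|pw] := ltrP 0 (label_dist mu v w); last first.
    by have -> : label_dist mu v w = 0; [apply/eqP; rewrite eq_le pw p0|rewrite !mul0r].
  by rewrite ler_pM2l//; have [x <-] := vex w pw; exact: lnr.
rewrite /B; under eq_bigr do rewrite !mulrDr.
rewrite !big_split/= -!mulr_suml p1 !mul1r; apply: lerD.
  rewrite lerD2l.
  under eq_bigr do rewrite mulrA.
  rewrite -mulr_suml (expect (fun w => ~~ w.2)) ler_wpM2r ?mulr_ge0//.
  rewrite le_eqVlt; apply/orP; left; apply/eqP; congr prob.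
  by apply/seteqP; split=> x; [move/asboolPn|move=> Gx; exact/asboolPn].
under eq_bigr do rewrite mulrA.
rewrite -mulr_suml ler_wpM2r//.
under eq_bigr do rewrite /nN mulr_sumr.
rewrite exchange_big/= mulr_natl -[n in _ *+ n]card_ord -sumr_const.
apply: ler_sum => l _; rewrite (expect (fun w => w.1.2 l == None)).
apply: le_trans (qP l); rewrite le_eqVlt; apply/orP; left; apply/eqP; congr prob.
apply/seteqP; split=> x.
  by move=> /eqP; rewrite /= ffunE add0n.
by move=> ex; apply/eqP; rewrite /= ffunE add0n.
Qed.

End GibbsComparison.

(** * From words to separated points *)

Section SeparatedWords.
Context {R : realType}.

(** Take a maximal separated [E]. Each word of [J] is close to some centre in [E], and words close
    to the same centre agree wherever both are defined. So a word is determined by its centre and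
    its pattern of [None], with [2 ^ n] patterns. *)
Lemma separated_words (I : finType) (n : nat) (J : pred {ffun 'I_n -> option I})
    (dist : {ffun 'I_n -> option I} -> {ffun 'I_n -> option I} -> R) (e : R) :
  (forall j, dist j j <= e) -> (forall i j, dist i j = dist j i) ->
  (forall i j j', J i -> J j -> J j' -> dist i j <= e -> dist i j' <= e ->
     forall l a b, j l = Some a -> j' l = Some b -> a = b) ->
  exists E : {set {ffun 'I_n -> option I}},
    [/\ forall j, j \in E -> J j,
        forall i j, i \in E -> j \in E -> i != j -> e < dist i j &
        (#|J| <= #|E| * 2 ^ n)%N].
Proof.
move=> d0 dC dJ.
pose sep (E : {set {ffun 'I_n -> option I}}) := (E \subset J) &&
  [forall i in E, forall j in E, (i != j) ==> (e < dist i j)].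
have sep0 : sep finset.set0.
  by apply/andP; split; [apply/fintype.subsetP|apply/forall_inP] => i;
    rewrite finset.inE.
have [E /maxsetP[/andP[/fintype.subsetP EJ /forall_inP sE] maxE] _] := maxset_exists sep0.
have sepE i j : i \in E -> j \in E -> i != j -> e < dist i j.
  by move=> iE jE ij; have /forall_inP/(_ j jE)/implyP := sE i iE; exact.
have EJ' j : j \in E -> J j by move=> /EJ.
exists E; split => //.
have /choice[r rP] : forall j, exists i, J j -> i \in E /\ dist i j <= e.
  move=> j; have [jJ|nJ] := boolP (J j); last by exists j.
  have [jE|jE] := boolP (j \in E); first by exists j.
  apply: contrapT => h.
  have far i : i \in E -> e < dist i j.
    by move=> iE; rewrite ltNge; apply/negP => ij; apply: h; exists i.
  have : sep (j |: E)%SET.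
    apply/andP; split.
      apply/fintype.subsetP => i; rewrite !finset.inE => /predU1P[->//|/EJ'].
      by [].
    apply/forall_inP => i; rewrite finset.in_setU1 => iE.
    apply/forall_inP => i'; rewrite finset.in_setU1 => iE'; apply/implyP => ii'.
    case/predU1P : iE => [ij|iE]; case/predU1P : iE' => [ij'|iE'].
    - by move: ii'; rewrite ij ij' eqxx.
    - by rewrite ij dC far.
    - by rewrite ij' far.
    - exact: sepE.
  move=> /maxE /(_ (finset.subsetUr _ _)) EE.
  by move: jE; rewrite -EE finset.setU11.
pose code (j : {ffun 'I_n -> option I}) := (r j, [ffun l => j l == None]).
have codeI : {in J &, injective code}.
  move=> j j' Jj Jj' [rr bb]; apply/ffunP => l.
  have := congr1 (fun b : {ffun 'I_n -> bool} => b l) bb; rewrite !ffunE.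
  have [rE rj] := rP j Jj; have [_ rj'] := rP j' Jj'; rewrite -rr in rj'.
  case jl : (j l) => [a|]; case jl' : (j' l) => [b|] // _.
  by rewrite (dJ _ _ _ (EJ' _ rE) Jj Jj' rj rj' l a b jl jl').
rewrite -(card_in_imset codeI).
have -> : (#|E| * 2 ^ n)%N = #|finset.setX E [set: {ffun 'I_n -> bool}]%SET|.
  by rewrite cardsX cardsT card_ffun card_bool card_ord.
apply: subset_leq_card; apply/fintype.subsetP => _ /imsetP[j Jj ->].
by rewrite finset.in_setX finset.in_setT andbT; case: (rP j Jj).
Qed.

End SeparatedWords.

(** * Lower bound for ergodic measures *)

Section LowerBound.
Context {R : realType} {X : pmetricType R}.
Variables (T : X -> X) (d : nat) (Phi : 'I_d -> X -> R).
Variable F : 'rV[R]_d -> R.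
Hypotheses (X_compact : compact [set: X]) (T_cont : continuous T).
Hypotheses (Phi_cont : forall i, continuous (Phi i)) (F_cont : continuous F).
Variable mu : probability (Borel X) R.
Hypothesis mu_ergodic : ergodic_measure (T : Borel X -> Borel X) mu.

Lemma prob_exists_le (I : finType) (A : I -> set (Borel X)) :
  (forall i, measurable (A i)) ->
  measurable [set x | exists i, A i x] /\
  prob mu [set x | exists i, A i x] <= \sum_i prob mu (A i).
Proof.
move=> mA; have -> : [set x | exists i, A i x] =
    [set x | exists2 i, i \in index_enum I & A i x].
  by apply/seteqP; split=> x /=; [move=> [i Ai]|move=> [i _ Ai]]; exists i; rewrite ?mem_index_enum.
elim: (index_enum I) => [|i s [ms IH]].
  rewrite big_nil (_ : mkset _ = set0) ?prob0//.
  by apply/seteqP; split=> x //= [].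
rewrite (_ : mkset _ = A i `|` [set x | exists2 j, j \in s & A j x]).
  split; first exact: measurableU.
  by rewrite big_cons (le_trans (probU_le _ _ _))// lerD2l.
apply/seteqP; split=> x /=.
  by move=> [j]; rewrite inE => /predU1P[->|js Aj]; [left|right; exists j].
by case=> [Ai|[j js Aj]]; [exists i|exists j]; rewrite // inE ?eqxx// js orbT.
Qed.

Definition typical_set (n : nat) (delta : R) : set (Borel X) :=
  [set x | forall i, `|birkhoff_sum T n (Phi i) x -
    n%:R * integral_vec Phi mu ord0 i| <= n%:R * delta].

Lemma typical_setP (delta eta : R) : 0 < delta -> 0 < eta ->
  exists N, forall n, (N <= n)%N -> measurable (typical_set n delta) /\
    prob mu (~` typical_set n delta) <= eta.
Proof.
move=> delta0 eta0; have e0 : 0 < eta / d.+1%:R by rewrite divr_gt0// ltr0n.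
have /choice[N NP] : forall i, exists N, forall n, (N <= n)%N ->
    prob mu [set x | n%:R * delta < `|birkhoff_sum T n (Phi i) x -
       n%:R * \int[mu]_y Phi i y|] <= eta / d.+1%:R.
  move=> i; exact: (ergodic_birkhoff X_compact T_cont mu_ergodic (@Phi_cont i) delta0 e0).
exists (\max_i N i)%N => n nN.
pose A i : set (Borel X) := [set x | n%:R * delta < `|birkhoff_sum T n (Phi i) x -
       n%:R * \int[mu]_y Phi i y|].
have mA i : measurable (A i).
  apply: borel_gt_fun => x.
  apply: cvg_norm; apply: cvgB; last exact: cvg_cst.
  exact: birkhoff_sum_continuous.
have [mU pU] := prob_exists_le mA.
have -> : typical_set n delta = ~` [set x | exists i, A i x].
  apply/seteqP; split=> x /= h.
    by move=> [i]; rewrite /A /= ltNge; have := h i; rewrite mxE => ->.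
  move=> i; rewrite mxE leNgt; apply/negP => Ai; apply: h; exists i; exact: Ai.
split; first exact: measurableC.
rewrite setCK; apply: le_trans pU _.
apply: (@le_trans _ _ (\sum_(i < d) eta / d.+1%:R)).
  apply: ler_sum => i _; apply: NP; apply: leq_trans nN.
  exact: (leq_bigmax i).
rewrite sumr_const card_ord -[_ *+ _]mulr_natr -mulrA.
apply: ler_piMr; first exact: ltW.
by rewrite ler_pdivrMl ?ltr0n// mulr1 ler_nat.
Qed.

Lemma bowen_distxx n x : bowen_dist T n x x = 0.
Proof.
apply/eqP; rewrite eq_le; apply/andP; split.
  by apply/bigmax_leP; split=> // i _; rewrite mdistxx.
exact: bigmax_ge_id.
Qed.

Lemma bowen_distC n x y : bowen_dist T n x y = bowen_dist T n y x.
Proof. by apply: eq_bigr => i _; rewrite metric_sym. Qed.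

Lemma mdist_le_bowen n x y k : (k < n)%N ->
  mdist (iter k T x) (iter k T y) <= bowen_dist T n x y.
Proof.
move=> kn; exact: (le_bigmax _ (fun k : 'I_n => mdist (iter k T x) (iter k T y)) (Ordinal kn)).
Qed.

Lemma nonlinear_pressure_ge :
  (entropy T mu + (F (integral_vec Phi mu))%:E <= nonlinear_pressure T Phi F)%E.
Proof.
have [inv _] := mu_ergodic; set z := integral_vec Phi mu.
rewrite leNgt; apply/negP => /ereal_between[b0 Pb0 b0h].
have bh : ((b0 - F z)%:E < entropy T mu)%E by rewrite EFinB lteBlDr.
move: Pb0; apply/negP; rewrite -leNgt.
set b := b0 - F z in bh; have -> : b0 = b + F z by rewrite subrK.
have mT : measurable_fun [set: Borel X] (T : Borel X -> Borel X).
  exact: borel_continuous_map.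
have [k [c [a [mc ba aP]]]] := ks_entropy_gt mT inv bh.
pose delta := a - b; have delta0 : 0 < delta by rewrite subr_gt0.
(* The losses amount to at most 4 per block of length [m], hence to [delta / 2] per unit of time. *)
pose m := (Num.truncn (8 / delta)).+1.
have m8 : 8 <= m%:R * delta.
  by rewrite -ler_pdivrMr//; apply: ltW; exact: truncnS_gt.
pose I := {ffun 'I_m -> 'I_k}.
pose u : X -> I := word (orbit_label T c) 0 m.
have mu_ : measurable_label (u : Borel X -> I) by exact: measurable_orbit_word.
have lnI0 (l : nat) : 0 <= ln l%:R :> R.
  by case: l => [|l]; [rewrite ln0|rewrite ln_ge0// ler1n].
(* Makes the expected cost of the [None] symbols at most 1 per block. *)
pose theta := (ln #|I|%:R + 1)^-1 : R.
have theta0 : 0 < theta by rewrite invr_gt0 ltr_wpDl.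
have thetaI : theta * ln #|I|%:R <= 1.
  by rewrite ler_pdivrMl ?mulr1 ?lerDl// ltr_wpDl.
have [eta [e [meta e0 petaN etau etad]]] := compact_subpartition X_compact mu mu_ theta0.
have delta20 : 0 < delta / 2 by rewrite divr_gt0.
have [r r0 rF] := local_oscillation F_cont z delta20.
have r20 : 0 < r / 2 by rewrite divr_gt0.
(* Makes the cost of atypical points at most 1 per block, and keeps [kappa < 1] so that typical
   points exist. *)
pose kappa := (ln #|I|.+1%:R + 2)^-1 : R.
have kappa0 : 0 < kappa by rewrite invr_gt0 ltr_wpDl.
have kappa1 : kappa < 1 by have h := lnI0 #|I|.+1; rewrite invf_lt1; lra.
have kappaI : kappa * ln #|I|.+1%:R <= 1.
  by rewrite ler_pdivrMl ?mulr1 ?lerDl// ltr_wpDl.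
have [N0 N0P] := typical_setP r20 kappa0.
apply: (separated_growth_ge e0); apply: limn_esup_ge => N.
pose n := (N + N0).+1; pose nm := (n * m)%N.
have n_nm : (n <= nm)%N by rewrite leq_pmulr.
have n0 : 0 < n%:R :> R by rewrite ltr0n.
have nm0 : (0 < nm)%N by rewrite muln_gt0.
have nm0' : 0 < nm%:R :> R by rewrite ltr0n.
exists nm; first by apply: leq_trans n_nm; rewrite ltnW// ltnS leq_addr.
have [mG pG] : measurable (typical_set nm (r / 2)) /\
    prob mu (~` typical_set nm (r / 2)) <= kappa.
  by apply: N0P; apply: leq_trans n_nm; rewrite ltnW// ltnS leq_addl.
set G := typical_set nm (r / 2) in mG pG.
pose ut t : X -> I := fun x => u (iter (t * m) T x).
pose et t : X -> option I := fun x => eta (iter (t * m) T x).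
pose H : X -> {ffun 'I_n -> option I} := word et 0 n.
pose J := [pred j | `[< exists2 x, G x & H x = j >]].
have mut t : measurable_label (ut t : Borel X -> I).
  by move=> i; apply: (measurable_iter_preimage mT _ (mu_ i)).
have met t : measurable_label (et t : Borel X -> option I).
  by move=> i; apply: (measurable_iter_preimage mT _ (meta i)).
have GJ x : G x -> J (H x) by move=> Gx; apply/asboolP; exists x.
have qP t : prob mu (et t @^-1` [set None]) <= theta.
  rewrite (_ : prob _ _ = prob mu (eta @^-1` [set None]))//; congr fine.
  exact: (invariant_iter mT (t * m) inv (meta None)).
have HJ := word_ent_subpartition mut met mG (fun t x i => etau _ i) qP GJ.
(* The term [n * ln 2] is set aside to pay for the factor [2 ^ n] of [separated_words]. *)
have {}HJ : label_ent mu (word ut 0 n) <= 4 * n%:R - n%:R * ln 2 + ln #|J|%:R.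
  apply: le_trans HJ _.
  have ln2 : ln 2 <= 1 :> R.
    by apply: le_trans (@ln_le_subr1 R 2 _) _ => //; lra.
  have n1 : 1 <= n%:R :> R by rewrite ler1n.
  have h1 : prob mu (~` G) * ln #|I|.+1%:R <= 1.
    by apply: le_trans kappaI; rewrite ler_wpM2r.
  have := ler_wpM2l (ltW n0) h1; have := ler_wpM2l (ltW n0) thetaI.
  have := ler_wpM2l (ltW n0) ln2.
  by rewrite mulrCA -(mulrA n%:R theta); lra.
have aJ : nm%:R * (a - delta / 2) + n%:R * ln 2 <= ln #|J|%:R.
  (* The word of length [nm] can be read off from its [n] blocks. *)
  have h : orbit_ent (T : Borel X -> Borel X) mu c nm <= label_ent mu (word ut 0 n).
    pose f (i : {ffun 'I_n -> I}) : {ffun 'I_nm -> 'I_k} :=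
      [ffun t : 'I_nm => i (inord (t %/ m)) (inord (t %% m))].
    have -> : orbit_ent (T : Borel X -> Borel X) mu c nm = label_ent mu (f \o word ut 0 n).
      congr ent; congr label_dist; apply/funext => x; apply/ffunP => t /=.
      rewrite !ffunE /orbit_label /ut !add0n.
      have tn : (t %/ m < n)%N by rewrite ltn_divLR.
      by rewrite !inordK ?ltn_pmod// -iterD addnC -divn_eq.
    by apply: label_ent_comp_le; exact: measurable_label_word.
  have := le_trans (aP nm) (le_trans h HJ).
  have := ler_wpM2l (ltW n0) m8.
  by rewrite /nm natrM; lra.
have /choice[pt ptP] : forall j, exists x, J j -> G x /\ H x = j.
  move=> j; have [/asboolP[x Gx Hx]|_] := boolP (J j); first by exists x.
  by exists point.
pose dist i j := bowen_dist T nm (pt i) (pt j).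
have [||j0 j1 j2 J0 J1 J2 d1 d2 l a1 b1 jl jl'|E [EJ Esep JE]] :=
    @separated_words R I n J dist e.
- by move=> j; rewrite /dist bowen_distxx ltW.
- by move=> i j; exact: bowen_distC.
(* Both points stay within [e] of the orbit of the common centre, so at time [l * m] they are within
   [2 * e] of each other. *)
- have lm : (l * m < nm)%N by rewrite ltn_pmul2r.
  have [_ H1] := ptP j1 J1; have [_ H2] := ptP j2 J2.
  move: jl jl'; rewrite -{1}H1 -{1}H2 !ffunE /et add0n => E1 E2.
  apply: (etad _ _ _ _ _ E1 E2); apply: le_trans (metric_triangle _ (iter (l * m) T (pt j0)) _) _.
  have := le_trans (mdist_le_bowen (pt j0) (pt j1) lm) d1.
  have := le_trans (mdist_le_bowen (pt j0) (pt j2) lm) d2.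
  by rewrite (metric_sym (iter _ _ (pt j0)) (iter _ _ (pt j1))); lra.
have [x0 _] : exists x : X, True by exists point.
have J0 : (0 < #|J|)%N.
  have [x Gx] : exists x, G x.
    apply: contrapT => nG; move: pG kappa1; rewrite (_ : ~` G = setT).
      by rewrite probT => /le_lt_trans h /h; rewrite ltxx.
    by apply/seteqP; split=> // x _ Gx; apply: nG; exists x.
  by apply/card_gt0P; exists (H x); exact: GJ.
apply: (@separated_sup_ge _ _ T _ e nm _ {j | j \in E} (fun j => pt (val j))) => //.
- exact: ltW.
- move=> i j ij; apply: Esep; [exact: valP|exact: valP|].
  by rewrite (inj_eq val_inj).
have E0 : 0 < #|E|%:R :> R.
  by rewrite ltr0n; move: (leq_trans J0 JE); rewrite muln_gt0 => /andP[].
have lnE : nm%:R * (a - delta / 2) <= ln #|E|%:R.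
  have : ln #|J|%:R <= ln (#|E| * 2 ^ n)%N%:R :> R.
    by rewrite ler_ln ?posrE ?ltr0n ?ler_nat//; exact: leq_trans J0 JE.
  have -> : ln (#|E| * 2 ^ n)%N%:R = ln #|E|%:R + n%:R * ln 2 :> R.
    by rewrite natrM natrX lnM ?posrE ?exprn_gt0// lnXn// mulr_natl.
  by move: aJ; lra.
(* Of [delta = a - b], one half was spent on the number of points; the other half covers the
   oscillation of [F] on typical averages. *)
apply: (@le_trans _ _ (\sum_(j : {j | j \in E}) expR (nm%:R * (F z - delta / 2)))).
  rewrite sumr_const card_sig -[X in _ <= X]mulr_natl.
  rewrite (_ : #|[pred j | j \in E]| = #|E|); last by apply: eq_card => j.
  rewrite -[#|E|%:R]lnK ?posrE// -expRD ler_expR.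
  by move: lnE; rewrite /delta; lra.
apply: ler_sum => [[j jE]] _ /=; rewrite ler_expR ler_wpM2l//.
have [Gj _] := ptP j (EJ j jE).
have : `|F z - F (\row_i (birkhoff_sum T nm (Phi i) (pt j) / nm%:R))| <= delta / 2.
  apply: rF => i; rewrite [X in _ - X]mxE distrC.
  apply: (@le_lt_trans _ _ (r / 2)); last by lra.
  have -> : birkhoff_sum T nm (Phi i) (pt j) / nm%:R - z ord0 i =
      (birkhoff_sum T nm (Phi i) (pt j) - nm%:R * z ord0 i) / nm%:R.
    by rewrite mulrBl [X in _ = _ - X]mulrAC mulfV ?mul1r// gt_eqF.
  rewrite normrM normfV normr_nat ler_pdivrMr// [leRHS]mulrC; exact: Gj.
by rewrite ler_norml => /andP[_]; lra.
Qed.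

End LowerBound.

(** * Weak* convergence and semicontinuity of the entropy *)

Section WeakStarLimits.
Context {R : realType} {X : pmetricType R}.
Variable T : X -> X.
Hypotheses (X_compact : compact [set: X]) (T_cont : continuous T).
Implicit Types (f : X -> R) (mu nu : probability (Borel X) R).

Definition weak_cvg (I : Type) (U : set_system I)
    (m : I -> probability (Borel X) R) mu : Prop :=
  forall f, continuous f ->
    \int[m i]_x f x @[i --> U] -->
    \int[mu]_x f x.

(** Semicontinuity is assumed in terms of neighbourhoods of [weak_star_topology], whereas limits are
    known through integrals; this connects the two. *)
Lemma weak_cvg_nbhs (I : Type) (U : set_system I)
    (m : I -> probability (Borel X) R) mu : ProperFilter U -> weak_cvg U m mu ->
  (m i : weak_star_topology X) @[i --> U] --> (mu : weak_star_topology X).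
Proof.
move=> PU mcvg A /= [_ [[B Bop <-] Bmu] sBA].
pose G (nu : probability (Borel X) R) (f : continuousType X R) :=
  \int[nu]_x f x.
have : {ptws, G (m i) @[i --> U] --> G mu}.
  apply/cvg_sup => f.
  have sf : (fun g : continuousType X R -> R => g f) @` setT = setT.
    by apply/seteqP; split=> // v _; exists (cst v).
  rewrite (cvg_image _ _ sf).
  have fc : continuous f by exact: cts_fun.
  move=> W /(mcvg f fc) UW; exists ((fun g => g f) @^-1` W) => //.
  by apply/seteqP; split=> [v [g Wg <-]|v Wv]; [|exists (cst v)].
have nB : nbhs (G mu : {ptws continuousType X R -> R}) B by rewrite nbhsE; exists B.
move=> cv; have UB : U [set i | B (G (m i))] by exact: (cv B nB).
suff : U [set i | A (m i)] by [].
by apply: filterS UB => i Bi; exact: sBA.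
Qed.

Lemma entropy_usc_cvg (I : Type) (U : set_system I)
    (m : I -> probability (Borel X) R) mu (c : R) : entropy_usc T ->
  ProperFilter U -> (forall i, invariant_measures T (m i)) ->
  invariant_measures T mu -> weak_cvg U m mu -> (entropy T mu < c%:E)%E ->
  \forall i \near U, (entropy T (m i) < c%:E)%E.
Proof.
move=> usc PU minv inv mcvg muc.
have H : U [set i | invariant_measures T (m i) -> (entropy T (m i) < c%:E)%E].
  exact: (weak_cvg_nbhs PU mcvg (usc mu inv c muc)).
by apply: filterS H => i; apply; exact: minv.
Qed.

Lemma weak_cvg_invariant (I : Type) (U : set_system I)
    (m : I -> probability (Borel X) R) mu : ProperFilter U ->
  (forall i, invariant_measures T (m i)) -> weak_cvg U m mu ->
  invariant_measures T mu.
Proof.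
move=> PU minv mcvg; apply: invariant_of_Rintegral => // f fc.
have fTc : continuous (f \o T).
  by move=> x; apply: continuous_comp; [exact: T_cont|exact: fc].
apply: cvg_unique (mcvg _ fTc) _ => //.
have := mcvg _ fc; apply: cvg_trans; apply: near_eq_cvg.
by apply: nearW => i /=; rewrite (Rintegral_invariant X_compact T_cont (minv i)).
Qed.

Lemma weak_cvg_ultra (I : Type) (U : set_system I)
    (m : I -> probability (Borel X) R) : UltraFilter U ->
  (forall i, invariant_measures T (m i)) ->
  exists2 mu, invariant_measures T mu & weak_cvg U m mu.
Proof.
move=> ultraU minv.
have [mu mcvg] := weak_limit X_compact ultraU
  (fun i => integral_state X_compact (m i)).
exists mu => //; exact: (weak_cvg_invariant (@ultra_proper _ _ ultraU) minv mcvg).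
Qed.

(** The form in which semicontinuity is used: if the sums of entropy and [g] eventually exceed every
    [c < s], then the limit reaches [s]. *)
Lemma le_entropy_cvg (I : Type) (U : set_system I)
    (m : I -> probability (Borel X) R) mu (g : I -> R) (l : R) (s : \bar R) :
  entropy_usc T -> ProperFilter U -> (forall i, invariant_measures T (m i)) ->
  invariant_measures T mu -> weak_cvg U m mu -> g i @[i --> U] --> l ->
  (forall c : R, (c%:E < s)%E ->
     \forall i \near U, (c%:E < entropy T (m i) + (g i)%:E)%E) ->
  (s <= entropy T mu + l%:E)%E.
Proof.
move=> usc PU minv inv mcvg gl Ss; rewrite leNgt; apply/negP.
move=> /ereal_between[c1 + c1s]; rewrite -lteBrDr// -EFinB => hc.
have [c2 hc2] := ereal_between hc; rewrite lte_fin => c21.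
have H1 := entropy_usc_cvg usc PU minv inv mcvg hc2.
have H2 : \forall i \near U, g i < c1 - c2.
  by apply: (cvgr_lt l) gl _ _; lra.
have [i [[/= h1 h2] h3]] := filter_ex (filterI (filterI H1 H2) (Ss _ c1s)).
move: h3; rewrite ltNge => /negP; apply.
by apply: (@le_trans _ _ (c2%:E + (g i)%:E)%E); [rewrite leeD2r// ltW|rewrite -EFinD lee_fin; lra].
Qed.

End WeakStarLimits.

(** * Midpoints and conditional measures *)

Section ConditionalMeasures.
Context {R : realType} {d : measure_display} {S : measurableType d}.
Implicit Types (mu : probability S R) (A B : set S).

(** The argument [mu] of [mnormalize] is its default value for total mass 0 or infinity. *)
Lemma prob_mnormalize (m : {measure set S -> \bar R}) mu A (c a : R) :
  0 < c -> m setT = c%:E -> m A = a%:E -> prob (mnormalize m mu) A = a / c.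
Proof.
move=> c0 mT mA; have : mnormalize m mu A = (m A * c^-1%:E)%E.
  by rewrite /mnormalize mT eqe gt_eqF.
by move=> E; rewrite /prob; have -> := congr1 fine E; rewrite mA -EFinM.
Qed.

Lemma prob_midpoint mu1 mu2 : exists mu, forall A, measurable A ->
  prob mu A = 2^-1 * prob mu1 A + 2^-1 * prob mu2 A.
Proof.
pose m := measure_add mu1 mu2; exists (mnormalize m mu1) => A mA.
have mE B : measurable B -> m B = (prob mu1 B + prob mu2 B)%:E.
  by move=> mB; rewrite EFinD -!probE// -measure_addE.
rewrite -mulrDr mulrC; apply: prob_mnormalize => //; last exact: (mE A mA).
by have := mE setT measurableT; rewrite !probT.
Qed.

Lemma prob_conditional mu A : measurable A -> 0 < prob mu A ->
  exists m : probability S R, forall B, measurable B ->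
    prob m B = prob mu (B `&` A) / prob mu A.
Proof.
move=> mA A0; exists (mnormalize (mrestr mu mA) mu) => B mB.
have mE C : measurable C -> mrestr mu mA C = (prob mu (C `&` A))%:E.
  by move=> mC; rewrite -probE//; exact: measurableI.
apply: prob_mnormalize => //; last exact: (mE B mB).
by have := mE setT measurableT; rewrite setTI.
Qed.

End ConditionalMeasures.

(** * Ergodicity of unique equilibrium measures *)

Section Equilibria.
Context {R : realType} {X : pmetricType R}.
Variable T : X -> X.
Hypotheses (X_compact : compact [set: X]) (T_cont : continuous T).
Implicit Types (f psi : X -> R) (mu nu : probability (Borel X) R).

Let T_meas : measurable_fun [set: Borel X] (T : Borel X -> Borel X).
Proof. exact: borel_continuous_map. Qed.

Lemma Rintegral_mixture (a b : R) mu mu1 mu2 f : 0 <= a -> 0 <= b ->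
  (forall A, measurable A -> prob mu A = a * prob mu1 A + b * prob mu2 A) ->
  continuous f ->
  \int[mu]_x f x = a * \int[mu1]_x f x +
    b * \int[mu2]_x f x.
Proof.
move=> a0 b0 mix.
have key (g : X -> R) : continuous g -> (forall x, 0 <= g x) ->
    \int[mu]_x g x = a * \int[mu1]_x g x +
      b * \int[mu2]_x g x.
  move=> gc g0; have mg : measurable_fun [set: Borel X] (EFin \o (g : Borel X -> R)).
    by apply/measurable_EFinP; exact: borel_continuous.
  pose m := measure_add (mscale (NngNum a0) mu1) (mscale (NngNum b0) mu2).
  have gfin nu : (\int[nu]_(x in [set: Borel X]) (g x)%:E)%E =
      (\int[nu]_x g x)%:E.
    by rewrite fineK//; apply: integrable_fin_num => //; exact: continuous_integrable.
  apply: EFin_inj; rewrite -gfin.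
  transitivity (\int[m]_(x in [set: Borel X]) (g x)%:E)%E.
    apply: eq_measure_integral => A mA _.
    transitivity ((a * prob mu1 A + b * prob mu2 A)%:E).
      by rewrite -mix//; exact: probE.
    by rewrite EFinD !EFinM -!probE//; exact/esym/measure_addE.
  rewrite ge0_integral_measure_add//; last by move=> x _; rewrite lee_fin.
  rewrite !ge0_integral_mscale//; try by move=> x _; rewrite lee_fin.
  by rewrite !gfin/= -!EFinM -EFinD.
move=> fc; have [C fC] := continuous_bounded X_compact fc.
have cc : continuous (fun _ : X => C) by exact: cst_continuous.
have := key _ (continuous_add_fun fc cc).
rewrite !(stateD (integral_state X_compact _))// !(state_cst (integral_state X_compact _)).
have ab1 : a + b = 1 by have := mix setT measurableT; rewrite !probT !mulr1.
rewrite !mulrDr addrACA -mulrDl ab1 mul1r => /(_ _)/addIr; apply => x.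
by have := fC x; rewrite ler_norml => /andP[? _]; lra.
Qed.

Lemma le_classical_sup psi mu : invariant_measures T mu ->
  (entropy T mu + (\int[mu]_x psi x)%:E <=
   ereal_sup [set (entropy T nu + (\int[nu]_x psi x)%:E)%E
            | nu in invariant_measures T])%E.
Proof. by move=> inv; apply: ereal_sup_ubound; exists mu. Qed.

Lemma same_measure_prob mu nu A : same_measure mu nu -> measurable A ->
  prob mu A = prob nu A.
Proof. by move=> munu mA; rewrite /prob munu. Qed.

(** A measure of infinite entropy is an equilibrium for [psi], hence equals [e]. The midpoint of
    [mu] and any invariant [nu] has infinite entropy too, so it also equals [e], and then [nu]
    equals [mu]. *)
Lemma infinite_entropy_same psi e mu : unique_classical_equilibrium T psi e ->
  invariant_measures T mu -> entropy T mu = +oo%E ->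
  forall nu, invariant_measures T nu -> same_measure nu mu.
Proof.
move=> [_ eq_e] invmu muoo nu invnu.
have eq_oo m : invariant_measures T m -> entropy T m = +oo%E -> same_measure m e.
  move=> inv moo; apply: eq_e; split=> //; rewrite moo addye//; apply/esym/eqP.
  by rewrite -leye_eq -[X in (X <= _)%E](@addye _ (\int[m]_x psi x)%:E)// -moo le_classical_sup.
have [m mE] := prob_midpoint mu nu.
have invm : invariant_measures T m.
  move=> A mA; have mTA := borel_preimage T_cont mA.
  by rewrite (probE m mTA) (probE m mA) !mE// /prob (invmu A mA) (invnu A mA).
have moo : entropy T m = +oo%E.
  apply: (@ks_entropy_mixture_pinfty _ _ _ _ T_meas 2^-1 2^-1 m mu nu) => //; lra.
move=> A mA; rewrite (probE nu mA) (probE mu mA); congr EFin.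
have := mE A mA; rewrite (same_measure_prob (eq_oo m invm moo) mA).
by rewrite (same_measure_prob (eq_oo mu invmu muoo) mA); lra.
Qed.

(** Conditioning on an invariant set of intermediate measure and on its complement gives two
    invariant measures different from [mu]. By uniqueness both fall strictly below the supremum, and
    so does their mixture [mu], a contradiction. *)
Lemma unique_equilibrium_ergodic psi mu : continuous psi ->
  unique_classical_equilibrium T psi mu ->
  ergodic_measure (T : Borel X -> Borel X) mu.
Proof.
move=> psic mu_eq; have [[inv muE] mu_uniq] := mu_eq; split=> // A mA TA.
apply: contrapT => /not_orP[A0 A1].
have pA0 : 0 < prob mu A.
  rewrite lt_def prob_ge0 andbT; apply/eqP => pA; apply: A0.
  by rewrite (probE mu mA) pA.
have pA1 : 0 < prob mu (~` A).
  rewrite probC// subr_gt0 lt_neqAle prob_le1// andbT; apply/eqP => pA; apply: A1.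
  by rewrite (probE mu mA) pA.
have mAC := measurableC mA; have pC := probC mu mA.
have cond (B : set (Borel X)) : measurable B -> T @^-1` B = B -> 0 < prob mu B ->
    exists2 m : probability (Borel X) R, invariant_measures T m &
    forall C, measurable C -> prob m C = prob mu (C `&` B) / prob mu B.
  move=> mB TB pB; have [m mE] := prob_conditional mB pB; exists m => // C mC.
  have mTC := borel_preimage T_cont mC.
  rewrite (probE m mTC) (probE m mC) !mE//; congr (_ / _)%:E; congr fine.
  by rewrite -{1}TB -preimage_setI; apply: inv; exact: measurableI.
have [mu1 inv1 mu1E] := cond A mA TA pA0.
have [||mu2 inv2 mu2E] := cond (~` A) mAC; [exact: (congr1 setC TA)|by []|].
have n1 : ~ same_measure mu1 mu.
  move=> /same_measure_prob/(_ mA); rewrite mu1E// setIid divff ?gt_eqF//; lra.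
have n2 : ~ same_measure mu2 mu.
  move=> /same_measure_prob/(_ mA); rewrite mu2E// setICr prob0 mul0r; lra.
have [muoo|mufin] := eqVneq (entropy T mu) +oo%E.
  by apply: n1; apply: (infinite_entropy_same mu_eq inv muoo).
have h_fin m : (entropy T m < +oo)%E -> invariant_measures T m ->
    entropy T m = (fine (entropy T m))%:E.
  by move=> moo mi; rewrite fineK// ge0_fin_numE// (entropy_ge0 T_cont).
have muh := h_fin mu; rewrite ltey mufin in muh; have {}muh := muh isT inv.
pose I (m : probability (Borel X) R) := \int[m]_x psi x.
pose h m := fine (entropy T m).
have lt m : invariant_measures T m -> ~ same_measure m mu ->
    (entropy T m <= (h m)%:E)%E /\ h m + I m < h mu + I mu.
  move=> mi nm; have : (entropy T m + (I m)%:E < (h mu + I mu)%:E)%E.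
    rewrite EFinD -muh muE lt_neqAle le_classical_sup// andbT.
    by apply/eqP => mE; apply: nm; exact: mu_uniq.
  rewrite -lteBrDr// -EFinB => mlt.
  have mh : entropy T m = (h m)%:E by apply: h_fin => //; exact: lt_trans mlt (ltry _).
  by split; [rewrite mh|move: mlt; rewrite mh lte_fin; lra].
have [h1 l1] := lt mu1 inv1 n1; have [h2 l2] := lt mu2 inv2 n2.
have mix (B : set (Borel X)) : measurable B ->
    prob mu B = prob mu A * prob mu1 B + prob mu (~` A) * prob mu2 B.
  move=> mB; rewrite mu1E// mu2E// mulrCA divff ?gt_eqF// mulr1.
  by rewrite [X in _ + X]mulrCA divff ?gt_eqF// mulr1 (probID mu mB mA) setDE.
have pAC : prob mu A + prob mu (~` A) = 1 by lra.
have := ks_entropy_mixture_le T_meas pA0 pA1 pAC mix inv inv1 inv2 h1 h2.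
rewrite -/(entropy T mu) muh lee_fin.
have := Rintegral_mixture (ltW pA0) (ltW pA1) mix psic.
rewrite -/(I _) -/(I mu1) -/(I mu2) -/(h mu).
have : prob mu A * (h mu1 + I mu1) < prob mu A * (h mu + I mu) by rewrite ltr_pM2l.
have : prob mu (~` A) * (h mu2 + I mu2) < prob mu (~` A) * (h mu + I mu) by rewrite ltr_pM2l.
by rewrite pC; lra.
Qed.

End Equilibria.

(** * Integral vectors and fibres *)

Section IntegralVector.
Context {R : realType} {X : pmetricType R}.
Variables (T : X -> X) (d : nat) (Phi : 'I_d -> X -> R).
Hypotheses (X_compact : compact [set: X]) (T_cont : continuous T).
Hypothesis Phi_cont : forall i, continuous (Phi i).
Implicit Types (psi : X -> R) (mu nu : probability (Borel X) R) (q v w z : 'rV[R]_d).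

Definition dot q v : R := \sum_i q ord0 i * v ord0 i.

Lemma dotDl q q' v : dot (q + q') v = dot q v + dot q' v.
Proof. by rewrite -big_split; apply: eq_bigr => i _; rewrite mxE mulrDl. Qed.

Lemma dotDr q v w : dot q (v + w) = dot q v + dot q w.
Proof. by rewrite -big_split; apply: eq_bigr => i _; rewrite mxE mulrDr. Qed.

Lemma dotZl (t : R) q v : dot (t *: q) v = t * dot q v.
Proof. by rewrite mulr_sumr; apply: eq_bigr => i _; rewrite mxE mulrA. Qed.

Lemma dotC q v : dot q v = dot v q.
Proof. by apply: eq_bigr => i _; rewrite mulrC. Qed.

Lemma dotZr (t : R) q v : dot q (t *: v) = t * dot q v.
Proof. by rewrite dotC dotZl dotC. Qed.

Lemma dot0r q : dot q 0 = 0.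
Proof. by rewrite /dot big1// => i _; rewrite mxE mulr0. Qed.

Lemma dot_sqr_ge q i : q ord0 i ^+ 2 <= dot q q.
Proof.
by rewrite /dot (bigD1 i)//= -expr2 lerDl sumr_ge0// => j _; rewrite -expr2 sqr_ge0.
Qed.

Lemma dot_eq0 q : dot q q <= 0 -> q = 0.
Proof.
move=> q0; apply/rowP => i; rewrite mxE; apply/eqP; rewrite -sqrf_eq0 eq_le sqr_ge0.
by rewrite (le_trans (dot_sqr_ge q i)).
Qed.

Lemma dot_cvg (I : Type) (U : set_system I) (u : I -> 'rV[R]_d) q v : Filter U ->
  u k @[k --> U] --> v -> dot q (u k) @[k --> U] --> dot q v.
Proof.
move=> FU uv; apply: cvg_big => [|i _]; first exact: add_continuous.
apply: cvgMr; apply: (cvg_comp u (fun v : 'rV[R]_d => v ord0 i) uv).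
exact: coord_continuous.
Qed.

Lemma dot_sqr_cvg (I : Type) (U : set_system I) (u : I -> 'rV[R]_d) v : Filter U ->
  u k @[k --> U] --> v -> dot (u k) (u k) @[k --> U] --> dot v v.
Proof.
move=> FU uv; apply: cvg_big => [|i _]; first exact: add_continuous.
by apply: cvgM; apply: (cvg_comp u (fun v : 'rV[R]_d => v ord0 i) uv);
  exact: coord_continuous.
Qed.

Lemma norm1_cvg (I : Type) (U : set_system I) (u : I -> 'rV[R]_d) v : Filter U ->
  u k @[k --> U] --> v ->
  \sum_i `|u k ord0 i| @[k --> U] --> \sum_i `|v ord0 i|.
Proof.
move=> FU uv; apply: cvg_big => [|i _]; first exact: add_continuous.
apply: cvg_norm; apply: (cvg_comp u (fun v : 'rV[R]_d => v ord0 i) uv).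
exact: coord_continuous.
Qed.

Lemma integral_span mu (a : 'I_d -> R) (c : R) :
  \int[mu]_x (\sum_i a i * Phi i x + c) =
  \sum_i a i * integral_vec Phi mu ord0 i + c.
Proof.
have HL := integral_state X_compact mu.
have cP i : continuous (fun x => a i * Phi i x) by exact: continuous_scale_fun.
have sc : continuous (fun x => \sum_i a i * Phi i x).
  by apply: (@continuous_sum _ _ _ _ _ (fun i x => a i * Phi i x)) => i _.
rewrite (stateD HL)//; last exact: cst_continuous.
rewrite (state_cst HL); congr (_ + _).
rewrite (state_sum HL)//; apply: eq_bigr => i _.
by rewrite (stateZ HL)// mxE.
Qed.

Lemma span1_continuous psi : span1 Phi psi -> continuous psi.
Proof.
move=> [a [c ->]]; apply: continuous_add_fun; last exact: cst_continuous.
apply: (@continuous_sum _ _ _ _ _ (fun i x => a i * Phi i x)) => i _.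
exact: continuous_scale_fun.
Qed.

Lemma span1_inner_shift q z : span1 Phi (inner_shift Phi q z).
Proof.
exists (q ord0), (- dot q z); apply/funext => x; rewrite /inner_shift /dot -sumrB.
by apply: eq_bigr => i _; rewrite mulrBr.
Qed.

Lemma integral_inner_shift mu q z :
  \int[mu]_x inner_shift Phi q z x =
  dot q (integral_vec Phi mu - z).
Proof.
rewrite (_ : inner_shift Phi q z = fun x => \sum_i q ord0 i * Phi i x - dot q z).
  by rewrite integral_span /dot -sumrB; apply: eq_bigr => i _; rewrite !mxE mulrBr.
apply/funext => x; rewrite /inner_shift /dot -sumrB.
by apply: eq_bigr => i _; rewrite mulrBr.
Qed.

Lemma integral_vec_cvg (I : Type) (U : set_system I)
    (m : I -> probability (Borel X) R) mu : Filter U -> weak_cvg U m mu ->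
  integral_vec Phi (m i) @[i --> U] --> integral_vec Phi mu.
Proof.
move=> FU mcvg; apply: cvg_row => i; rewrite mxE.
have := mcvg _ (@Phi_cont i); apply: cvg_trans; apply: near_eq_cvg.
by apply: nearW => k; rewrite mxE.
Qed.

Lemma integral_vec_same mu nu : same_measure mu nu ->
  integral_vec Phi mu = integral_vec Phi nu.
Proof. by move=> mn; apply/rowP => i; rewrite !mxE; exact: same_measure_Rintegral. Qed.

Lemma integral_vec_bounded : exists C : R, forall mu i, `|integral_vec Phi mu ord0 i| <= C.
Proof.
have [C PC] := Phi_bounded X_compact Phi_cont; exists C => mu i; rewrite mxE.
exact: (state_norm_le (integral_state X_compact mu)).
Qed.

(** On a fibre the integral of [psi] is constant, so an equilibrium for [psi] in the fibre maximises
    the entropy there, and uniqueness carries over. *)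
Lemma classical_equilibrium_fiber psi mu nu : span1 Phi psi ->
  unique_classical_equilibrium T psi nu -> invariant_measures T mu ->
  integral_vec Phi mu = integral_vec Phi nu ->
  (entropy T mu <= entropy T nu)%E /\
  ((entropy T nu <= entropy T mu)%E -> same_measure mu nu).
Proof.
move=> [a [c psiE]] [[inv nuE] uniq] invm muI.
have int_eq : \int[mu]_x psi x = \int[nu]_x psi x.
  by rewrite psiE !integral_span muI.
have := le_classical_sup psi invm; rewrite -nuE int_eq leeD2rE// => le_mn; split=> // le_nm.
apply: uniq; split=> //; rewrite -nuE int_eq; congr (_ + _)%E; apply/eqP.
by rewrite eq_le le_mn le_nm.
Qed.

End IntegralVector.

(** * The dual problem: minimising the pressure of <q, Phi - z> *)

Section Duality.
Context {R : realType} {X : pmetricType R}.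
Variables (T : X -> X) (d : nat) (Phi : 'I_d -> X -> R).
Hypotheses (X_compact : compact [set: X]) (T_cont : continuous T).
Hypotheses (Phi_cont : forall i, continuous (Phi i)) (usc : entropy_usc T).
Hypothesis finite_entropy : forall mu : probability (Borel X) R,
  invariant_measures T mu -> (entropy T mu < +oo)%E.
Implicit Types (mu nu : probability (Borel X) R) (q v z : 'rV[R]_d).

Let h mu : R := fine (entropy T mu).

Let hE mu : invariant_measures T mu -> entropy T mu = (h mu)%:E.
Proof.
by move=> inv; rewrite fineK// ge0_fin_numE ?finite_entropy// (entropy_ge0 T_cont).
Qed.

Variables (z : 'rV[R]_d) (e : 'rV[R]_d -> probability (Borel X) R).
Hypothesis eP : forall q, unique_classical_equilibrium T (inner_shift Phi q z) (e q).

Let shift mu : 'rV[R]_d := integral_vec Phi mu - z.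

(** The supremum in the classical variational principle for [<q, Phi - z>], read off at its
    equilibrium measure [e q] as a real number. *)
Definition dual_pressure q : R := h (e q) + dot q (shift (e q)).

Let e_inv q : invariant_measures T (e q). Proof. by case: (eP q) => -[]. Qed.

Lemma le_dual_pressure q mu : invariant_measures T mu ->
  h mu + dot q (shift mu) <= dual_pressure q.
Proof.
move=> inv; have [[_ eE] _] := eP q.
have := le_classical_sup (inner_shift Phi q z) inv; rewrite -eE.
by rewrite !integral_inner_shift// hE// (hE (e_inv q)) -!EFinD lee_fin.
Qed.

Lemma dual_pressure_unique q mu : invariant_measures T mu ->
  dual_pressure q <= h mu + dot q (shift mu) -> same_measure mu (e q).
Proof.
move=> inv le_mu; have [[_ eE] uniq] := eP q; apply: uniq; split=> //.
rewrite -eE !integral_inner_shift// hE// (hE (e_inv q)) -!EFinD; congr EFin.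
by apply/eqP; rewrite eq_le le_dual_pressure.
Qed.

(** [shift (e q')] is a subgradient at [q'] of this convex function; here [q'] is the far end of the
    step. *)
Lemma dual_pressure_step q v (t : R) :
  dual_pressure (q + t *: v) <= dual_pressure q + t * dot v (shift (e (q + t *: v))).
Proof.
rewrite {1}/dual_pressure dotDl dotZl addrA lerD2r.
exact: le_dual_pressure.
Qed.

(* Limits of equilibria for [q + v / (n + 1)] are equilibria for [q], hence [e q]. *)
Lemma shift_equilibrium_limit q v : exists U : set_system nat,
  [/\ UltraFilter U, U `=>` \oo &
   shift (e (q + n.+1%:R^-1 *: v)) @[n --> U] --> shift (e q)].
Proof.
have [U [ultraU ooU]] := ultraFilterLemma (eventually_filter : ProperFilter \oo).
exists U; split=> //; have PU := @ultra_proper _ _ ultraU.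
pose m n := e (q + n.+1%:R^-1 *: v).
have [mu inv mcvg] := weak_cvg_ultra X_compact T_cont ultraU (fun n => e_inv (q + n.+1%:R^-1 *: v)).
have scvg : shift (m n) @[n --> U] --> shift mu.
  by apply: cvgB; [exact: integral_vec_cvg|exact: cvg_cst].
have dcvg u : dot u (shift (m n)) @[n --> U] --> dot u (shift mu).
  exact: dot_cvg.
suff emu : same_measure (e q) mu.
  have -> : shift (e q) = shift mu by rewrite /shift (integral_vec_same Phi emu).
  exact: scvg.
have tcvg : (n.+1%:R^-1 : R) @[n --> U] --> (0 : R).
  apply: cvg_trans (@cvg_harmonic R); exact: cvg_app.
suff /(dual_pressure_unique inv) mue : dual_pressure q <= h mu + dot q (shift mu).
  by move=> A mA; rewrite mue.
rewrite -lee_fin [X in (_ <= X)%E]EFinD -[X in (_ <= X + _)%E]hE//.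
apply: (le_entropy_cvg usc PU (fun n => e_inv (q + n.+1%:R^-1 *: v)) inv mcvg (dcvg q)).
move=> c; rewrite lte_fin => cp.
(* Comparing [m n] with its competitor [e q] at the parameter of [m n] bounds its value at [q] from
   below by [dual_pressure q], up to a term of order [1 / (n + 1)]. *)
have gcvg : dual_pressure q + n.+1%:R^-1 * (dot v (shift (e q)) - dot v (shift (m n)))
    @[n --> U] --> dual_pressure q + 0 * (dot v (shift (e q)) - dot v (shift mu)).
  apply: cvgD; first exact: cvg_cst.
  by apply: cvgM => //; apply: cvgB; [exact: cvg_cst|exact: dcvg].
rewrite mul0r addr0 in gcvg.
have H : U [set n | c < dual_pressure q + n.+1%:R^-1 * (dot v (shift (e q)) - dot v (shift (m n)))].
  exact: cvgr_gt gcvg _ cp.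
apply: filterS H => n /= cn.
rewrite hE// -EFinD lte_fin; apply: lt_le_trans cn _.
have := le_dual_pressure (q + n.+1%:R^-1 *: v) (e_inv q).
rewrite dotDl dotZl -/(m n).
have := dual_pressure_step q v n.+1%:R^-1; rewrite -/(m n).
have : dual_pressure (q + n.+1%:R^-1 *: v) =
  h (m n) + dot (q + n.+1%:R^-1 *: v) (shift (m n)) by [].
rewrite dotDl dotZl /dual_pressure => ->.
by move: (n.+1%:R^-1) => t; rewrite mulrBr; lra.
Qed.

(** Leave the minimiser in the direction [v = - s], where [s] is the expected gradient. Dividing the
    subgradient bound by the step length and letting it tend to 0 gives [0 <= - dot s s]. The limit
    exists by [shift_equilibrium_limit]. *)
Lemma dual_stationary q0 (dl : R) : 
  (forall q, dual_pressure q0 + dl / 2 * dot q0 q0 <= dual_pressure q + dl / 2 * dot q q) ->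
  shift (e q0) = - (dl *: q0).
Proof.
move=> qmin; set s := shift (e q0) + dl *: q0.
have [v vE] : exists v, v = (-1) *: s by exists ((-1) *: s).
suff s0 : s = 0 by apply/eqP; rewrite -addr_eq0 -/s s0.
have [U [ultraU ooU scvg]] := shift_equilibrium_limit q0 v.
have PU := @ultra_proper _ _ ultraU.
have tcvg : (n.+1%:R^-1 : R) @[n --> U] --> (0 : R).
  apply: cvg_trans (@cvg_harmonic R); exact: cvg_app.
have : dot v (shift (e (q0 + n.+1%:R^-1 *: v))) + dl * dot q0 v +
    dl / 2 * n.+1%:R^-1 * dot v v @[n --> U] -->
  dot v (shift (e q0)) + dl * dot q0 v + dl / 2 * 0 * dot v v.
  apply: cvgD; first by apply: cvgD; [exact: dot_cvg|exact: cvg_cst].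
  by apply: cvgMl; apply: cvgMr.
move=> /cvgr_to_ge h0; have : 0 <= dot v (shift (e q0)) + dl * dot q0 v + dl / 2 * 0 * dot v v.
  apply: h0; apply: nearW => n; set t : R := n.+1%:R^-1.
  have t0 : 0 < t by rewrite invr_gt0.
  rewrite -(pmulr_rge0 _ t0); have := qmin (q0 + t *: v).
  have := dual_pressure_step q0 v t; rewrite !dotDl !dotDr !dotZl !dotZr (dotC v q0).
  by rewrite !mulrDr; lra.
rewrite mulr0 mul0r addr0 (dotC q0) -dotZr -dotDr -/s vE dotZl => s0.
by apply: dot_eq0; lra.
Qed.

(** [dual_pressure] is Lipschitz because integral vectors are bounded, so a minimum exists on a
    compact box; outside the box the value at 0 is not undercut. *)
Lemma dual_minimizer (dl M : R) :
  (forall q i, M < `|q ord0 i| -> dual_pressure 0 <= dual_pressure q + dl / 2 * dot q q) ->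
  exists q0, forall q,
    dual_pressure q0 + dl / 2 * dot q0 q0 <= dual_pressure q + dl / 2 * dot q q.
Proof.
move=> coercive; pose G q := dual_pressure q + dl / 2 * dot q q.
have [C PC] := integral_vec_bounded X_compact Phi_cont.
pose D := \sum_i (C + `|z ord0 i|).
have sD mu i : `|shift mu ord0 i| <= D.
  have -> : shift mu ord0 i = integral_vec Phi mu ord0 i - z ord0 i by rewrite !mxE.
  rewrite /D (bigD1 i)//=; apply: (@le_trans _ _ (C + `|z ord0 i|)).
    by apply: le_trans (ler_normB _ _) _; rewrite lerD2r.
  rewrite lerDl sumr_ge0// => j _; rewrite addr_ge0//.
  exact: le_trans (PC mu j).
have dotD mu v : `|dot v (shift mu)| <= D * \sum_i `|v ord0 i|.
  apply: le_trans (ler_norm_sum _ _ _) _; rewrite mulr_sumr; apply: ler_sum => i _.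
  by rewrite normrM mulrC ler_wpM2r.
have lip q q' : dual_pressure q' <= dual_pressure q + D * \sum_i `|(q - q') ord0 i|.
  have := dual_pressure_step q (q' - q) 1; rewrite scale1r addrC subrK mul1r => /le_trans; apply.
  rewrite lerD2l; apply: le_trans (ler_norm _) _; apply: le_trans (dotD _ _) _.
  rewrite le_eqVlt; apply/orP; left; apply/eqP; congr (_ * _).
  by apply: eq_bigr => i _; rewrite !mxE distrC.
have sumc q : (\sum_i `|(q - q') ord0 i|) @[q' --> q] --> (0 : R).
  have s0 : \sum_(i < d) `|(q - q) ord0 i| = 0.
    by rewrite big1// => i _; rewrite !mxE subrr normr0.
  rewrite -[X in _ --> X]s0.
  apply: (norm1_cvg (u := fun q' => q - q') (v := q - q) (nbhs_filter q)).
  by apply: cvgB; [exact: cvg_cst|exact: cvg_id].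
have pc : continuous dual_pressure.
  move=> q; apply: (@squeeze_cvgr _ _ (nbhs_filter q) _
    (fun q' => dual_pressure q - D * \sum_i `|(q - q') ord0 i|)
    (fun q' => dual_pressure q + D * \sum_i `|(q - q') ord0 i|)).
  - apply: nearW => q'; rewrite lip andbT lerBlDr; apply: le_trans (lip q' q) _.
    rewrite le_eqVlt; apply/orP; left; apply/eqP; congr (_ + _ * _).
    by apply: eq_bigr => i _; rewrite !mxE distrC.
  - have hh := cvgB (cvg_cst (dual_pressure q)) (cvgMr (a := D) (sumc q)).
    rewrite mulr0 subr0 in hh; exact: hh.
  - have hh := cvgD (cvg_cst (dual_pressure q)) (cvgMr (a := D) (sumc q)).
    rewrite mulr0 addr0 in hh; exact: hh.
have Gc : continuous G.
  move=> q; apply: (cvgD (pc q)).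
  exact: (cvgMr (dot_sqr_cvg (nbhs_filter q) cvg_id)).
(* The maximum with 0 ensures that the box contains the origin. *)
pose K := [set q : 'rV[R]_d | forall i, `|q ord0 i| <= Num.max M 0].
have K0 : K 0 by move=> i; rewrite mxE normr0 le_max lexx orbT.
have [||q0 _ q0min] := @compact_EVT_min _ _ G K _ (@box_compact _ _ _).
- by exists 0.
- exact: continuous_subspaceT.
exists q0 => q; have [Kq|nKq] := pselect (K q); first by apply: q0min; exact/mem_set.
apply: (@le_trans _ _ (G 0)); first by apply: q0min; exact/mem_set.
rewrite /G dot0r mulr0 addr0; move/existsNP: nKq => [i /negP].
by rewrite -ltNge gt_max => /andP[Mi _]; exact: coercive Mi.
Qed.

(** Testing [q0] with [mu], whose shift is 0, gives [h mu <= dual_pressure q0], which is [h (e q0)]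
    minus [dl * dot q0 q0] by stationarity. The second bound compares [q0] with the origin. *)
Lemma dual_minimizer_attains q0 (dl : R) mu : invariant_measures T mu ->
  integral_vec Phi mu = z ->
  (forall q, dual_pressure q0 + dl / 2 * dot q0 q0 <= dual_pressure q + dl / 2 * dot q q) ->
  0 <= dl ->
  (entropy T mu <= entropy T (e q0))%E /\
  dl * dot q0 q0 <= 2 * dual_pressure 0.
Proof.
move=> inv muz qmin dl0; have sE := dual_stationary qmin.
have qq0 : 0 <= dot q0 q0 by apply: sumr_ge0 => i _; rewrite -expr2 sqr_ge0.
have pE : dual_pressure q0 = h (e q0) - dl * dot q0 q0.
  by rewrite /dual_pressure sE -scaleNr dotZr mulNr.
have := le_dual_pressure q0 inv; have := qmin 0; rewrite dot0r mulr0 addr0 /shift muz subrr dot0r.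
have h0 : 0 <= h mu by rewrite fine_ge0// (entropy_ge0 T_cont).
have dq0 : 0 <= dl * dot q0 q0 by rewrite mulr_ge0.
rewrite addr0 hE// (hE (e_inv q0)) lee_fin => h1 h2.
by move: h1; rewrite mulrAC; split; lra.
Qed.

(* Tikhonov regularisation: a minimiser for small [dl] almost realises [z]. *)
Lemma equilibrium_near mu (eps : R) : invariant_measures T mu ->
  integral_vec Phi mu = z -> 0 < eps -> exists q0,
  (entropy T mu <= entropy T (e q0))%E /\
  forall i, `|integral_vec Phi (e q0) ord0 i - z ord0 i| <= eps.
Proof.
move=> inv muz eps0; pose P := dual_pressure 0.
have pge q : 0 <= dual_pressure q.
  apply: le_trans (le_dual_pressure q inv).
  by rewrite /shift muz subrr dot0r addr0 fine_ge0// (entropy_ge0 T_cont).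
(* Each coordinate of the shift has square at most [dl * (dl * dot q0 q0) <= dl * (2 * P)], which
   this choice keeps below [eps ^+ 2]. *)
pose dl := eps ^+ 2 / (2 * P + 1); have P1 : 0 < 2 * P + 1 by have := pge 0; rewrite -/P; lra.
have dl0 : 0 < dl by rewrite divr_gt0// exprn_gt0.
(* Beyond this bound a coordinate is at least 1 and at least [2 * P / dl], so its square already
   gives [dl / 2 * q_i ^ 2 >= P]. *)
have [|q0 qmin] := @dual_minimizer dl (1 + 2 * P / dl).
  move=> q i qi; rewrite -/P; apply: le_trans (_ : dl / 2 * q ord0 i ^+ 2 <= _).
    have a1 : 1 <= `|q ord0 i|.
      by apply: le_trans (ltW qi); rewrite lerDl divr_ge0// ?(ltW dl0)// mulr_ge0// pge.
    have a2 : 2 * P / dl <= `|q ord0 i| by apply: le_trans (ltW qi); rewrite lerDr.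
    rewrite ler_pdivrMr// in a2.
    have a3 : `|q ord0 i| <= q ord0 i ^+ 2.
      by rewrite -real_normK ?num_real// expr2 ler_peMl.
    have : `|q ord0 i| * dl <= q ord0 i ^+ 2 * dl by rewrite ler_wpM2r// ltW.
    by rewrite mulrAC (mulrC dl); lra.
  rewrite ler_wpDl// ler_wpM2l//; first by rewrite divr_ge0// ltW.
  exact: dot_sqr_ge.
have [h1 h2] := dual_minimizer_attains inv muz qmin (ltW dl0).
exists q0; split=> // i.
have -> : integral_vec Phi (e q0) ord0 i - z ord0 i = shift (e q0) ord0 i by rewrite !mxE.
rewrite (dual_stationary qmin) !mxE normrN.
rewrite -ler_sqr ?nnegrE// ?(ltW eps0)// real_normK ?num_real// exprMn.
apply: (@le_trans _ _ (dl * (2 * P))).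
  rewrite expr2 -mulrA ler_pM2l//; apply: le_trans h2.
  by rewrite ler_pM2l// dot_sqr_ge.
by rewrite /dl mulrAC ler_pdivrMr// ler_wpM2l ?sqr_ge0// lerDl.
Qed.

(** The ball around [z] inside [L_set] makes [dual_pressure] grow linearly in [q], so a minimiser
    exists without regularisation, and there the shift is 0. *)
Lemma equilibrium_interior : (L_set T Phi)° z ->
  exists q0, integral_vec Phi (e q0) = z.
Proof.
move=> zL; have [mu inv muz] := interior_subset zL.
have [r r0 rL] : exists2 r : R, 0 < r & ball z r `<=` L_set T Phi.
  by move: zL => /nbhs_ballP[r /= r0 rL]; exists r.
have [|q0 qmin] := @dual_minimizer 0 (dual_pressure 0 / (r / 2)).
  move=> q i qi; rewrite mul0r mul0r addr0.
  (* Moving from [z] by [r / 2] along the signs of [q] gives [dot q (y - z)] equal to [r / 2] times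
     the sum of the absolute values of the coordinates. *)
  pose y : 'rV[R]_d := z + \row_i (r / 2 * Num.sg (q ord0 i)).
  have [nu invn nuy] : L_set T Phi y.
    apply: rL; split=> // k j; rewrite (ord1 k) /y !mxE /ball/= opprD addNKr normrN.
    rewrite normrM gtr0_norm ?divr_gt0// normr_sg; case: eqP => _; rewrite ?mulr0 ?mulr1//; lra.
  apply: le_trans (le_dual_pressure q invn).
  have h0 : 0 <= h nu by rewrite fine_ge0// (entropy_ge0 T_cont).
  rewrite ler_wpDl// /shift nuy /y addrC addKr.
  apply: (@le_trans _ _ (r / 2 * `|q ord0 i|)).
    by rewrite -ler_pdivrMl ?divr_gt0// mulrC ltW.
  rewrite /dot (bigD1 i)//= mxE mulrCA (mulrC (q ord0 _)) -normrEsg lerDl sumr_ge0// => j _.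
  by rewrite mxE mulrCA (mulrC (q ord0 _)) -normrEsg mulr_ge0// divr_ge0// ltW.
exists q0; have := dual_stationary qmin.
by rewrite scale0r oppr0 => /subr0_eq.
Qed.

End Duality.

(** * The variational principle for all invariant measures, and attained suprema *)

Section Variational.
Context {R : realType} {X : pmetricType R}.
Variables (T : X -> X) (d : nat) (Phi : 'I_d -> X -> R) (F : 'rV[R]_d -> R).
Hypotheses (X_compact : compact [set: X]) (T_cont : continuous T).
Hypotheses (Phi_cont : forall i, continuous (Phi i)) (usc : entropy_usc T).
Hypothesis unique_equilibria : forall psi, span1 Phi psi ->
  exists mu, unique_classical_equilibrium T psi mu.
Implicit Types (mu nu : probability (Borel X) R) (q v z : 'rV[R]_d).

Lemma entropy_same mu nu : same_measure mu nu -> entropy T mu = entropy T nu.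
Proof. by move=> munu; apply: eq_ks_entropy => //; exact: borel_continuous_map. Qed.

Lemma span1_0 : span1 Phi (fun x => \sum_i 0 * Phi i x + 0).
Proof. by exists (fun=> 0), 0. Qed.

Lemma entropy_dichotomy :
  (forall mu, invariant_measures T mu -> (entropy T mu < +oo)%E) \/
  exists2 psi, span1 Phi psi & exists nu, unique_classical_equilibrium T psi nu /\
    forall mu, invariant_measures T mu -> same_measure mu nu.
Proof.
have [[m [invm moo]]|fin] := pselect (exists m, invariant_measures T m /\ entropy T m = +oo%E).
  right; exists (fun x => \sum_i 0 * Phi i x + 0); first exact: span1_0.
  have [nu nuP] := unique_equilibria span1_0; exists nu; split=> // mu inv A mA.
  have same := infinite_entropy_same T_cont nuP invm moo.
  by rewrite (same _ inv)// (same _ nuP.1.1).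
left=> mu inv; rewrite ltey; apply/eqP => muoo; apply: fin; by exists mu.
Qed.

Lemma interior_equilibrium z : (L_set T Phi)° z -> exists psi nu,
  [/\ span1 Phi psi, unique_classical_equilibrium T psi nu & integral_vec Phi nu = z].
Proof.
move=> zL; have [fin|[psi sp [nu [nuP same]]]] := entropy_dichotomy.
  have /choice[e eP] := fun q => unique_equilibria (span1_inner_shift Phi q z).
  have [q0 q0z] := equilibrium_interior X_compact T_cont Phi_cont usc fin eP zL.
  by exists (inner_shift Phi q0 z), (e q0); split=> //; exact: span1_inner_shift.
have [mu inv muz] := interior_subset zL; exists psi, nu; split=> //.
by rewrite -muz; apply/integral_vec_same => A mA; rewrite (same mu inv).
Qed.

Hypothesis F_cont : continuous F.

Lemma le_nonlinear_pressure mu : invariant_measures T mu ->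
  (entropy T mu + (F (integral_vec Phi mu))%:E <= nonlinear_pressure T Phi F)%E.
Proof.
move=> inv; have NPge psi nu : span1 Phi psi -> unique_classical_equilibrium T psi nu ->
    (entropy T nu + (F (integral_vec Phi nu))%:E <= nonlinear_pressure T Phi F)%E.
  move=> sp nuP; apply: nonlinear_pressure_ge => //.
  by apply: unique_equilibrium_ergodic nuP => //; exact: span1_continuous sp.
have [fin|[psi sp [nu [nuP same]]]] := entropy_dichotomy; last first.
  have mn := same mu inv.
  by rewrite (entropy_same mn) (integral_vec_same Phi mn); exact: NPge sp nuP.
set z := integral_vec Phi mu.
have /choice[e eP] := fun q => unique_equilibria (span1_inner_shift Phi q z).
apply/lee_addgt0Pr => delta delta0.
have [eta eta0 etaP] := local_oscillation F_cont z delta0.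
have eta20 : 0 < eta / 2 by rewrite divr_gt0.
have [q0 [h1 h2]] := equilibrium_near X_compact T_cont Phi_cont usc fin eP inv erefl eta20.
apply: le_trans (leeD2r _ (NPge _ _ (span1_inner_shift Phi q0 z) (eP q0))).
rewrite -addeA -EFinD; apply: leeD => //; rewrite lee_fin.
have : `|F z - F (integral_vec Phi (e q0))| <= delta.
  by apply: etaP => i; rewrite distrC (le_lt_trans (h2 i))//; lra.
by rewrite ler_norml => /andP[_]; lra.
Qed.

(* The sets [mu : c < h_mu + G] generate a filter converging to the supremum. *)
Lemma entropy_attained (Z : set 'rV[R]_d) (G : 'rV[R]_d -> R) mu0 :
  continuous G -> closed Z -> invariant_measures T mu0 -> Z (integral_vec Phi mu0) ->
  exists mu, [/\ invariant_measures T mu, Z (integral_vec Phi mu) &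
    forall nu, invariant_measures T nu -> Z (integral_vec Phi nu) ->
      (entropy T nu + (G (integral_vec Phi nu))%:E <=
       entropy T mu + (G (integral_vec Phi mu))%:E)%E].
Proof.
move=> Gc Zc inv0 Z0.
pose val mu := (entropy T mu + (G (integral_vec Phi mu))%:E)%E.
pose W := [set mu | invariant_measures T mu /\ Z (integral_vec Phi mu)].
pose s := ereal_sup (val @` W).
have W0 : W mu0 by [].
have val_gtN mu : invariant_measures T mu -> (-oo < val mu)%E.
  move=> inv; apply: lt_le_trans (leeD2r _ (entropy_ge0 T_cont inv)).
  by rewrite add0e ltNyr.
have sN : (-oo < s)%E.
  apply: lt_le_trans (val_gtN _ inv0) _; by apply: ereal_sup_ubound; exists mu0.
pose B (c : R) := [set mu | W mu /\ (c%:E < val mu)%E].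
pose D := [set c : R | (c%:E < s)%E].
have [c0 _ Dc0] := ereal_between sN.
have PF : ProperFilter (filter_from D B).
  apply: filter_from_proper.
    apply: filter_from_filter; first by exists c0.
    move=> i j Di Dj; exists (Num.max i j); first by rewrite /D/=; case: (leP i j).
    by move=> mu [Wmu ijm]; split; split=> //;
      apply: le_lt_trans ijm; rewrite lee_fin le_max lexx ?orbT.
  by move=> c /ereal_sup_gt[_ [mu Wmu <-] cmu]; exists mu.
have [U [ultraU BU]] := ultraFilterLemma PF.
have PU := @ultra_proper _ _ ultraU.
have UB c : (c%:E < s)%E -> U (B c) by move=> cs; apply: BU; exists c.
(* Makes the identity a family with values in [W]; the default [mu0] does not matter, since the
   ultrafilter lives on [W]. *)
pose m mu := if pselect (W mu) then mu else mu0.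
have Wm mu : W (m mu) by rewrite /m; case: pselect.
have [mu inv mcvg] := weak_cvg_ultra X_compact T_cont ultraU (fun mu => (Wm mu).1).
have FU : Filter U by exact: PU.
have Icvg := integral_vec_cvg Phi_cont FU mcvg.
exists mu; split=> //.
  apply: (@closed_cvg _ _ U PU (fun k => integral_vec Phi (m k)) Z Zc _ _ Icvg).
  by apply: nearW => k; exact: (Wm k).2.
have smu : (s <= val mu)%E.
  have Gcvg : G (integral_vec Phi (m k)) @[k --> U] --> G (integral_vec Phi mu).
    by apply: (cvg_comp _ G Icvg); exact: Gc.
  apply: (le_entropy_cvg usc PU (fun k => (Wm k).1) inv mcvg Gcvg) => c cs.
  have := UB c cs; apply: filterS => k [Wk ck].
  by rewrite /m; case: pselect.
by move=> nu invn Zn; apply: le_trans smu; apply: ereal_sup_ubound; exists nu.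
Qed.

End Variational.

(** * The set K(F, Phi) *)

Section EquilibriumSet.
Context {R : realType} {X : pmetricType R}.
Variables (T : X -> X) (d : nat) (Phi : 'I_d -> X -> R) (F : 'rV[R]_d -> R).
Hypotheses (X_compact : compact [set: X]) (T_cont : continuous T).
Hypotheses (Phi_cont : forall i, continuous (Phi i)) (usc : entropy_usc T).
Hypothesis unique_equilibria : forall psi, span1 Phi psi ->
  exists mu, unique_classical_equilibrium T psi mu.
Hypothesis F_cont : continuous F.
Implicit Types (mu nu : probability (Borel X) R) (q v z : 'rV[R]_d).

Let NP := nonlinear_pressure T Phi F.
Let NP_ge := le_nonlinear_pressure X_compact T_cont Phi_cont usc unique_equilibria F_cont.
Let NP_le := nonlinear_pressure_le X_compact T_cont Phi_cont F_cont.

Lemma K_set_nonempty : K_set T Phi F !=set0.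
Proof.
have [mu0 [[inv0 _] _]] := unique_equilibria (span1_0 Phi).
have [mu [inv _ mu_max]] := entropy_attained X_compact T_cont Phi_cont usc F_cont closedT inv0 I.
exists (integral_vec Phi mu), mu => //; split=> //.
apply/eqP; rewrite eq_le NP_ge// andbT; apply: NP_le => nu invn; exact: mu_max.
Qed.

(** For closedness, choose equilibrium measures over points of [K_set] converging to [z]. Their weak
    limit has integral vector [z], and by semicontinuity it still reaches the pressure. *)
Lemma K_set_compact : compact (K_set T Phi F).
Proof.
have [C PC] := integral_vec_bounded X_compact Phi_cont.
apply: (subclosed_compact _ (@box_compact _ _ C)); last first.
  by move=> _ [mu _ <-] i; exact: PC.
move=> z clz; have [_ [mu0 mu0P _]] := K_set_nonempty.
have PW : ProperFilter (within (K_set T Phi F) (nbhs z)) := within_nbhs_proper clz.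
have [U [ultraU WU]] := ultraFilterLemma PW.
have PU := @ultra_proper _ _ ultraU; have FU : Filter U by exact: PU.
have /choice[m mP] : forall y, exists mu, nonlinear_equilibrium T Phi F mu /\
    (K_set T Phi F y -> integral_vec Phi mu = y).
  move=> y; have [[mu muP muy]|nK] := pselect (K_set T Phi F y); first by exists mu.
  by exists mu0.
have [mu inv mcvg] := weak_cvg_ultra X_compact T_cont ultraU (fun y => (mP y).1.1).
have Icvg := integral_vec_cvg Phi_cont FU mcvg.
have UK : U (K_set T Phi F) by apply: WU; exact: withinT.
have Iz : integral_vec Phi (m y) @[y --> U] --> z.
  move=> A zA; suff : U [set y | A (integral_vec Phi (m y))] by [].
  have UA : U A by apply: WU; exact: cvg_within zA.
  by apply: filterS (filterI UK UA) => y [Ky Ay] /=; rewrite (mP y).2.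
have muz : integral_vec Phi mu = z by apply: cvg_unique Icvg Iz; exact: norm_hausdorff.
exists mu => //; split=> //; apply/eqP; rewrite eq_le NP_ge// andbT.
have Fcvg : F (integral_vec Phi (m y)) @[y --> U] --> F (integral_vec Phi mu).
  by apply: (cvg_comp _ F Icvg); exact: F_cont.
apply: (le_entropy_cvg usc PU (fun y => (mP y).1.1) inv mcvg Fcvg) => c cNP.
by apply: filterE => y; rewrite -(mP y).1.2.
Qed.

Lemma h_sup_ge mu : invariant_measures T mu ->
  (entropy T mu <= h_sup T Phi (integral_vec Phi mu))%E.
Proof. by move=> inv; apply: ereal_sup_ubound; exists mu. Qed.

(** For the converse inclusion, the supremum [h_sup] over the fibre of [z] is attained
    ([entropy_attained] with the closed set [[set z]] and [G = 0]), and the maximising measure then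
    reaches the pressure. *)
Lemma K_set_maximizers : K_set T Phi F =
  [set z | L_set T Phi z /\ forall w, L_set T Phi w ->
     (h_sup T Phi w + (F w)%:E <= h_sup T Phi z + (F z)%:E)%E].
Proof.
apply/seteqP; split=> [_ [mu [inv muE] <-]|z [[mu0 inv0 mu0z] zmax]].
  split; first by exists mu.
  move=> w _; apply: (@le_trans _ _ NP); last by rewrite /NP muE leeD2r// h_sup_ge.
  rewrite -leeBrDr//; apply: ge_ereal_sup => _ [nu [invn nuw] <-].
  by rewrite leeBrDr// -nuw NP_ge.
have c0 : continuous (fun _ : 'rV[R]_d => 0 : R) by exact: cst_continuous.
have clz : closed [set z].
  by apply/accessible_closed_set1/hausdorff_accessible; exact: norm_hausdorff.
have [mu [inv muz mu_max]] := entropy_attained X_compact T_cont Phi_cont usc c0 clz inv0 mu0z.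
exists mu => //; split=> //; apply/eqP; rewrite eq_le NP_ge// andbT.
apply: NP_le => nu invn; apply: le_trans (leeD2r _ (h_sup_ge invn)) _.
apply: le_trans (zmax _ _) _; first by exists nu.
rewrite -muz leeD2r//; apply: ge_ereal_sup => _ [nu' [invn' nuz'] <-].
by have := mu_max nu' invn'; rewrite nuz' !adde0; apply; rewrite -muz.
Qed.

(** On the fibre of [z] the term [F] is constant, so the nonlinear equilibria over a point of
    [K_set] are the measures of maximal entropy there. The classical equilibrium [nu z] is the only
    one, up to [same_measure]. *)
Lemma nonlinear_equilibria_interior : K_set T Phi F `<=` (L_set T Phi)° ->
  exists nu : 'rV[R]_d -> probability (Borel X) R,
    (forall z, K_set T Phi F z ->
       [/\ M_fiber T Phi z (nu z),
           ergodic_measure (T : Borel X -> Borel X) (nu z)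
         & exists2 psi, span1 Phi psi & unique_classical_equilibrium T psi (nu z)]) /\
    (forall mu, nonlinear_equilibrium T Phi F mu <->
       exists2 z, K_set T Phi F z & same_measure mu (nu z)).
Proof.
move=> KL; have [_ [mu0 _ _]] := K_set_nonempty.
have /choice[nu nuP] : forall z, exists nu, K_set T Phi F z -> exists psi,
    [/\ span1 Phi psi, unique_classical_equilibrium T psi nu & integral_vec Phi nu = z].
  move=> z; have [Kz|nKz] := pselect (K_set T Phi F z); last by exists mu0.
  have [psi [nu nuP]] := interior_equilibrium X_compact T_cont Phi_cont usc
    unique_equilibria (KL _ Kz).
  by exists nu => _; exists psi.
exists nu; split=> [z /nuP[psi [sp uniq nuz]]|mu].
  split; first by split=> //; exact: uniq.1.1.
    by apply: unique_equilibrium_ergodic uniq => //; exact: span1_continuous sp.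
  by exists psi.
split=> [[inv muE]|[z Kz munu]].
  have Kmu : K_set T Phi F (integral_vec Phi mu) by exists mu.
  exists (integral_vec Phi mu) => //; have [psi [sp uniq nuz]] := nuP _ Kmu.
  apply: (classical_equilibrium_fiber X_compact Phi_cont sp uniq inv (esym nuz)).2.
  by have := NP_ge uniq.1.1; rewrite nuz muE leeD2rE.
have [psi [sp uniq nuz]] := nuP _ Kz; have [mu' [inv' mu'E] mu'z] := Kz.
have nuI : integral_vec Phi mu = z by rewrite (integral_vec_same Phi munu).
have inv : invariant_measures T mu.
  move=> A mA; have mTA := borel_preimage T_cont mA.
  by rewrite munu// munu//; exact: uniq.1.1.
split=> //; apply/eqP; rewrite eq_le NP_ge// andbT mu'E nuI mu'z.
rewrite leeD2r// (entropy_same T_cont munu).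
by apply: (classical_equilibrium_fiber X_compact Phi_cont sp uniq inv' _).1; rewrite nuz.
Qed.

End EquilibriumSet.

(** * Continuity of functions of class C^r, including the analytic case *)

Section SmoothContinuous.
Context {R : realType} {d : nat}.
Implicit Types (f : 'rV[R]_d -> R) (x v : 'rV[R]_d).

Lemma row_norm_lt (r : R) v : 0 < r -> (forall i, `|v ord0 i| < r) -> `|v| < r.
Proof.
move=> r0 vr; have : ball (0 : 'rV[R]_d) r v.
  by split=> // i j; rewrite (ord1 i) mxE /ball/= sub0r normrN.
by rewrite mx_norm_ball /ball_/= sub0r normrN.
Qed.

(** Terms of degree [n >= 1] shrink by [s ^ n <= s] when the coordinates shrink by [s]; the terms of
    degree 0 cancel. *)
Lemma homogeneous_part_dist (c : {ffun 'I_d -> nat} -> R) (u : R) v (s : R) n :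
  0 <= u -> 0 <= s <= 1 -> (forall i, `|v ord0 i| <= s * u) ->
  `|homogeneous_part c v n - homogeneous_part c 0 n| <=
  s * homogeneous_abs c (const_mx u) n.
Proof.
move=> u0 /andP[s0 s1] vu; rewrite /homogeneous_part /homogeneous_abs -sumrB.
apply: le_trans (ler_norm_sum _ _ _) _; rewrite mulr_sumr.
apply: ler_sum => a /eqP aE; rewrite /monomial_term -mulrBr !normrM mulrCA.
apply: ler_wpM2l => //.
have [n0|n0] := eqVneq n 0%N.
  have a0 i : nat_of_ord (a i) = 0%N.
    by have := leq_ord (a i); move: (nat_of_ord _) => k; rewrite n0 leqn0 => /eqP.
  rewrite [X in X - _]big1 => [|i _]; last by rewrite a0 expr0.
  rewrite [X in _ - X]big1 => [|i _]; last by rewrite a0 expr0.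
  by rewrite subrr normr0 mulr_ge0.
have [i ai] : exists i, (0 < a i)%N.
  apply: contrapT => na; move: n0; rewrite -aE big1// => i _.
  by apply/eqP; rewrite -leqn0 leqNgt; apply/negP => ai; apply: na; exists i.
rewrite [X in _ - X](bigD1 i)//= mxE expr0n eqn0Ngt ai/= mul0r subr0.
rewrite !normr_prod; apply: (@le_trans _ _ (\prod_i (s * u) ^+ a i)).
  apply: ler_prod => j _; rewrite normr_ge0 normrX /=.
  by apply: lerXn2r; rewrite ?nnegrE// mulr_ge0.
under eq_bigr do rewrite exprMn; rewrite big_split/=.
have -> : \prod_i `|(const_mx u : 'rV[R]_d) ord0 i ^+ a i| = \prod_i u ^+ a i.
  by apply: eq_bigr => j _; rewrite mxE ger0_norm// exprn_ge0.
apply: ler_wpM2r; first by apply: prodr_ge0 => j _; rewrite exprn_ge0.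
rewrite prodrXr aE -{2}(expr1 s); apply: ler_wiXn2l => //.
by rewrite lt0n.
Qed.

(** Absolute convergence at the single vector [const_mx u] controls all smaller vectors: by
    [homogeneous_part_dist] the increment of [f] is at most [s * A], where [A] is the sum there. *)
Lemma real_analytic_continuous f : real_analytic f -> continuous f.
Proof.
move=> fa x; have [c [e e0 fe]] := fa x.
pose u : R := e / 2; have u0 : 0 < u by rewrite divr_gt0.
have small v : (forall i, `|v ord0 i| <= u) -> `|v| < e.
  by move=> vu; apply: row_norm_lt => // i; apply: le_lt_trans (vu i) _; rewrite /u; lra.
have [Acvg _] : cvgn (series (homogeneous_abs c (const_mx u))) /\
    series (homogeneous_part c (const_mx u)) @ \oo --> f (x + const_mx u).
  by apply: fe; apply: small => i; rewrite mxE ger0_norm// ltW.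
pose A : R := limn (series (homogeneous_abs c (const_mx u))).
have abs0 n : 0 <= homogeneous_abs c (const_mx u) n by apply: sumr_ge0.
have AP N : series (homogeneous_abs c (const_mx u)) N <= A.
  by apply: nondecreasing_cvgn_le => //; apply: nondecreasing_series => n _ _.
have A0 : 0 <= A by apply: le_trans (AP 0%N); rewrite /series/= big_geq.
have fdist v (s : R) : 0 <= s <= 1 -> (forall i, `|v ord0 i| <= s * u) ->
    `|f (x + v) - f x| <= s * A.
  move=> s01 vs; have /andP[s0 s1] := s01.
  have [_ fv] : cvgn (series (homogeneous_abs c v)) /\
      series (homogeneous_part c v) @ \oo --> f (x + v).
    by apply: fe; apply: small => i; apply: le_trans (vs i) _; rewrite ler_piMl// ltW.
  have [_ f0] : cvgn (series (homogeneous_abs c 0)) /\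
      series (homogeneous_part c 0) @ \oo --> f (x + 0).
    by apply: fe; rewrite normr0.
  rewrite addr0 in f0; apply: (cvgr_to_le (cvg_norm (cvgB fv f0))).
  apply: nearW => N.
  suff : `|series (homogeneous_part c v) N - series (homogeneous_part c 0) N| <= s * A by [].
  rewrite /series/= -sumrB.
  apply: le_trans (ler_norm_sum _ _ _) _; apply: le_trans (ler_wpM2l s0 (AP N)).
  rewrite /series/= mulr_sumr; apply: ler_sum => n _.
  exact: homogeneous_part_dist (ltW u0) s01 vs.
apply/(@cvgrPdist_le _ _ _ _ (nbhs_filter x)) => ep ep0; pose s := Num.min 1 (ep / (A + 1)).
have A1 : 0 < A + 1 by rewrite ltr_wpDl.
have s0 : 0 < s by rewrite lt_min ltr01 divr_gt0.
have s1 : s <= 1 by rewrite ge_min lexx.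
have sA : s * A <= ep.
  apply: (@le_trans _ _ (ep / (A + 1) * A)).
    by rewrite ler_wpM2r// ge_min lexx orbT.
  by rewrite mulrAC ler_pdivrMr// ler_wpM2l ?(ltW ep0)// lerDl.
rewrite near_simpl; apply/nbhs_ballP; exists (s * u); first exact: mulr_gt0.
move=> y [_ xy]; rewrite distrC; apply: le_trans sA.
have -> : f y = f (x + (y - x)) by rewrite addrCA subrr addr0.
apply: fdist; first by rewrite (ltW s0).
by move=> i; rewrite !mxE distrC ltW//; exact: xy.
Qed.

Lemma Cr_continuous r f : smoothness_ge2 r -> Cr r f -> continuous f.
Proof.
case: r => [[|k]//|_ /(_ 0%N)//|_]; last exact: real_analytic_continuous.
by move=> _ [fd _] x; exact: differentiable_continuous.
Qed.

End SmoothContinuous.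

Theorem theorem6 (R : realType) (X : pmetricType R) (T : X -> X)
    (d : nat) (Phi : 'I_d -> X -> R) (r : smoothness) (F : 'rV[R]_d -> R)
    (X_compact : compact [set: X]) (T_cont : continuous T)
    (d_gt0 : (0 < d)%N) (Phi_cont : forall i, continuous (Phi i))
    (r_ge2 : smoothness_ge2 r) (TPhi_regular : regular_pair T Phi r)
    (F_Cr : Cr r F) :
  [/\ K_set T Phi F !=set0 /\ compact (K_set T Phi F),
      K_set T Phi F =
        [set z | L_set T Phi z /\
                 forall w, L_set T Phi w ->
                   (h_sup T Phi w + (F w)%:E <= h_sup T Phi z + (F z)%:E)%E]
    & K_set T Phi F `<=` (L_set T Phi)° ->
      exists nu : 'rV[R]_d -> probability (Borel X) R,
        (forall z, K_set T Phi F z ->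
           [/\ M_fiber T Phi z (nu z),
               ergodic_measure (T : Borel X -> Borel X) (nu z)
             & exists2 psi, span1 Phi psi &
                 unique_classical_equilibrium T psi (nu z)]) /\
        (forall mu : probability (Borel X) R,
           nonlinear_equilibrium T Phi F mu <->
           exists2 z, K_set T Phi F z & same_measure mu (nu z))].
Proof.
case: TPhi_regular => unique_equilibria _ usc.
have F_cont := Cr_continuous r_ge2 F_Cr; split.
- split; first exact: K_set_nonempty.
  exact: K_set_compact.
- exact: K_set_maximizers.
- exact: nonlinear_equilibria_interior.
Qed.
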